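(* Assume SETH. For every $\delta > 0$, $C > 1$ and $\gamma < 3$ there exists $c = c(\delta, C)$ such that $\gamma$-ANN under the $\ell_\infty$ norm cannot be solved with $N^C$ preprocessing time and $N^{1-\delta}$ query time on instances with dimension $d = c \log N$, where $N$ is the number of data points.
   Context: SETH: for every $\varepsilon > 0$ there exists $k = k(\varepsilon)$ such that $k$-SAT on $n$ variables cannot be solved in time $2^{(1-\varepsilon)n}$. $\gamma$-ANN under the $\ell_\infty$ norm: a set $A \subset \mathbb{R}^d$ of $N$ points is first preprocessed; then, given numbers $\gamma > 1$, $r > 0$ and a query $x \in \mathbb{R}^d$, one must distinguish between (YES) there exists $a \in A$ with $\|a-x\|_\infty \le r$, and (NO) for all $a \in A$, $\|a-x\|_\infty \ge \gamma r$. *)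

(* Defs.v *)
From mathcomp Require Import all_boot all_order all_algebra.
From mathcomp Require Import reals exp normedtype.

Set Implicit Arguments.
Unset Strict Implicit.
Unset Printing Implicit Defensive.

Import Order.TTheory GRing.Theory Num.Theory numFieldNormedType.Exports.

Local Open Scope ring_scope.

(** * Word RAM

Deterministic while-programs over finitely many registers (those named in the
program text) and a random-access memory, all holding natural numbers, with a
read-only random-access input.  Every instruction and every test costs one
unit of time.

The semantics is parameterized by a word length [w]: a run is legal only if
each number it produces is below [2 ^ w].  There is no wrap-around; an
overflowing run is simply not a run.  Hence [w] is a resource bound, exactly
like time, and a run legal for [w] is legal for every larger word length. *)

Inductive binop :=
  | Add | Sub | Mul | Div | Mod | BitAnd | BitOr | BitXor | Shl | Shr | Lt | Eq.

Definition eval_binop (o : binop) (a b : nat) : nat :=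
  match o with
  | Add => (a + b)%N
  | Sub => (a - b)%N
  | Mul => (a * b)%N
  | Div => (a %/ b)%N
  | Mod => (a %% b)%N
  | BitAnd => Nat.land a b
  | BitOr => Nat.lor a b
  | BitXor => Nat.lxor a b
  | Shl => (a * 2 ^ b)%N
  | Shr => (a %/ 2 ^ b)%N
  | Lt => (a < b)%N
  | Eq => (a == b)%N
  end.

(* Arguments other than the literal of [Const] are register names; [ReadMem y]
   and [ReadInput y] use the content of register [y] as an address. *)
Inductive rhs :=
  | Const of nat
  | Bin of binop & nat & nat
  | ReadMem of nat
  | ReadInput of nat.

Inductive cmd :=
  | Skip
  | Assign of nat & rhs
  | WriteMem of nat & nat
  | Seq of cmd & cmd
  | If of nat & cmd & cmd
  | While of nat & cmd.

Record state := State { reg : nat -> nat; mem : nat -> nat }.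

Definition init (m : nat -> nat) : state := State (fun=> 0%N) m.

Definition empty_mem : nat -> nat := fun=> 0%N.

Definition eval_rhs (inp : seq nat) (s : state) (e : rhs) : nat :=
  match e with
  | Const v => v
  | Bin o y z => eval_binop o (reg s y) (reg s z)
  | ReadMem y => mem s (reg s y)
  | ReadInput y => nth 0%N inp (reg s y)
  end.

(* [exec inp w c s s' t]: on input [inp] with word length [w], command [c]
   started in [s] halts in [s'] after [t] steps. *)
Inductive exec (inp : seq nat) (w : nat) : cmd -> state -> state -> nat -> Prop :=
  | exec_skip s : exec inp w Skip s s 1
  | exec_assign x e s : (eval_rhs inp s e < 2 ^ w)%N ->
      exec inp w (Assign x e) s
        (State [eta reg s with x |-> eval_rhs inp s e] (mem s)) 1
  | exec_write x y s :
      exec inp w (WriteMem x y) s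
        (State (reg s) [eta mem s with reg s x |-> reg s y]) 1
  | exec_seq c1 c2 s s1 s2 t1 t2 :
      exec inp w c1 s s1 t1 -> exec inp w c2 s1 s2 t2 ->
      exec inp w (Seq c1 c2) s s2 (t1 + t2)
  | exec_if_true x c1 c2 s s' t : reg s x != 0%N ->
      exec inp w c1 s s' t -> exec inp w (If x c1 c2) s s' t.+1
  | exec_if_false x c1 c2 s s' t : reg s x = 0%N ->
      exec inp w c2 s s' t -> exec inp w (If x c1 c2) s s' t.+1
  | exec_while_false x c s : reg s x = 0%N ->
      exec inp w (While x c) s s 1
  | exec_while_true x c s s1 s2 t1 t2 : reg s x != 0%N ->
      exec inp w c s s1 t1 -> exec inp w (While x c) s1 s2 t2 ->
      exec inp w (While x c) s s2 (t1 + t2).+1.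

(* The answer is read off register 0. *)
Definition answers (R : realType) (inp : seq nat) (w : nat) (P : cmd)
    (m : nat -> nat) (T : R) (b : bool) : Prop :=
  exists s t, [/\ exec inp w P (init m) s t, t%:R <= T & (reg s 0 != 0%N) = b].

(** * k-SAT and SETH *)

(* The literal [(b, i)] is satisfied by [v] when [v i = b]. *)
Definition literal (n : nat) : Type := (bool * 'I_n)%type.
Definition cnf (n : nat) : Type := seq (seq (literal n)).

Definition satisfies n (v : {ffun 'I_n -> bool}) (F : cnf n) : bool :=
  all (has (fun l : literal n => v l.2 == l.1)) F.

Definition satisfiable n (F : cnf n) : bool :=
  [exists v : {ffun 'I_n -> bool}, satisfies v F].

(* Without [uniq] the input length would not be polynomial in [n], and no time
   bound depending on [n] alone could be met. *)
Definition is_kcnf (k n : nat) (F : cnf n) : bool :=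
  uniq F && all (fun C : seq (literal n) => size C <= k)%N F.

Definition encode_cnf n (F : cnf n) : seq nat :=
  n :: size F ::
  flatten [seq size C :: flatten [seq [:: nat_of_bool l.1; nat_of_ord l.2]
                                 | l : literal n <- C]
          | C : seq (literal n) <- F].

(* k-SAT on [n] variables is solved in time O(T n), with words of O(n) bits
   (enough to address exponentially large memories). *)
Definition ksat_solvable_in_time (R : realType) (k : nat) (T : nat -> R) : Prop :=
  exists (P : cmd) (W : nat) (K : R),
  forall (n : nat) (F : cnf n), is_kcnf k F ->
    answers (encode_cnf F) (W * n.+1) P empty_mem (K * T n) (satisfiable F).

Definition SETH (R : realType) : Prop :=
  forall eps : R, 0 < eps ->
  exists k : nat,
    ~ ksat_solvable_in_time k (fun n => 2 `^ ((1 - eps) * n%:R) : R).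

(** * Approximate nearest neighbours in the sup norm *)

(* Points have rational coordinates so that they can be input to a program. *)
Definition real_point (R : realType) d (v : 'rV[rat]_d) : 'rV[R]_d :=
  map_mx ratr v.

(* [`| _ |] on ['rV[R]_d] is the sup norm (see [mx_norm]). *)
Definition ann_yes (R : realType) N d (A : 'I_N -> 'rV[rat]_d)
    (r : rat) (x : 'rV[rat]_d) : Prop :=
  exists i : 'I_N, `|real_point R (A i) - real_point R x| <= ratr r.

Definition ann_no (R : realType) (gamma : R) N d (A : 'I_N -> 'rV[rat]_d)
    (r : rat) (x : 'rV[rat]_d) : Prop :=
  forall i : 'I_N, gamma * ratr r <= `|real_point R (A i) - real_point R x|.

Definition has_bits (L : nat) (q : rat) : bool :=
  (`|numq q| < 2 ^ L)%N && (`|denq q| < 2 ^ L)%N.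

Definition encode_rat (q : rat) : seq nat :=
  [:: nat_of_bool (q < 0); `|numq q|%N; `|denq q|%N].

Definition encode_point d (v : 'rV[rat]_d) : seq nat :=
  flatten [seq encode_rat (v 0 j) | j <- enum 'I_d].

Definition encode_points N d (A : 'I_N -> 'rV[rat]_d) : seq nat :=
  N :: d :: flatten [seq encode_point (A i) | i <- enum 'I_N].

Definition encode_query d (r : rat) (x : 'rV[rat]_d) : seq nat :=
  encode_rat r ++ encode_point x.

(* Number of binary digits of [N] (for [N > 0]). *)
Definition log_bits (N : nat) : nat := (trunc_log 2 N).+1.

(* [Pre] builds the data structure in memory from the points alone; [Query]
   starts from that memory and sees only the query.  [A] enumerates a set of
   exactly [N] points.  All numbers in an instance have [b * log_bits N] bits,
   for an arbitrary constant [b] on which the word length and the constants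
   hidden in the time bounds may depend. *)
Definition ann_solvable_in_time (R : realType) (gamma : R) (dim : nat -> nat)
    (Tpre Tquery : nat -> R) : Prop :=
  exists Pre Query : cmd,
  forall b : nat,
  exists (W : nat) (K : R),
  forall (N d : nat) (A : 'I_N -> 'rV[rat]_d),
    (0 < N)%N -> d = dim N -> injective A ->
    (forall i j, has_bits (b * log_bits N) (A i 0 j)) ->
    exists (s : state) (t : nat),
    [/\ exec (encode_points A) (W * log_bits N) Pre (init empty_mem) s t,
        t%:R <= K * Tpre N &
        forall (r : rat) (x : 'rV[rat]_d),
          0 < r -> has_bits (b * log_bits N) r ->
          (forall j, has_bits (b * log_bits N) (x 0 j)) ->
          (ann_yes R A r x ->
             answers (encode_query r x) (W * log_bits N) Query (mem s)
               (K * Tquery N) true) /\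
          (ann_no gamma A r x ->
             answers (encode_query r x) (W * log_bits N) Query (mem s)
               (K * Tquery N) false)].

Definition log_dim (R : realType) (c : R) (N : nat) : nat :=
  Num.truncn (c * (ln N%:R / ln 2)).

(* Main.v *)
(** Split the variables into a first block of about [n / s] variables, with
    [s > 2 C], and the rest.  Assignments of the first block are the data points
    and assignments of the rest are the queries; a clause is a coordinate.  A data
    point that falsifies its part of the clause has entry [3 N], otherwise [- N];
    a query that falsifies its part has [- 3 N], otherwise [N].  The two are at
    distance [6 N] if some clause is falsified and within [2 N] otherwise, so any
    [gamma < 3] separates the cases; one more, small coordinate only makes the
    data points distinct.

    The dimension must be linear in [n], so the formula is sparsified first
    (Impagliazzo, Paturi and Zane).  If many minimal clauses [C] of equal size
    share a heart [H], branch on adding [H] or adding all petals [C :\: H], always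
    taking a flower of lexicographically least (clause size, petal size).  The
    formula only grows, and its minimal clauses stay sparse.  Few clauses of each
    size are ever added, and a petal branch adds many at once, so petal branches
    are rare and there are only [2 ^ (rho n / 4)] leaves.

    The data structure is built once per leaf, whereas its query program may
    overwrite it; each overwritten cell is therefore logged, and a query is undone
    at a cost proportional to its running time. *)

(* The exponents are budgeted as follows. A block of about [n / s] variables gives [N] about
   [2 ^ (n / s)]; preprocessing costs [N ^ C], about [2 ^ (n / 2)] at most because [s > 2 C]. The
   remaining assignments, about [2 ^ (n - n / s)] of them, are queried in time about
   [2 ^ (n - delta n / s)], to which writing the queries adds about [2 ^ (n - n / s)]. With [rho]
   the minimum of [1 / s] and [delta / s], a leaf thus takes about [2 ^ ((1 - rho) n)], and
   [2 ^ (rho n / 4)] leaves with subexponential bookkeeping stay below [2 ^ ((1 - rho / 2) n)]. SETH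
   at [rho / 2] supplies [k], and the dimension constant is computed from [s] and [k], hence before
   [gamma] is given.

   SETH speaks of one program for all [n], so the reduction itself has to run on the word RAM. For
   fixed [k] there are only polynomially many clauses, so a formula is stored as a characteristic
   vector over clause codes and every test on it is a brute-force sum. All data are bounded by one
   [Y] of size [2 ^ O(n)] and all intermediate values by a fixed power of [Y], so words of [O(n)]
   bits suffice. *)
From mathcomp Require Import all_boot all_order all_algebra zify ring lra.
From mathcomp Require Import reals sequences exp normedtype.
Require Import Defs.
From Stdlib Require Import FunctionalExtensionality.

Set Implicit Arguments.
Unset Strict Implicit.
Unset Printing Implicit Defensive.

(** * Sparsification of k-CNF formulas *)
Section Sparsify.
Variables (L : finType) (th : nat -> nat).
Implicit Types (C D H : {set L}) (F : {set {set L}}).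

Definition minimal F := [set C in F | [forall D in F, ~~ (D \proper C)]].

Definition corolla F (s : nat) H :=
  [set C in minimal F | (H \subset C) && (#|C| == s)].

Definition petals F s H := [set C :\: H | C in corolla F s H].

Definition flower F (s i : nat) H :=
  [&& 0 < #|H|, 0 < i, #|H| + i == s & th i <= #|corolla F s H|].

Definition first_flower F (s i : nat) H := flower F s i H /\
  forall s' i' H', flower F s' i' H' -> s < s' \/ s = s' /\ i <= i'.

Lemma minimalP F C :
  reflect (C \in F /\ forall D, D \in F -> ~~ (D \proper C)) (C \in minimal F).
Proof. by rewrite inE; apply: (iffP andP) => -[? /forall_inP]. Qed.

Lemma minimal_exists F C : C \in F -> exists2 D, D \in minimal F & D \subset C.
Proof.
move=> CF; have /minset_exists[D /minsetP[DF minD] sDC] : C \in F by [].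
exists D => //; apply/minimalP; split=> // E EF.
apply/negP => pE; move: (pE); rewrite properEneq => /andP[/eqP + sED].
by apply; exact: minD.
Qed.

Definition of_size (s : nat) F := [set C in F | #|C| == s].

(* What both branches have in common: every added clause lies strictly inside
   a minimal one, and all have the same size [r]. *)
Record admissible F (New : {set {set L}}) r : Prop := Admissible {
  adm_size : forall D, D \in New -> #|D| = r;
  adm_gt0 : 0 < r;
  adm_sub : forall D, D \in New -> exists2 C, C \in minimal F & D \proper C;
  adm_old : forall H, 0 < #|H| < r -> #|corolla F r H| <= th (r - #|H|);
  adm_new : forall H, 0 < #|H| < r ->
    #|[set D in New | H \subset D]| <= th (r - #|H|) }.

(** An added clause is alive while it is minimal. The factor 2 in [spread_alive] allows one
    threshold for the clauses present before a batch of the same size ([adm_old]) and one for the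
    batch itself ([adm_new]). A dead clause is charged to an added clause that was put strictly
    inside it while it was alive; this is the sum in [spread_dead]. *)
Record spread (F0 F : {set {set L}}) : Prop := Spread {
  spread_alive : forall H s, 0 < #|H| < s ->
    #|corolla F s H :\: F0| <= 2 * th (s - #|H|);
  spread_dead : forall s, #|of_size s (F :\: F0 :\: minimal F)| <=
    \sum_(j < s) 2 * th (s - j) * #|of_size j (F :\: F0)|;
  spread_nonempty : set0 \notin F :\: F0;
  spread_sub : F0 \subset F }.

Lemma spread0 F : spread F F.
Proof.
split=> [H s _|s||]; rewrite ?setDv ?subxx ?inE//.
- rewrite (_ : _ :\: _ = set0) ?cards0//; apply/setP => C.
  by rewrite !inE; case: (C \in F).
- rewrite (_ : of_size _ _ = set0) ?cards0//; apply/setP => C.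
  by rewrite !inE andbF.
Qed.

(** New clauses lie strictly inside minimal ones and have equal sizes, so they contain no other
    clause and are minimal at once. Only corollas of size [r] can therefore grow; all others can
    only shrink. *)
Lemma spread_step F0 F New r :
  admissible F New r -> spread F0 F -> spread F0 (F :|: New).
Proof.
move=> [szN r0 subN oldN newN] [alive dead ne sF].
have NF D : D \in New -> D \notin F.
  move=> /subN[C /minimalP[_ mC] pDC]; apply: contraL pDC; exact: mC.
have NnoF D E : D \in New -> E \in F -> ~~ (E \subset D).
  move=> /subN[C /minimalP[_ mC] pDC] /mC; apply: contra => sED.
  exact: sub_proper_trans sED pDC.
have minold C : C \in F -> C \in minimal (F :|: New) -> C \in minimal F.
  move=> CF /minimalP[_ mC]; apply/minimalP; split=> // D DF.
  by apply: mC; rewrite inE DF.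
have Nmin D : D \in New -> D \in minimal (F :|: New).
  move=> DN; apply/minimalP; split; first by rewrite inE DN orbT.
  move=> E; rewrite inE => /orP[EF|EN].
    by apply: contra (NnoF _ _ DN EF) => /proper_sub.
  by apply/negP => /proper_card; rewrite !szN// ltnn.
have NF0 : [disjoint F :\: F0 & New].
  rewrite -setI_eq0; apply/eqP/setP => D; rewrite !inE.
  by apply/negP => /andP[/andP[_ DF] /NF]; rewrite DF.
have defD : (F :|: New) :\: F0 = (F :\: F0) :|: New.
  apply/setP => D; rewrite !inE; case: (boolP (D \in New)) => [/NF|] h;
    rewrite ?orbF// !orbT andbT.
  by apply: contra h => /(subsetP sF).
have cardS s : #|of_size s ((F :|: New) :\: F0)| =
    #|of_size s (F :\: F0)| + #|of_size s New|.
  have e0 : of_size s (F :\: F0) :&: of_size s New = set0.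
    apply/setP => D; rewrite !inE; apply/negP => /andP[/andP[/andP[_ DF] _]].
    by case/andP=> /NF; rewrite DF.
  rewrite defD -cardsUI e0 cards0 addn0.
  by apply: eq_card => D; rewrite !inE; case: (#|D| == s); rewrite ?andbF ?andbT.
have cardN : of_size r New = New.
  by apply/setP => D; rewrite !inE; case: (boolP (D \in New)) => // /szN ->; rewrite eqxx.
have cardN0 s : s != r -> of_size s New = set0.
  move=> sr; apply/setP => D; rewrite !inE; apply/negP => /andP[/szN ->] /eqP e.
  by rewrite e eqxx in sr.
split.
- move=> H s Hs; have [e|sr] := eqVneq s r.
    subst s; rewrite mul2n -addnn.
    apply: leq_trans (leq_add (oldN _ Hs) (newN _ Hs)).
    apply: leq_trans (leq_card_setU _ _); apply/subset_leq_card/subsetP => C.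
    case/setDP; rewrite inE => /and3P[CM sHC szC] CF0.
    have /minimalP[+ _] := CM; rewrite inE => /orP[CF|CN]; last first.
      by apply/setUP; right; rewrite inE CN.
    by apply/setUP; left; rewrite inE (minold _ CF CM) sHC.
  apply: leq_trans (alive H s Hs); apply/subset_leq_card/subsetP => C.
  case/setDP; rewrite inE => /and3P[CM sHC szC] CF0.
  have /minimalP[+ _] := CM; rewrite inE => /orP[CF|CN]; last first.
    by move/eqP: szC sr; rewrite szN// => ->; rewrite eqxx.
  by apply/setDP; split=> //; rewrite inE (minold _ CF CM) sHC.
(* A clause that stops being minimal lies in the corolla of a new clause, and the old [spread_alive]
   bounds that corolla. *)
- move=> s; pose kill D := corolla F s D :\: F0.
  have sub : of_size s ((F :|: New) :\: F0 :\: minimal (F :|: New)) \subset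
     of_size s (F :\: F0 :\: minimal F) :|: \bigcup_(D in New) kill D.
    apply/subsetP => C; rewrite inE => /andP[/setDP[/setDP[CF' CF0] CnM] szC].
    have CF : C \in F.
      move: CF'; rewrite inE => /orP[//|/Nmin]; by rewrite (negbTE CnM).
    rewrite inE; apply/orP; case: (boolP (C \in minimal F)) => CM; last first.
      by left; rewrite inE szC andbT; apply/setDP; split=> //; apply/setDP.
    right; move: CnM; rewrite inE CF' /= => /forall_inPn[D D' /negPn pDC].
    apply/bigcupP; exists D.
      move: D'; rewrite inE => /orP[DF|//].
      by have /minimalP[_ /(_ _ DF)] := CM; rewrite pDC.
    by apply/setDP; split=> //; rewrite inE CM (proper_sub pDC).
  apply: leq_trans (subset_leq_card sub) _.
  apply: leq_trans (leq_card_setU _ _) _.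
  under [X in _ <= X]eq_bigr do rewrite cardS mulnDr.
  rewrite big_split /=; apply: leq_add; first exact: dead.
  (* A new clause has size [r] and only kills strictly larger clauses. *)
  have [sr|rs] := leqP s r.
    rewrite big1 ?cards0// => D DN; apply/setP => C; rewrite [RHS]inE.
    apply/negP => /setDP[]; rewrite inE => /and3P[CM sDC /eqP szC] CF0.
    have /minimalP[CF _] := CM.
    have : ~~ (D \proper C).
      by apply/negP => /proper_card; rewrite (szN _ DN) szC ltnNge sr.
    rewrite properEneq sDC andbT negbK => /eqP e.
    by have := NF _ DN; rewrite e CF.
  rewrite (bigD1 (Ordinal rs)) //= cardN; apply: leq_trans (leq_addr _ _).
  apply: leq_trans (_ : \sum_(D in New) #|kill D| <= _).
    elim/big_rec2: _ => [|D n B DN le]; first by rewrite cards0.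
    by apply: leq_trans (leq_card_setU _ _) _; rewrite leq_add2l.
  rewrite mulnC -sum_nat_const; apply: leq_sum => D DN.
  by rewrite -(szN _ DN) alive// szN// r0 rs.
- rewrite defD inE negb_or ne; apply/negP => /szN; rewrite cards0 => e.
  by rewrite -e in r0.
- exact: subset_trans sF (subsetUl _ _).
Qed.

Hypothesis th_gt0 : forall i, 0 < th i.

Lemma flower_size F s i H : flower F s i H -> exists2 C, C \in F & #|C| = s.
Proof.
move=> /and4P[_ _ _ /(leq_trans (th_gt0 _))] /card_gt0P[C].
by rewrite inE => /and3P[/minimalP[CF _] _ /eqP <-]; exists C.
Qed.

(** Otherwise [D] would be the heart of a flower with clause size [r < s], against the choice of the
    first flower. *)
Lemma small_corolla F s i H r D : first_flower F s i H -> r < s ->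
  0 < #|D| < r -> #|corolla F r D| <= th (r - #|D|).
Proof.
move=> [_ min] rs /andP[D0 Dr]; apply: ltnW; rewrite ltnNge; apply/negP => le.
have : s < r \/ s = r /\ i <= r - #|D|; last by lia.
by apply: (min _ _ D); rewrite /flower D0 subn_gt0 Dr le subnKC ?eqxx// ltnW.
Qed.

Lemma admissible_heart F s i H :
  first_flower F s i H -> admissible F [set H] #|H|.
Proof.
move=> ff; have [/and4P[H0 i0 /eqP Hs cH] min] := ff; split=> //.
- by move=> D /set1P ->.
- move=> D /set1P ->; have := leq_trans (th_gt0 _) cH => /card_gt0P[C].
  rewrite inE => /and3P[CM sHC /eqP szC]; exists C => //.
  by rewrite properEcard sHC szC -Hs -addn1 leq_add2l.
- by move=> D; apply: small_corolla ff _; rewrite -Hs -addn1 leq_add2l.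
- move=> D _; apply: leq_trans (th_gt0 _); rewrite -(cards1 H).
  by apply/subset_leq_card/subsetP => E; rewrite !inE => /andP[].
Qed.

Lemma card_petals F s H : #|petals F s H| = #|corolla F s H|.
Proof.
apply: card_in_imset => C D; rewrite !inE => /and3P[_ sHC _] /and3P[_ sHD _] e.
by rewrite -(setID C H) -(setID D H) e !(setIidPr _).
Qed.

(** This is where the petal size enters the order. Petals that share a set [D] come from clauses
    that share [H :|: D]; more than [th (i - #|D|)] of them would form a flower with the same clause
    size and smaller petals. *)
Lemma admissible_petals F s i H :
  first_flower F s i H -> admissible F (petals F s H) i.
Proof.
move=> ff; have [/and4P[H0 i0 /eqP Hs cH] min] := ff.
have is_ : i < s by lia.
split=> //.
- move=> D /imsetP[C]; rewrite inE => /and3P[_ sHC /eqP szC] ->.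
  by rewrite cardsD (setIidPr sHC) szC -Hs addKn.
- move=> D /imsetP[C]; rewrite inE => /and3P[CM sHC /eqP szC] ->.
  exists C => //; rewrite properEcard subDset subsetUr/=.
  by rewrite cardsD (setIidPr sHC) szC -Hs addKn; lia.
- by move=> D; apply: small_corolla ff _.
- move=> D /andP[D0 Di].
  case: (set_0Vmem [set E in petals F s H | D \subset E]) => [->|[E0]].
    by rewrite cards0.
  rewrite inE => /andP[/imsetP[C0 _ ->]]; rewrite subsetD => /andP[_ dDH].
  have cHD : #|H :|: D| = #|H| + #|D|.
    rewrite cardsU (_ : H :&: D = set0) ?cards0 ?subn0//.
    by apply/eqP; rewrite setI_eq0 disjoint_sym.
  apply: leq_trans (_ : #|corolla F s (H :|: D)| <= _).
    apply: leq_trans (leq_imset_card (fun C => C :\: H) _).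
    apply/subset_leq_card/subsetP => E; rewrite inE.
    move=> /andP[/imsetP[C]]; rewrite inE => /and3P[CM sHC szC] -> sDC.
    apply/imsetP; exists C => //; rewrite inE CM subUset sHC szC.
    by rewrite (subset_trans sDC) ?subsetDl.
  apply: ltnW; rewrite ltnNge; apply/negP => le.
  have : s < s \/ s = s /\ i <= i - #|D|; last by lia.
  apply: (min _ _ (H :|: D)).
  by rewrite /flower cHD addn_gt0 H0 subn_gt0 Di le /= andbT; apply/eqP; lia.
Qed.

(** The first number is the depth of the node, the second counts the petal branches on the way to
    it. *)
Inductive branches (F0 : {set {set L}}) : nat -> nat -> {set {set L}} -> Prop :=
  | branches_root : branches F0 0 0 F0
  | branches_heart a p F s i H : branches F0 a p F -> first_flower F s i H ->
      branches F0 a.+1 p (H |: F)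
  | branches_petals a p F s i H : branches F0 a p F -> first_flower F s i H ->
      branches F0 a.+1 p.+1 (F :|: petals F s H).

Lemma branches_spread F0 a p F : branches F0 a p F -> spread F0 F.
Proof.
elim=> [|{}a {}p {}F s i H _ IH ff|{}a {}p {}F s i H _ IH ff].
- exact: spread0.
- by rewrite setUC; apply: spread_step IH; exact: admissible_heart ff.
- by apply: spread_step IH; exact: admissible_petals ff.
Qed.

Lemma branches_size k F0 a p F : {in F0, forall C, #|C| <= k} ->
  branches F0 a p F -> {in F, forall C, #|C| <= k}.
Proof.
move=> h0; elim=> // {}a {}p {}F s i H _ IH [ff _] C;
  have [D /IH Dk Ds] := flower_size ff; case/and4P: ff => H0 i0 /eqP e _.
- by rewrite !inE => /orP[/eqP ->|/IH//]; lia.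
- rewrite inE => /orP[/IH//|/imsetP[E]]; rewrite inE => /and3P[EM _ _] ->.
  by apply: leq_trans (subset_leq_card (subsetDl _ _)) _; apply: IH; case/minimalP: EM.
Qed.

(* [wt] is meant to be about [X / th], so that one batch of petals weighs [X]. *)
Lemma branches_weight k (wt : nat -> nat) X F0 a p F :
  {in F0, forall C, #|C| <= k} ->
  (forall i, 0 < i < k -> X <= wt i * th i) ->
  branches F0 a p F ->
  a <= #|F :\: F0| /\ p * X <= \sum_(C in F :\: F0) wt #|C|.
Proof.
move=> h0 hX; elim=> [|{}a {}p {}F s i H br [IHa IHp] ff|{}a {}p {}F s i H br [IHa IHp] ff].
- by rewrite mul0n.
- have [_ _ + _ _] := admissible_heart ff => /(_ H (set11 _)) [C CM pHC].
  have HF : H \notin F.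
    by apply: contraL pHC; case/minimalP: CM => _; exact.
  have sF := spread_sub (branches_spread br).
  have HF0 : H \notin F0 by apply: contra HF; exact: (subsetP sF).
  have -> : (H |: F) :\: F0 = H |: (F :\: F0).
    by apply/setP => D; rewrite !inE; case: eqVneq => [->|//]; rewrite HF0.
  have HD : H \notin F :\: F0 by rewrite inE (negbTE HF) andbF.
  rewrite cardsU1 HD ltnS; split=> //.
  by rewrite big_setU1 //=; apply: leq_trans IHp (leq_addl _ _).
- have [szN _ subN _ _] := admissible_petals ff.
  have NF D : D \in petals F s H -> D \notin F.
    by move=> /subN[C /minimalP[_ mC] pDC]; apply: contraL pDC; exact: mC.
  have sF := spread_sub (branches_spread br).
  have [/and4P[H0 i0 /eqP Hs cH] min] := ff.
  have ik : 0 < i < k.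
    have [D DF Ds] := flower_size ff.1.
    by have := branches_size h0 br DF; lia.
  have -> : (F :|: petals F s H) :\: F0 = (F :\: F0) :|: petals F s H.
    apply/setP => D; rewrite !inE; case: (boolP (D \in petals F s H)) => [/NF|] h;
      rewrite ?orbF// !orbT andbT.
    by apply: contra h => /(subsetP sF).
  have dis : [disjoint F :\: F0 & petals F s H].
    rewrite -setI_eq0; apply/eqP/setP => D; rewrite !inE.
    by apply/negP => /andP[/andP[_ DF] /NF]; rewrite DF.
  have cP : th i <= #|petals F s H| by rewrite card_petals.
  split.
    move: (leq_card_setU (F :\: F0) (petals F s H)) => [_].
    by rewrite dis => /eqP ->; rewrite -addn1 leq_add// (leq_trans (th_gt0 i)).
  rewrite (eq_bigl [predU F :\: F0 & petals F s H]) => [|D]; last by rewrite !inE.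
  rewrite bigU//= mulSn addnC; apply: leq_add => //.
  apply: leq_trans (hX _ ik) _; rewrite (eq_bigr (fun=> wt i)).
    by rewrite sum_nat_const mulnC leq_mul.
  by move=> D /szN ->.
Qed.

Lemma card_le_literals F s c : 0 < s ->
  (forall x : L, #|[set C in F | (x \in C) && (#|C| == s)]| <= c) ->
  #|of_size s F| <= #|L| * c.
Proof.
move=> s0 h; apply: leq_trans (_ : \sum_(x : L) #|[set C in F | (x \in C) && (#|C| == s)]| <= _).
  apply: leq_trans (_ : #|\bigcup_x [set C in F | (x \in C) && (#|C| == s)]| <= _).
    apply/subset_leq_card/subsetP => C; rewrite inE => /andP[CF /eqP Cs].
    have /card_gt0P[x xC] : 0 < #|C| by rewrite Cs.
    by apply/bigcupP; exists x; rewrite // inE CF xC Cs eqxx.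
  elim/big_rec2: _ => [|x n B _ le]; first by rewrite cards0.
  by apply: leq_trans (leq_card_setU _ _) _; rewrite leq_add2l.
by rewrite -sum_nat_const; apply: leq_sum => x _.
Qed.

Lemma card_singletons F : #|of_size 1 F| <= #|L|.
Proof.
rewrite -cardsT; apply: leq_trans (leq_imset_card (@set1 L) _).
apply/subset_leq_card/subsetP => C; rewrite inE => /andP[_ /cards1P[x ->]].
by apply/imsetP; exists x.
Qed.

Lemma card_by_size k F : {in F, forall C, #|C| <= k} ->
  #|F| = \sum_(s < k.+1) #|of_size s F|.
Proof.
move=> h; rewrite -sum1_card (partition_big (fun C => inord #|C| : 'I_k.+1) xpredT)//=.
apply: eq_bigr => s _; rewrite -sum1_card; apply: eq_bigl => C.
rewrite inE; case: (boolP (C \in F)) => //= /h Ck.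
by rewrite -val_eqE /= inordK.
Qed.

(** Without flowers, a singleton heart shows that each literal occurs in fewer than [th s] minimal
    clauses of size [1 + s]. Petals of size 0 form no flower, so unit clauses are counted
    separately; the leading 1 is for the empty clause. *)
Lemma minimal_sparse k c F : {in F, forall C, #|C| <= k} ->
  (forall s i H, ~~ flower F s i H) -> (forall i, i < k -> th i <= c) ->
  #|minimal F| <= 1 + #|L| * (1 + k * c).
Proof.
move=> hk nofl thc.
have mF : minimal F \subset F by apply/subsetP => C /minimalP[].
rewrite (@card_by_size k) => [|C /(subsetP mF)/hk//].
rewrite big_ord_recl /= leq_add//.
  rewrite -(cards1 (set0 : {set L})); apply/subset_leq_card/subsetP => C.
  by rewrite inE cards_eq0 => /andP[_ /eqP ->]; rewrite set11.
apply: leq_trans (_ : \sum_(s < k) #|L| * ((s == 0 :> nat) + c) <= _).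
  apply: leq_sum => s _; rewrite /bump /=.
  case: (posnP s) => [->|s0].
    by apply: leq_trans (card_singletons _) _; rewrite leq_pmulr.
  rewrite add0n.
  apply: card_le_literals => // x.
  have := nofl (1 + s) s [set x]; rewrite /flower cards1 s0 eqxx -ltnNge /corolla /=.
  move=> lt; apply: leq_trans (_ : th s <= c); last by apply: thc.
  apply: ltnW; apply: leq_trans lt; rewrite ltnS; apply: subset_leq_card.
  by apply/subsetP => C; rewrite !inE sub1set.
rewrite -big_distrr /= big_split /= sum_nat_const card_ord leq_mul2l leq_add2r.
apply/orP; right; case: k {hk thc} => [|k]; first by rewrite big_ord0.
by rewrite big_ord_recl big1.
Qed.

(** * Counting the added clauses and the petal branches *)

Section Growth.
Variables (al G k : nat).
Hypothesis al_gt0 : 0 < al.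
Hypothesis G_ge : al * (4 + 2 * k) <= G.
(* [G ^ (2 * s - 1)] dominates the solution of the recurrence that bounds the
   added clauses of size [s] by the heart and petal thresholds below [s]. *)
Hypothesis thE : forall i, 0 < i -> th i = al * G ^ (2 * i - 1).

Lemma G_gt0 : 0 < G.
Proof. by apply: leq_trans G_ge; rewrite muln_gt0 al_gt0. Qed.

(** Strong induction on [s]. Alive clauses are counted through singleton hearts, dead ones through
    their killers. Each term for the dead carries [G ^ (2 * (s - j) - 1) * G ^ (2 * j - 1) = G ^ (2
    * s - 2)], one power below the claim, and the spare factor [G] pays for [al * (4 + 2 * k)]. *)
Lemma added_of_size F0 a p F s : branches F0 a p F -> s <= k -> 0 < s ->
  #|of_size s (F :\: F0)| <= G ^ (2 * s - 1) * #|L|.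
Proof.
move=> /branches_spread[alive dead ne sF].
elim/ltn_ind: s => s IH sk s0.
have [->|s1] := eqVneq s 1.
  by apply: leq_trans (card_singletons _) _; rewrite leq_pmull// expn_gt0 G_gt0.
have s2 : 1 < s by lia.
have -> : #|of_size s (F :\: F0)| = #|of_size s ((F :\: F0) :&: minimal F)| +
   #|of_size s (F :\: F0 :\: minimal F)|.
  rewrite -(cardsID (minimal F)); congr addn; apply: eq_card => C;
    by rewrite !inE -?andbA; do ?bool_congr; case: (C \in F); rewrite /= ?andbF ?andbT.
have al1 : #|of_size s ((F :\: F0) :&: minimal F)| <= #|L| * (2 * th s.-1).
  apply: card_le_literals => // x; have := alive [set x] s.
  rewrite cards1 subn1 s2 => /(_ isT); apply: leq_trans.
  apply/subset_leq_card/subsetP => C.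
  rewrite inE => /andP[/setIP[/setDP[CF CF0] CM] /andP[xC Cs]].
  by apply/setDP; split=> //; rewrite inE CM sub1set xC.
have de : #|of_size s (F :\: F0 :\: minimal F)| <=
    k * (2 * al * G ^ (2 * s - 2) * #|L|).
  apply: leq_trans (dead s) _.
  apply: leq_trans (_ : s * (2 * al * G ^ (2 * s - 2) * #|L|) <= _); last first.
    by rewrite leq_mul2r sk orbT.
  rewrite -[X in X * _]card_ord -sum_nat_const; apply: leq_sum => -[[|j] js] _ /=.
    rewrite (_ : of_size _ _ = set0) ?cards0 ?muln0//.
    apply/setP => C; rewrite inE cards_eq0 [RHS]inE; apply/negP => /andP[+ /eqP e].
    by rewrite e (negbTE ne).
  have := IH j.+1 js (leq_trans (ltnW js) sk) isT.
  have -> : 2 * s - 2 = (2 * (s - j.+1) - 1) + (2 * j.+1 - 1) by lia.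
  rewrite thE ?subn_gt0// expnD -!mulnA leq_pmul2l// leq_pmul2l// => le.
  by rewrite leq_mul2l le orbT.
apply: leq_trans (leq_add al1 de) _.
rewrite thE; last by lia.
have -> : 2 * s - 1 = (2 * s - 2).+1 by lia.
have -> : 2 * s.-1 - 1 = 2 * s - 3 by lia.
have le3 : G ^ (2 * s - 3) <= G ^ (2 * s - 2).
  by rewrite leq_exp2l//; [lia | have := G_gt0; move: G_ge al_gt0; nia].
rewrite expnS; set X := G ^ _ in le3 *; set Z := G ^ _ in le3 *.
apply: leq_trans (_ : (al * (4 + 2 * k)) * Z * #|L| <= _); last first.
  by rewrite !leq_mul.
have : #|L| * (2 * (al * X)) <= #|L| * (2 * (al * Z)) by rewrite !leq_mul.
by nia.
Qed.

(** A clause of size [i] weighs [G ^ (2 * (k - i))], which makes [th i] petals weigh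
    [al * G ^ (2 * k - 1)] whatever [i] is. The added clauses of one size weigh at most
    [G ^ (2 * k - 1) * #|L|] together, and there are [k] sizes. The depth is bounded by the number
    of added clauses, since every step adds one. *)
Lemma branches_length F0 a p F : {in F0, forall C, #|C| <= k} ->
  branches F0 a p F -> a <= k * G ^ (2 * k) * #|L| /\ p * al <= k * #|L|.
Proof.
move=> h0 br; have hk := branches_size h0 br.
have hX i : 0 < i < k -> al * G ^ (2 * k - 1) <= G ^ (2 * (k - i)) * th i.
  move=> /andP[i0 ik]; rewrite thE// mulnCA -expnD leq_mul2l leq_pexp2l ?orbT ?G_gt0//.
  by lia.
have [ha hp] := branches_weight h0 hX br.
have hD : {in F :\: F0, forall C, #|C| <= k}.
  by move=> C; rewrite inE => /andP[_ /hk].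
have ne : #|of_size 0 (F :\: F0)| = 0.
  have := spread_nonempty (branches_spread br) => ne.
  rewrite (_ : of_size _ _ = set0) ?cards0//; apply/setP => C.
  rewrite inE cards_eq0 [RHS]inE; apply/negP => /andP[+ /eqP e].
  by rewrite e (negbTE ne).
split.
  apply: leq_trans ha _; rewrite (card_by_size hD) big_ord_recl /= ne add0n.
  rewrite -mulnA -[X in X * _]card_ord -sum_nat_const; apply: leq_sum => s _.
  apply: leq_trans (added_of_size br (ltn_ord s) isT) _.
  rewrite leq_mul2r leq_pexp2l ?G_gt0 ?orbT//; have := ltn_ord s; lia.
have : p * (al * G ^ (2 * k - 1)) <= k * (G ^ (2 * k - 1) * #|L|).
  apply: leq_trans hp _.
  rewrite (partition_big (fun C => inord #|C| : 'I_k.+1) xpredT)//= big_ord_recl /=.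
  rewrite big1 ?add0n => [|C /andP[CD]]; last first.
    rewrite -val_eqE /= inordK ?ltnS ?hD// => /eqP e.
    have : C \in of_size 0 (F :\: F0) by rewrite inE CD e.
    by move/card0_eq: ne => ->.
  rewrite -[X in X * _]card_ord -sum_nat_const; apply: leq_sum => s _.
  apply: leq_trans (_ : \sum_(C in of_size s.+1 (F :\: F0)) G ^ (2 * (k - s.+1)) <= _).
    rewrite [X in X <= _]big_mkcond [X in _ <= X]big_mkcond /=; apply: leq_sum => C _.
    rewrite [C \in of_size _ _]inE -val_eqE /=; case: (boolP (C \in F :\: F0)) => //= CD.
    by rewrite inordK ?ltnS ?hD// /bump /=; case: eqP => // ->.
  rewrite sum_nat_const.
  apply: leq_trans (leq_mul (added_of_size br (ltn_ord s) isT) (leqnn _)) _.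
  rewrite mulnAC -expnD leq_mul2r leq_pexp2l ?G_gt0 ?orbT//; have := ltn_ord s; lia.
rewrite mulnA [X in _ <= X]mulnCA [X in X <= _]mulnC leq_pmul2l//.
by rewrite expn_gt0 G_gt0.
Qed.

End Growth.

(** * Satisfaction is preserved by branching *)

Definition models (v : pred L) F := [forall C in F, [exists x in C, v x]].

Lemma models_minimal v F : models v (minimal F) = models v F.
Proof.
apply/forall_inP/forall_inP => h C CF.
  have [D DM sDC] := minimal_exists CF.
  have /exists_inP[x xD vx] := h _ DM.
  by apply/exists_inP; exists x => //; exact: (subsetP sDC).
by apply: h; case/minimalP: CF.
Qed.

(** If [v] misses the heart, each clause around it must be satisfied in its petal. *)
Lemma models_branch v F s H :
  models v F = models v (H |: F) || models v (F :|: petals F s H).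
Proof.
apply/idP/orP => [/forall_inP h|]; last first.
  by case=> /forall_inP h; apply/forall_inP => C CF; apply: h; rewrite inE CF ?orbT.
case: (boolP [exists x in H, v x]) => hH; [left|right].
  by apply/forall_inP => C /setU1P[->//|/h].
apply/forall_inP => D /setUP[/h//|/imsetP[C]].
rewrite inE => /and3P[/minimalP[/h/exists_inP[x xC vx] _] _ _] ->.
apply/exists_inP; exists x => //; rewrite inE xC andbT.
by apply: contra hH => xH; apply/exists_inP; exists x.
Qed.

End Sparsify.

(** * Expressions over the word RAM *)
(** [Shl] is left out because its value is not bounded by a power of its operands, as [deg]
    requires; the solver uses it directly for its two powers of two. *)
Variant aop := OAdd | OSub | OMul | ODiv | OMod | OShr | OLt | OEq.

Definition binop_of (o : aop) : binop :=
  match o with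
  | OAdd => Add | OSub => Defs.Sub | OMul => Mul | ODiv => Div
  | OMod => Mod | OShr => Shr | OLt => Lt | OEq => Eq
  end.

(* [V] is a de Bruijn index, [G] a global register, and [Rd b e] reads cell [e]
   of memory region [5 + b].  [Sum] binds an index ranging over [0 <= i < M]
   for a global [M], so that the cost does not depend on the data. *)
Inductive expr :=
  | V of nat
  | G of nat
  | K of nat
  | O of aop & expr & expr
  | Rd of bool & expr
  | In of expr
  | Sum of expr
  | Let of expr & expr.

Notation NG := 20.
Notation gM := 6.

Section Eval.
Variables (inp : seq nat) (g : seq nat) (m : nat -> nat).

Fixpoint eval (env : seq nat) (e : expr) : nat :=
  match e with
  | V i => nth 0 env i
  | G i => nth 0 g i
  | K c => c
  | O o a b => eval_binop (binop_of o) (eval env a) (eval env b)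
  | Rd b a => m (8 * eval env a + (5 + b))
  | In a => nth 0 inp (eval env a)
  | Sum a => sumn [seq eval (i :: env) a | i <- iota 0 (nth 0 g gM)]
  | Let a b => eval (eval env a :: env) b
  end.
End Eval.

(** The exponent in [eval_le]: data up to [Y] give values up to [Y ^ deg e]. The 10 at [Rd] leaves
    room for the address arithmetic of the compiled code. A bound variable may reach
    [Y ^ (deg a).+1], whence the product at [Let]. *)
Fixpoint deg (e : expr) : nat :=
  match e with
  | V _ | G _ => 1
  | K c => c.+1
  | O _ a b => (deg a + deg b).+1
  | Rd _ a => deg a + 10
  | In a => (deg a).+1
  | Sum a => (deg a).+1
  | Let a b => (deg a).+1 * deg b
  end.

(** This is the exact running time: no expression branches, and a [Sum] always visits all [M]
    indices. *)
Fixpoint cost (M : nat) (e : expr) : nat :=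
  match e with
  | V _ | G _ | K _ => 1
  | O _ a b => cost M a + cost M b + 1
  | Rd _ a => cost M a + 5
  | In a => cost M a + 1
  | Sum a => M * (cost M a + 5) + 4
  | Let a b => cost M a + cost M b + 1
  end.

(** There is no move instruction; a bitwise disjunction of a value with itself copies it and cannot
    overflow. *)
Definition copy x y := Assign x (Bin BitOr y y).

(** Scratch registers in units of two: [fr] accumulates, [fr.+1] is the index, [fr.+2] the loop
    test, and [fr.+3] holds the summand and then the constant 1. *)
Definition sum_body fr c := Seq c
  (Seq (Assign fr.*2 (Bin Add fr.*2 fr.+3.*2))
  (Seq (Assign fr.+3.*2 (Const 1))
  (Seq (Assign fr.+1.*2 (Bin Add fr.+1.*2 fr.+3.*2))
       (Assign fr.+2.*2 (Bin Lt fr.+1.*2 gM.*2))))).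

(* Local variable [i] lives in register [(nth 0 pos i).*2]; the result goes to
   [fr.*2], and the even registers from there on are scratch. *)
Fixpoint comp (pos : seq nat) (fr : nat) (e : expr) : cmd :=
  match e with
  | V i => if i < size pos then copy fr.*2 (nth 0 pos i).*2
           else Assign fr.*2 (Const 0)
  | G i => if i < NG then copy fr.*2 i.*2 else Assign fr.*2 (Const 0)
  | K c => Assign fr.*2 (Const c)
  | O o a b => Seq (comp pos fr a) (Seq (comp pos fr.+1 b)
      (Assign fr.*2 (Bin (binop_of o) fr.*2 fr.+1.*2)))
  | Rd b a => Seq (comp pos fr a) (Seq (Assign fr.+1.*2 (Const 8))
      (Seq (Assign fr.*2 (Bin Mul fr.+1.*2 fr.*2))
      (Seq (Assign fr.+1.*2 (Const (5 + b)))
      (Seq (Assign fr.*2 (Bin Add fr.*2 fr.+1.*2))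
           (Assign fr.*2 (ReadMem fr.*2))))))
  | In a => Seq (comp pos fr a) (Assign fr.*2 (ReadInput fr.*2))
  | Sum a => Seq (Assign fr.*2 (Const 0)) (Seq (Assign fr.+1.*2 (Const 0))
      (Seq (Assign fr.+2.*2 (Bin Lt fr.+1.*2 gM.*2))
      (While fr.+2.*2 (sum_body fr (comp (fr.+1 :: pos) fr.+3 a)))))
  | Let a b => Seq (comp pos fr a) (Seq (comp (fr :: pos) fr.+1 b)
      (copy fr.*2 fr.+1.*2))
  end.

Definition globals (g : seq nat) (s : state) :=
  forall i, i < NG -> reg s i.*2 = nth 0 g i.

(** Odd registers are set aside for the simulated program, so compiled expressions leave all of them
    alone. *)
Definition frame fr (s s' : state) :=
  mem s' = mem s /\ forall x, (x < fr.*2) || odd x -> reg s' x = reg s x.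

Record bounded (inp g : seq nat) (m : nat -> nat) (Y : nat) : Prop := Bounded {
  bounded_ge2 : 1 < Y;
  bounded_inp : forall i, nth 0 inp i <= Y;
  bounded_glob : forall i, nth 0 g i <= Y;
  bounded_mem : forall (b : bool) a, m (8 * a + (5 + b)) <= Y }.

Lemma bounded_le inp g m Y Y' : Y <= Y' -> bounded inp g m Y -> bounded inp g m Y'.
Proof.
move=> le [h1 h2 h3 h4]; split=> [|i|i|b a]; apply: leq_trans le => //.
Qed.

Lemma sumn_le (f : nat -> nat) c k n : (forall i, i < k + n -> f i <= c) ->
  sumn [seq f i | i <- iota k n] <= n * c.
Proof.
elim: n k => // n IH k h /=; rewrite mulSn leq_add ?h//; first by lia.
by apply: IH => i ik; apply: h; lia.
Qed.

Lemma deg_gt0 e : 0 < deg e.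
Proof. by elim: e => //= *; rewrite ?muln_gt0 ?addn_gt0 ?orbT. Qed.

Lemma eval_binop_le o a b da db Y : 1 < Y -> a <= Y ^ da -> b <= Y ^ db ->
  eval_binop (binop_of o) a b <= Y ^ (da + db).+1.
Proof.
move=> Y1 ha hb.
have pa : 0 < Y ^ da by rewrite expn_gt0 ltnW.
have pb : 0 < Y ^ db by rewrite expn_gt0 ltnW.
have hM : Y ^ (da + db).+1 = Y * (Y ^ da * Y ^ db) by rewrite expnS expnD.
have ha' : a <= Y ^ (da + db).+1.
  by apply: leq_trans ha _; rewrite leq_pexp2l ?(ltnW Y1)//; lia.
have hb' : b <= Y ^ (da + db).
  by apply: leq_trans hb _; rewrite leq_pexp2l ?(ltnW Y1)//; lia.
have ha2 : a <= Y ^ (da + db).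
  by apply: leq_trans ha _; rewrite leq_pexp2l ?(ltnW Y1)//; lia.
have h1 : 0 < Y ^ (da + db).+1 by rewrite expn_gt0 ltnW.
case: o => /=.
- rewrite expnS; apply: leq_trans (leq_mul Y1 (leqnn _)).
  by rewrite mul2n -addnn leq_add.
- exact: leq_trans (leq_subr _ _) ha'.
- by rewrite hM; apply: leq_trans (leq_mul ha hb) _; rewrite leq_pmull// ltnW.
- exact: leq_trans (leq_div _ _) ha'.
- exact: leq_trans (leq_mod _ _) ha'.
- exact: leq_trans (leq_div _ _) ha'.
- by case: (a < b).
- by case: (a == b).
Qed.

Lemma eval_le inp g m e Y env : bounded inp g m Y -> (forall i, nth 0 env i <= Y) ->
  eval inp g m env e <= Y ^ deg e.
Proof.
elim: e Y env => [i|i|c|o a IHa b IHb|b a IHa|a IHa|a IHa|a IHa b IHb] Y env bd he /=;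
  have [Y1 hi hg hm] := bd; have Y0 := ltnW Y1.
- by rewrite expn1.
- by rewrite expn1.
- by apply: ltnW; apply: ltnW; apply: ltn_expl.
- by apply: eval_binop_le => //; [exact: IHa | exact: IHb].
- by apply: leq_trans (hm _ _) _; rewrite -{1}(expn1 Y) leq_pexp2l//; lia.
- by apply: leq_trans (hi _) _; rewrite -{1}(expn1 Y) leq_pexp2l.
- rewrite expnS; apply: leq_trans (_ : nth 0 g gM * Y ^ deg a <= _).
    apply: sumn_le => i; rewrite add0n => iM; apply: IHa => // -[|j] //=.
    by apply: leq_trans (hg gM); exact: ltnW.
  by rewrite leq_mul.
- rewrite expnM; apply: IHb => [|[|i] /=].
  + by apply: bounded_le bd; rewrite -{1}(expn1 Y) leq_pexp2l.
  + by apply: leq_trans (IHa _ _ bd he) _; rewrite leq_pexp2l.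
  + by apply: leq_trans (he _) _; rewrite -{1}(expn1 Y) leq_pexp2l.
Qed.

Definition setr (s : state) x v := State [eta reg s with x |-> v] (mem s).

Lemma exec_set inp w x e s v : eval_rhs inp s e = v -> v < 2 ^ w ->
  exec inp w (Assign x e) s (setr s x v) 1.
Proof. by move=> <- h; exact: exec_assign. Qed.

Lemma lorn n : Nat.lor n n = n. Proof. exact: PeanoNat.Nat.lor_diag. Qed.

Lemma frame_trans fr fr' s1 s2 s3 : frame fr s1 s2 -> frame fr' s2 s3 -> fr <= fr' ->
  frame fr s1 s3.
Proof.
move=> [m1 r1] [m2 r2] le; split; first by rewrite m2.
move=> x hx; rewrite r2 ?r1//; case/orP: hx => [hx|->]; last by rewrite orbT.
by rewrite (leq_trans hx)// leq_double.
Qed.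

Lemma frame_setr fr fr' s v : fr <= fr' -> frame fr s (setr s fr'.*2 v).
Proof.
move=> le; split=> // x hx /=; case: eqP => // e; move: hx; rewrite e odd_double orbF.
by rewrite ltn_double ltnNge le.
Qed.

Lemma frame_set fr fr' s s' v : frame fr s s' -> fr <= fr' ->
  frame fr s (setr s' fr'.*2 v).
Proof. by move=> f le; exact: frame_trans f (frame_setr _ _ le) (leqnn _). Qed.

Lemma frame_reg fr s s' f : frame fr s s' -> f < fr -> reg s' f.*2 = reg s f.*2.
Proof. by move=> [_ h] lt; apply: h; rewrite ltn_double lt. Qed.

Lemma globals_frame fr g s s' : frame fr s s' -> NG <= fr -> globals g s -> globals g s'.
Proof.
by move=> fs le h i iN; rewrite (frame_reg fs) ?h// (leq_trans iN).
Qed.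

Lemma env_frame fr s s' pos env : frame fr s s' -> all (ltn^~ fr) pos ->
  [seq reg s p.*2 | p <- pos] = env -> [seq reg s' p.*2 | p <- pos] = env.
Proof.
move=> fs /allP hp <-; apply/eq_in_map => p /hp lt; exact: frame_reg lt.
Qed.

Section Comp.
Variables (inp : seq nat) (w : nat) (g : seq nat).
Hypothesis size_g : size g = NG.

Lemma reg_setr s x v : reg (setr s x v) x = v.
Proof. by rewrite /= eqxx. Qed.

Lemma reg_setr_ne s x y v : y != x -> reg (setr s x v) y = reg s y.
Proof. by move=> /negbTE /= ->. Qed.

(** The induction keeps [Y] general because the body of a [Let] is run with the larger data bound
    [Y ^ (deg a).+1]. *)
Lemma comp_correct e Y env pos fr s :
  bounded inp g (mem s) Y -> (forall i, nth 0 env i <= Y) -> Y ^ deg e < 2 ^ w ->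
  NG <= fr -> all (ltn^~ fr) pos -> [seq reg s p.*2 | p <- pos] = env ->
  globals g s ->
  exists s', [/\ exec inp w (comp pos fr e) s s' (cost (nth 0 g gM) e),
    frame fr s s' & reg s' fr.*2 = eval inp g (mem s) env e].
Proof.
elim: e Y env pos fr s => [i|i|c|o a IHa b IHb|b a IHa|a IHa|a IHa|a IHa b IHb]
  Y env pos fr s bd he hw frN hpos henv hg;
  have [Y1 hi hgY hm] := bd; have Y0 := ltnW Y1; have hle e0 := eval_le e0 bd he.
- have {}hle := leq_ltn_trans (hle (V i)) hw.
  have defi : nth 0 env i = if i < size pos then reg s (nth 0 pos i).*2 else 0.
    rewrite -henv; case: ltnP => h; first by rewrite (nth_map 0).
    by rewrite nth_default// size_map.
  rewrite /= in hle *; exists (setr s fr.*2 (nth 0 env i)); split.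
  + by case: ifP defi => _ defi; apply: exec_set => //=; rewrite ?lorn.
  + exact: frame_setr.
  + exact: reg_setr.
- have {}hle := leq_ltn_trans (hle (G i)) hw.
  have defi : nth 0 g i = if i < NG then reg s i.*2 else 0.
    by case: ltnP => h; [rewrite hg | rewrite nth_default// size_g].
  rewrite [comp _ _ _]/= [eval _ _ _ _ _]/= in hle *.
  exists (setr s fr.*2 (nth 0 g i)); split.
  + by case: ifP defi => _ defi; apply: exec_set => //=; rewrite ?lorn.
  + exact: frame_setr.
  + exact: reg_setr.
- exists (setr s fr.*2 c); split; [|exact: frame_setr|exact: reg_setr].
  by apply: exec_set => //; exact: leq_ltn_trans (hle (K c)) hw.
- have {}hle := leq_ltn_trans (hle (O o a b)) hw.
  have hwa : Y ^ deg a < 2 ^ w.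
    by apply: leq_ltn_trans hw; rewrite leq_pexp2l//=; lia.
  have hwb : Y ^ deg b < 2 ^ w.
    by apply: leq_ltn_trans hw; rewrite leq_pexp2l//=; lia.
  have [s1 [x1 f1 r1]] := IHa _ _ _ _ _ bd he hwa frN hpos henv hg.
  have m1 : mem s1 = mem s by case: f1.
  rewrite -m1 in bd.
  have [s2 [x2 f2 r2]] := IHb _ _ _ _ _ bd he hwb (leqW frN)
     (sub_all (fun x => @leqW x.+1 fr) hpos) (env_frame f1 hpos henv) (globals_frame f1 frN hg).
  have r12 : reg s2 fr.*2 = eval inp g (mem s) env a by rewrite (frame_reg f2).
  rewrite m1 in r2.
  exists (setr s2 fr.*2 (eval inp g (mem s) env (O o a b))); split.
  + rewrite /= -addnA; apply: exec_seq x1 _; apply: exec_seq x2 _.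
    by apply: exec_set => //=; rewrite r12 r2.
  + exact: frame_trans (frame_trans f1 f2 (leqnSn _)) (frame_setr _ _ (leqnn _)) (leqnn _).
  + exact: reg_setr.
- have hwa : Y ^ (deg a + 10) < 2 ^ w by [].
  have hwa' : Y ^ deg a < 2 ^ w.
    by apply: leq_ltn_trans hwa; rewrite leq_pexp2l//=; lia.
  have [s1 [x1 f1 r1]] := IHa _ _ _ _ _ bd he hwa' frN hpos henv hg.
  have m1 : mem s1 = mem s by case: f1.
  have small c : c <= 8 * Y ^ deg a + 6 -> c < 2 ^ w.
    move=> hc; apply: leq_ltn_trans hwa; apply: leq_trans hc _.
    have p0 : 0 < Y ^ deg a by rewrite expn_gt0 Y0.
    have p1 : 2 ^ 10 <= Y ^ 10 by rewrite leq_exp2r.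
    by rewrite expnD; move: p0 p1; set A := Y ^ deg a; set B := Y ^ 10 => p0 p1; nia.
  have va := eval_le a bd he.
  set v := eval inp g (mem s) env a in r1 va.
  pose s2 := setr s1 fr.+1.*2 8.
  pose s3 := setr s2 fr.*2 (8 * v).
  pose s4 := setr s3 fr.+1.*2 (5 + b).
  pose s5 := setr s4 fr.*2 (8 * v + (5 + b)).
  exists (setr s5 fr.*2 (mem s (8 * v + (5 + b)))); split.
  + rewrite /= (_ : _ + 5 = cost (nth 0 g gM) a + (1 + (1 + (1 + (1 + 1)))))//.
    have ne : (fr.+1.*2 == fr.*2) = false by lia.
    have ne' : (fr.*2 == fr.+1.*2) = false by lia.
    apply: exec_seq x1 _.
    apply: (@exec_seq _ _ _ _ _ s2); first by apply: exec_set => //; apply: small; lia.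
    apply: (@exec_seq _ _ _ _ _ s3).
      by apply: exec_set; [rewrite /= eqxx ne' r1 | apply: small; lia].
    apply: (@exec_seq _ _ _ _ _ s4).
      by apply: exec_set => //; apply: small; have := leq_b1 b; lia.
    apply: (@exec_seq _ _ _ _ _ s5).
      by apply: exec_set; [rewrite /= !eqxx ne' | apply: small; have := leq_b1 b; lia].
    apply: exec_set; first by rewrite /= eqxx m1.
    by apply: leq_ltn_trans (hm b v) _; apply: leq_ltn_trans hwa;
       rewrite -{1}(expn1 Y) leq_pexp2l//; lia.
  + by do 5! [apply: frame_set; last by lia].
  + exact: reg_setr.
- have {}hle := leq_ltn_trans (hle (In a)) hw.
  have hwa : Y ^ deg a < 2 ^ w.
    by apply: leq_ltn_trans hw; rewrite leq_pexp2l.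
  have [s1 [x1 f1 r1]] := IHa _ _ _ _ _ bd he hwa frN hpos henv hg.
  exists (setr s1 fr.*2 (eval inp g (mem s) env (In a))); split.
  + by apply: exec_seq x1 _; apply: exec_set => //=; rewrite r1.
  + exact: frame_trans f1 (frame_setr _ _ (leqnn _)) (leqnn _).
  + exact: reg_setr.
- have hwa : Y ^ deg a < 2 ^ w by apply: leq_ltn_trans hw; rewrite leq_pexp2l.
  set M := nth 0 g gM; pose f i := eval inp g (mem s) (i :: env) a.
  have MY : M <= Y by exact: hgY.
  have Yw : Y < 2 ^ w.
    by apply: leq_ltn_trans hwa; rewrite -{1}(expn1 Y) leq_pexp2l// deg_gt0.
  have fY i : i <= M -> f i <= Y ^ deg a.
    by move=> iM; apply: eval_le => // -[|j] //=; apply: leq_trans MY.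
  have sw i : i <= M -> sumn [seq f j | j <- iota 0 i] < 2 ^ w.
    move=> iM; apply: leq_ltn_trans hw; rewrite expnS.
    apply: leq_trans (_ : i * Y ^ deg a <= _); last by rewrite leq_mul2r (leq_trans iM) ?orbT.
    by apply: sumn_le => j; rewrite add0n => ji; apply: fY; rewrite ltnW// (leq_trans ji).
  have loop j i s1 : i + j = M -> frame fr s s1 ->
      reg s1 fr.*2 = sumn [seq f j | j <- iota 0 i] -> reg s1 fr.+1.*2 = i ->
      reg s1 fr.+2.*2 = (i < M) ->
      exists s', [/\ exec inp w (While fr.+2.*2 (sum_body fr (comp (fr.+1 :: pos) fr.+3 a)))
          s1 s' (j * (cost M a + 5) + 1),
        frame fr s s' & reg s' fr.*2 = sumn [seq f j | j <- iota 0 M]].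
    elim: j i s1 => [|j IHj] i s1 ij f1 racc ridx rc.
      rewrite addn0 in ij; exists s1; split; rewrite -?ij//.
      by apply: exec_while_false; rewrite rc ij ltnn.
    have iM : i < M by lia.
    have m1 : mem s1 = mem s by case: f1.
    have bd1 : bounded inp g (mem s1) Y by rewrite m1.
    have he1 k : nth 0 (i :: env) k <= Y by case: k => //=; lia.
    have fr3 : NG <= fr.+3 by lia.
    have hp1 : all (ltn^~ fr.+3) (fr.+1 :: pos).
      by apply/andP; split; [exact: ltnW (ltnSn _) | apply: sub_all hpos => x /=; lia].
    have hv1 : [seq reg s1 p.*2 | p <- fr.+1 :: pos] = i :: env.
      by rewrite map_cons (env_frame f1 hpos henv) ridx.
    have [s2 [x2 f2 r2]] := IHa Y _ _ _ _ bd1 he1 hwa fr3 hp1 hv1 (globals_frame f1 frN hg).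
    rewrite m1 -/(f i) in r2.
    pose s3 := setr s2 fr.*2 (sumn [seq f j | j <- iota 0 i.+1]).
    pose s4 := setr s3 fr.+3.*2 1.
    pose s5 := setr s4 fr.+1.*2 i.+1.
    pose s6 := setr s5 fr.+2.*2 (i.+1 < M).
    have sumS : sumn [seq f j | j <- iota 0 i.+1] = sumn [seq f j | j <- iota 0 i] + f i.
      by rewrite -addn1 iotaD map_cat sumn_cat /= addn0.
    have [|||||s' [x' f' r']] := IHj i.+1 s6; try by [lia | rewrite reg_setr | ].
    + do 4! [apply: frame_set; last by lia].
      by apply: frame_trans f1 f2 _; lia.
    + rewrite /s6 reg_setr_ne; last by lia.
      rewrite /s5 reg_setr_ne; last by lia.
      by rewrite /s4 reg_setr_ne ?reg_setr//; last by lia.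
    + by rewrite /s6 reg_setr_ne ?reg_setr//; lia.
    exists s'; split=> //.
    rewrite (_ : _ + 1 = (cost M a + (1 + (1 + (1 + 1))) + (j * (cost M a + 5) + 1)).+1);
      last by lia.
    apply: exec_while_true x'; first by rewrite rc iM.
    apply: exec_seq x2 _.
    apply: (@exec_seq _ _ _ _ _ s3).
      apply: exec_set; last by apply: sw.
      by rewrite /eval_rhs /eval_binop (frame_reg f2)// ?r2 ?racc -?sumS; lia.
    apply: (@exec_seq _ _ _ _ _ s4).
      by apply: exec_set => //; apply: leq_trans Yw.
    apply: (@exec_seq _ _ _ _ _ s5).
      apply: exec_set; last by lia.
      rewrite [eval_rhs _ _ _]/= eqxx.
      rewrite !ifF; try by lia.
      by rewrite (frame_reg f2)// ridx addn1.
    apply: exec_set; last by apply: leq_ltn_trans Yw; case: (_ < _); lia.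
    rewrite [eval_rhs _ _ _]/= eqxx !ifF; try by lia.
    by rewrite (frame_reg f2)// ?(frame_reg f1) ?hg//; lia.
  have [|||||s' [x' f' r']] := loop M 0 (setr (setr (setr s fr.*2 0) fr.+1.*2 0) fr.+2.*2 (0 < M)).
  + by [].
  + by do 3! [apply: frame_set; last by lia].
  + rewrite reg_setr_ne; last by lia.
    by rewrite reg_setr_ne ?reg_setr//; lia.
  + by rewrite reg_setr_ne ?reg_setr//; lia.
  + exact: reg_setr.
  exists s'; split=> //.
  rewrite (_ : cost _ _ = 1 + (1 + (1 + (M * (cost M a + 5) + 1)))); last first.
    by rewrite /= -/M; lia.
  apply: (@exec_seq _ _ _ _ _ (setr s fr.*2 0)); first by apply: exec_set => //; lia.
  apply: (@exec_seq _ _ _ _ _ (setr (setr s fr.*2 0) fr.+1.*2 0)).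
    by apply: exec_set => //; lia.
  apply: exec_seq x'; apply: exec_set; last by apply: leq_ltn_trans Yw; case: (_ < _); lia.
  rewrite [eval_rhs _ _ _]/= eqxx !ifF; try by lia.
  by rewrite hg.
- have hwa : Y ^ deg a < 2 ^ w.
    apply: leq_ltn_trans hw; rewrite leq_pexp2l//=.
    by have := deg_gt0 b; nia.
  have [s1 [x1 f1 r1]] := IHa _ _ _ _ _ bd he hwa frN hpos henv hg.
  have m1 : mem s1 = mem s by case: f1.
  set v := eval inp g (mem s) env a in r1.
  have va : v <= Y ^ deg a by exact: eval_le.
  have bd1 : bounded inp g (mem s1) (Y ^ (deg a).+1).
    by rewrite m1; apply: bounded_le bd; rewrite -{1}(expn1 Y) leq_pexp2l.
  have he1 k : nth 0 (v :: env) k <= Y ^ (deg a).+1.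
    case: k => [|k] /=; first by apply: leq_trans va _; rewrite leq_pexp2l.
    by apply: leq_trans (he _) _; rewrite -{1}(expn1 Y) leq_pexp2l.
  have hp1 : all (ltn^~ fr.+1) (fr :: pos).
    by rewrite /= ltnSn/=; apply: sub_all hpos => x /=; lia.
  have hv1 : [seq reg s1 p.*2 | p <- fr :: pos] = v :: env.
    by rewrite /= (env_frame f1 hpos henv) r1.
  rewrite /= expnM in hw.
  have [s2 [x2 f2 r2]] := IHb _ _ _ _ _ bd1 he1 hw (leqW frN) hp1 hv1
    (globals_frame f1 frN hg).
  rewrite m1 in r2.
  exists (setr s2 fr.*2 (eval inp g (mem s) env (Let a b))); split.
  + rewrite /= -addnA; apply: exec_seq x1 _; apply: exec_seq x2 _.
    apply: exec_set; first by rewrite /= lorn r2.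
    apply: leq_ltn_trans hw; rewrite /= -expnM; exact: (hle (Let a b)).
  + exact: frame_trans (frame_trans f1 f2 (leqnSn _)) (frame_setr _ _ (leqnn _)) (leqnn _).
  + exact: reg_setr.
Qed.
End Comp.

(** * Composite statements *)
Definition setm (s : state) a v := State (reg s) [eta mem s with a |-> v].

Definition runs inp w (c : cmd) (s : state) (T : nat) (Q : state -> Prop) :=
  exists s' t, [/\ exec inp w c s s' t, t <= T & Q s'].

Lemma runs_exec inp w c s s' t T (Q : state -> Prop) :
  exec inp w c s s' t -> t <= T -> Q s' -> runs inp w c s T Q.
Proof. by exists s', t. Qed.

Lemma runs_weaken inp w c s T T' (Q Q' : state -> Prop) :
  runs inp w c s T Q -> T <= T' -> (forall s', Q s' -> Q' s') -> runs inp w c s T' Q'.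
Proof.
by move=> [s' [t [x le q]]] le' h; exists s', t; split; [|exact: leq_trans le'|exact: h].
Qed.

Lemma runs_seq inp w c1 c2 s T1 T2 (Q1 Q2 : state -> Prop) :
  runs inp w c1 s T1 Q1 -> (forall s1, Q1 s1 -> runs inp w c2 s1 T2 Q2) ->
  runs inp w (Seq c1 c2) s (T1 + T2) Q2.
Proof.
move=> [s1 [t1 [x1 le1 q1]]] /(_ _ q1) [s2 [t2 [x2 le2 q2]]].
by exists s2, (t1 + t2); split=> //; [exact: exec_seq x1 x2 | exact: leq_add].
Qed.

(** The index of [I] is a variant: it drops at every turn and so bounds their number. Its final
    value is existential because the loop may end early. *)
Lemma runs_while inp w x c T (I : nat -> state -> Prop) k s :
  (forall k s, I k s -> reg s x != 0 ->
     runs inp w c s T (fun s' => exists2 k', k' < k & I k' s')) ->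
  I k s ->
  runs inp w (While x c) s (k * T.+1).+1
    (fun s' => reg s' x = 0 /\ exists k', I k' s').
Proof.
move=> h; elim/ltn_ind: k s => k IH s Ik.
have [e|ne] := eqVneq (reg s x) 0.
  exists s, 1; split=> //; first exact: exec_while_false.
  by split=> //; exists k.
have [s1 [t1 [x1 le1 [k' lt Ik']]]] := h _ _ Ik ne.
have [s2 [t2 [x2 le2 q2]]] := IH _ lt _ Ik'.
exists s2, (t1 + t2).+1; split=> //; first exact: exec_while_true x1 x2.
by apply: leq_trans (_ : (T + (k' * T.+1).+1).+1 <= _); [lia | nia].
Qed.

Lemma nsn (g : seq nat) i v j :
  nth 0 (set_nth 0 g i v) j = if j == i then v else nth 0 g j.
Proof. by rewrite nth_set_nth. Qed.

Definition at_ g m s := globals g s /\ mem s = m.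

Section Statements.
Variables (inp : seq nat) (w Y D : nat).
Hypothesis Yw : Y ^ D < 2 ^ w.

Definition SetG i e := Seq (comp [::] NG e) (copy i.*2 NG.*2).

Lemma frame_at g m s s' : frame NG s s' -> at_ g m s -> at_ g m s'.
Proof. by move=> f [hg hm]; split; [exact: globals_frame f _ hg | case: f => ->]. Qed.

Lemma at_set g m s i v : i < NG -> at_ g m s ->
  at_ (set_nth 0 g i v) m (setr s i.*2 v).
Proof.
move=> iN [hg hm]; split=> // j jN; rewrite nsn /=.
case: (eqVneq j i) => [->|ne]; first by rewrite eqxx.
by rewrite (inj_eq double_inj) (negbTE ne) hg.
Qed.

Lemma deg_ltw e : 1 < Y -> deg e <= D -> Y ^ deg e < 2 ^ w.
Proof. by move=> Y1 le; apply: leq_ltn_trans Yw; rewrite leq_pexp2l// ltnW. Qed.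

Lemma runs_set i e g m s : size g = NG -> bounded inp g m Y -> deg e <= D -> i < NG ->
  at_ g m s -> runs inp w (SetG i e) s (cost (nth 0 g gM) e + 1)
    (at_ (set_nth 0 g i (eval inp g m [::] e)) m).
Proof.
move=> szg bd le iN st; have [hg hm] := st.
have Y1 := bounded_ge2 bd.
have he j : nth 0 [::] j <= Y by rewrite nth_nil.
rewrite -hm in bd.
have [s1 [x1 f1 r1]] :=
  comp_correct szg bd he (deg_ltw Y1 le) (leqnn _) (isT : all _ [::]) erefl hg.
apply: runs_exec (exec_seq x1 (@exec_set _ _ _ _ _ (eval inp g m [::] e) _ _)) (leqnn _) _.
- by rewrite /eval_rhs /eval_binop lorn r1 hm.
- rewrite hm in bd; apply: leq_ltn_trans (deg_ltw Y1 le); exact: eval_le.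
- exact: at_set (frame_at f1 st).
Qed.

Definition addr j e := O OAdd (O OMul (K 8) e) (K j).

Definition Store j ea e := Seq (comp [::] NG (addr j ea))
  (Seq (comp [::] NG.+1 e) (WriteMem NG.*2 NG.+1.*2)).

Lemma runs_store j ea e g m s : size g = NG -> bounded inp g m Y ->
  deg (addr j ea) <= D -> deg e <= D -> at_ g m s ->
  runs inp w (Store j ea e) s (cost (nth 0 g gM) (addr j ea) + cost (nth 0 g gM) e + 1)
    (at_ g [eta m with (8 * eval inp g m [::] ea + j) |-> eval inp g m [::] e]).
Proof.
move=> szg bd lea le st; have [hg hm] := st.
have Y1 := bounded_ge2 bd.
have he i : nth 0 [::] i <= Y by rewrite nth_nil.
have bd0 := bd; rewrite -hm in bd0.
have [s1 [x1 f1 r1]] :=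
  comp_correct szg bd0 he (deg_ltw Y1 lea) (leqnn _) (isT : all _ [::]) erefl hg.
have st1 := frame_at f1 st; have [hg1 hm1] := st1.
rewrite hm -hm1 in bd0.
have [s2 [x2 f2 r2]] :=
  comp_correct szg bd0 he (deg_ltw Y1 le) (leqnSn _) (isT : all _ [::]) erefl hg1.
have f02 : frame NG s s2 by apply: frame_trans f1 f2 (leqnSn _).
rewrite -addnA; apply: runs_exec (exec_seq x1 (exec_seq x2 _)) (leqnn _) _.
  exact: exec_write.
have [hg2 hm2] := frame_at f02 st; split=> //=.
by rewrite hm2 r2 hm1 (frame_reg f2)// r1 hm.
Qed.

(* Cells [off, off + cnt) of region [j] receive the values of [e], in which
   global 18 is the running index. *)
Definition Fill j off cnt e :=
  Seq (SetG 18 (K 0)) (Seq (SetG 19 (O OLt (K 0) cnt))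
  (While 38 (Seq (Store j (O OAdd off (G 18)) e)
    (Seq (SetG 18 (O OAdd (G 18) (K 1))) (SetG 19 (O OLt (G 18) cnt)))))).

Definition filled j off cnt (val : nat -> nat) (m m' : nat -> nat) :=
  (forall k, k < cnt -> m' (8 * (off + k) + j) = val k) /\
  (forall a, (forall k, k < cnt -> a <> 8 * (off + k) + j) -> m' a = m a).

Definition fill_cost M off cnt e n :=
  cost M cnt + 5 + n.+1 * (cost M (addr 0 (O OAdd off (G 18))) + cost M e + cost M cnt + 10).

Lemma size_set_nth_NG g i v : size g = NG -> i < NG -> size (set_nth 0 g i v) = NG.
Proof. by move=> sz iN; rewrite size_set_nth sz; exact/maxn_idPr. Qed.

Lemma cost_addr M j e : cost M (addr j e) = cost M (addr 0 e). Proof. by []. Qed.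

(** The values of [e] are required on every partially filled memory, since [e] may read the region
    that the loop is writing: [posE] reads the previous position, and [heartE] overwrites a formula
    in place. *)
Lemma runs_fill j off cnt e g m s offv n val :
  size g = NG -> bounded inp g m Y ->
  deg (addr j (O OAdd off (G 18))) <= D -> deg e <= D -> deg cnt + 2 <= D -> 5 <= D ->
  n <= Y -> (forall k, k < n -> val k <= Y) ->
  let gk k c := set_nth 0 (set_nth 0 g 18 k) 19 c in
  (forall k c mk, k <= n -> filled j offv k val m mk ->
     [/\ eval inp (gk k c) mk [::] off = offv, eval inp (gk k c) mk [::] cnt = n &
         k < n -> eval inp (gk k c) mk [::] e = val k]) ->
  eval inp (set_nth 0 g 18 0) m [::] cnt = n ->
  at_ g m s ->
  runs inp w (Fill j off cnt e) s (fill_cost (nth 0 g gM) off cnt e n)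
    (fun s' => exists2 m', filled j offv n val m m' & at_ (gk n 0) m' s').
Proof.
move=> szg bd dOff dE dCnt D5 nY valY gk hk hcnt st.
have Y1 := bounded_ge2 bd.
have szk k c : size (gk k c) = NG by rewrite !size_set_nth_NG.
have Mk k c : nth 0 (gk k c) gM = nth 0 g gM by rewrite !nsn.
have bk k c mk : k <= n -> c <= 1 -> filled j offv k val m mk -> bounded inp (gk k c) mk Y.
  move=> kn c1 [h1 h2]; have [_ hi hg hm] := bd; split=> // [i|b a].
    rewrite !nsn /=; case: eqP => _; first by lia.
    by case: eqP => _; [exact: leq_trans kn _ | rewrite hg].
  case: (boolP (has (fun i => 8 * a + (5 + b) == 8 * (offv + i) + j) (iota 0 k))).
    move=> /hasP[i]; rewrite mem_iota => /andP[_ ik] /eqP ->.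
    by rewrite h1// valY//; lia.
  move=> /hasPn hn; rewrite h2// => i ik e0.
  by have := hn i; rewrite mem_iota e0 eqxx => /(_ ik).
have b0 : bounded inp (set_nth 0 g 18 0) m Y.
  have [_ hi hg hm] := bd; split=> // i; rewrite nsn /=.
  by case: eqP.
pose c0 := cost (nth 0 g gM) (addr 0 (O OAdd off (G 18))).
(* The variant [r] is the number of cells still to be filled; global 19 holds the loop test. *)
pose I r s := exists k mk, [/\ k <= n, r = n - k, filled j offv k val m mk & at_ (gk k (k < n)) mk s].
have h := fun s H => @runs_while inp w 38 (Seq (Store j (O OAdd off (G 18)) e)
    (Seq (SetG 18 (O OAdd (G 18) (K 1))) (SetG 19 (O OLt (G 18) cnt))))
   (c0 + cost (nth 0 g gM) e + 1 + (4 + (cost (nth 0 g gM) cnt + 3))) I n s H.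
rewrite /fill_cost.
suff: runs inp w (Fill j off cnt e) s
    (2 + ((cost (nth 0 g gM) cnt + 3) + (n * (c0 + cost (nth 0 g gM) e + 1 + (4 + (cost (nth 0 g gM) cnt + 3))).+1).+1))
    (fun s' => reg s' 38 = 0 /\ exists k', I k' s').
  move=> H; apply: (runs_weaken H); first by rewrite /c0; nia.
  move=> s' [e0 [r [k [mk [kn er fk stk]]]]].
  have kn' : k = n.
    have := stk.1 19 isT; rewrite !nsn /= e0.
    by case: (ltnP k n) => // le _; lia.
  by rewrite kn' ltnn in fk stk; exists mk.
apply: (@runs_seq _ _ _ _ _ _ _ (at_ (set_nth 0 g 18 0) m)); last move=> s1 st1.
- by apply: (runs_weaken (runs_set szg bd _ _ st)) => //; rewrite /deg; lia.
apply: (@runs_seq _ _ _ _ _ _ _ (at_ (gk 0 (0 < n)) m)); last move=> s2 st2.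
- have hsz : size (set_nth 0 g 18 0) = NG by rewrite size_set_nth_NG.
  apply: (runs_weaken (runs_set hsz b0 _ _ st1)) => //.
  + by rewrite /=; lia.
  + by rewrite /= nsn /=; lia.
  + by rewrite /= hcnt.
apply: h.
- move=> r s3 [k [mk [kn er fk stk]]] cond.
  have kn' : k < n.
    have := stk.1 19 isT; rewrite !nsn /= => e1; move: cond; rewrite e1.
    by case: (k < n).
  rewrite kn' in stk.
  have [eo ec ee] := hk k 1 mk kn fk.
  have bdk := bk k 1 mk kn isT fk.
  apply: runs_seq (runs_weaken (runs_store (szk k 1) bdk dOff dE stk) _ (fun s' q => q)) _.
    by rewrite Mk cost_addr.
  move=> s4; set mk' := (X in at_ _ X) => st4.
  have fk' : filled j offv k.+1 val m mk'.
    have e18 : nth 0 (gk k 1) 18 = k by rewrite !nsn.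
    have [h1 h2] := fk; rewrite /mk' /= eo ee// e18; split.
      move=> i; rewrite ltnS leq_eqVlt => /orP[/eqP ->|ik] /=; first by rewrite eqxx.
      by rewrite ifF ?h1//; lia.
    move=> a ha /=; rewrite ifF; last by apply/eqP; apply: ha.
    by apply: h2 => i ik; apply: ha; lia.
  have bd4 : bounded inp (gk k 1) mk' Y.
    have := bk k.+1 1 mk' kn' isT fk'; case=> _ _ _ hm'; split=> //;
    by case: bdk.
  apply: runs_seq (runs_weaken (T' := 4) (runs_set (e := O OAdd (G 18) (K 1)) (szk k 1) bd4 _ (isT : 18 < NG) st4) _ (fun s' q => q)) _.
  + by rewrite /=; lia.
  + by rewrite /=.
  move=> s5 st5.
  have e5 : set_nth 0 (gk k 1) 18 (eval inp (gk k 1) mk' [::] (O OAdd (G 18) (K 1))) = gk k.+1 1.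
    apply: (@eq_from_nth _ 0); rewrite ?size_set_nth_NG// => i iN.
    by rewrite /= !nsn /= addn1; do !case: eqP => //; lia.
  rewrite e5 in st5.
  have bd5 := bk k.+1 1 mk' kn' isT fk'.
  apply: (runs_weaken (runs_set (e := O OLt (G 18) cnt) (szk k.+1 1) bd5 _ (isT : 19 < NG) st5)).
  + by rewrite /=; lia.
  + by rewrite Mk /=; lia.
  move=> s6 st6; exists (n - k.+1); first by lia.
  exists k.+1, mk'; split=> //.
  have [_ ec' _] := hk k.+1 1 mk' kn' fk'.
  move: st6; rewrite /= ec' !nsn /=.
  by rewrite set_set_nth eqxx.
- exists 0, m; rewrite subn0; split=> //; split=> [//|a _]; by [].
Qed.

End Statements.

(** * Simulating and undoing a sub-program *)
(** Straight-line blocks are executed by computation, which leaves only the overflow conditions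
    [slok] to prove. The default case is a dummy value that [slok] excludes. *)
Fixpoint slrun (inp : seq nat) (c : cmd) (s : state) : state :=
  match c with
  | Assign x e => setr s x (eval_rhs inp s e)
  | WriteMem x y => setm s (reg s x) (reg s y)
  | Seq a b => slrun inp b (slrun inp a s)
  | _ => s
  end.

Fixpoint slok (inp : seq nat) (w : nat) (c : cmd) (s : state) : Prop :=
  match c with
  | Assign x e => eval_rhs inp s e < 2 ^ w
  | WriteMem x y => True
  | Seq a b => slok inp w a s /\ slok inp w b (slrun inp a s)
  | _ => False
  end.

Fixpoint sltime (c : cmd) : nat :=
  match c with Seq a b => sltime a + sltime b | _ => 1 end.

Lemma slexec inp w c s : slok inp w c s ->
  exec inp w c s (slrun inp c s) (sltime c).
Proof.
elim: c s => //= [x e|x y|a IHa b IHb] s.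
- exact: exec_assign.
- by move=> _; exact: exec_write.
- by move=> [/IHa xa /IHb xb]; exact: exec_seq xa xb.
Qed.

Fixpoint seqs (c : cmd) (l : seq cmd) : cmd :=
  if l is d :: l' then Seq c (seqs d l') else c.

(** Registers of the simulated program become the odd ones; the even ones belong to the solver. *)
Definition rin x := x.*2.+1.

Lemma rin_eq x y : (rin x == rin y) = (x == y).
Proof. by rewrite /rin eqSS (inj_eq double_inj). Qed.

Lemma rin_even x : (((rin x == 30) = false) * ((rin x == 40) = false) *
  ((rin x == 42) = false) * ((rin x == 44) = false) * ((rin x == 46) = false) *
  ((30 == rin x) = false) * ((40 == rin x) = false))%type.
Proof. by do !split; apply/eqP; rewrite /rin; lia. Qed.

Lemma even_rin x i : (i.*2 == rin x) = false.
Proof. by apply/eqP; rewrite /rin; lia. Qed.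

(** Register 30 is the log length. The address is logged already multiplied by 8, so that undoing
    can use it directly. *)
Definition push_write x y :=
  seqs (Assign 40 (Const 8)) [:: Assign 40 (Bin Mul 40 (rin x));
    Assign 42 (ReadMem 40); Assign 44 (Const 8); Assign 44 (Bin Mul 44 30);
    Assign 46 (Const 3); Assign 44 (Bin Add 44 46); WriteMem 44 40;
    Assign 46 (Const 1); Assign 44 (Bin Add 44 46); WriteMem 44 42;
    Assign 30 (Bin Add 30 46); WriteMem 40 (rin y)].

(* Runs [c] on registers [rin _] and memory region 0, with its input in region
   [jin]; every overwritten cell is logged in regions 3 and 4. *)
Fixpoint sim (jin : nat) (c : cmd) : cmd :=
  match c with
  | Skip => Skip
  | Assign x (Const v) => Assign (rin x) (Const v)
  | Assign x (Bin o y z) => Assign (rin x) (Bin o (rin y) (rin z))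
  | Assign x (ReadMem y) => seqs (Assign 40 (Const 8))
      [:: Assign 40 (Bin Mul 40 (rin y)); Assign (rin x) (ReadMem 40)]
  | Assign x (ReadInput y) => seqs (Assign 40 (Const 8))
      [:: Assign 40 (Bin Mul 40 (rin y)); Assign 42 (Const jin);
          Assign 40 (Bin Add 40 42); Assign (rin x) (ReadMem 40)]
  | WriteMem x y => push_write x y
  | Seq a b => Seq (sim jin a) (sim jin b)
  | If x a b => If (rin x) (sim jin a) (sim jin b)
  | While x a => While (rin x) (sim jin a)
  end.

Fixpoint regs_below (R : nat) (c : cmd) : bool :=
  match c with
  | Skip => true
  | Assign x e => (x < R) && match e with
      | Const _ => true
      | Bin _ y z => (y < R) && (z < R)
      | ReadMem y | ReadInput y => y < R
      end
  | WriteMem x y => (x < R) && (y < R)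
  | Seq a b => regs_below R a && regs_below R b
  | If x a b => [&& x < R, regs_below R a & regs_below R b]
  | While x a => (x < R) && regs_below R a
  end.

Lemma regs_below_le R R' c : R <= R' -> regs_below R c -> regs_below R' c.
Proof.
move=> le; elim: c => //=.
- by move=> x [v|o y z|y|y] /andP[h]; rewrite (leq_trans h le) //=;
    [move=> /andP[h1 h2]; rewrite !(leq_trans _ le) | move/leq_trans; exact
    | move/leq_trans; exact].
- by move=> x y /andP[h1 h2]; rewrite !(leq_trans _ le).
- by move=> a IHa b IHb /andP[/IHa -> /IHb ->].
- by move=> x a IHa b IHb /and3P[h /IHa -> /IHb ->]; rewrite (leq_trans h le).
- by move=> x a IHa /andP[h /IHa ->]; rewrite (leq_trans h le).
Qed.

Lemma regs_below_exists c : exists R, regs_below R c.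
Proof.
elim: c => //=.
- by exists 0.
- move=> x [v|o y z|y|y].
  + by exists x.+1; rewrite ltnSn.
  + by exists (x + y + z).+1; lia.
  + by exists (x + y).+1; lia.
  + by exists (x + y).+1; lia.
- by move=> x y; exists (x + y).+1; lia.
- move=> a [Ra ha] b [Rb hb]; exists (Ra + Rb).
  by rewrite (regs_below_le (leq_addr _ _) ha) (regs_below_le (leq_addl _ _) hb).
- move=> x a [Ra ha] b [Rb hb]; exists (x.+1 + (Ra + Rb)).
  rewrite leq_addr (regs_below_le _ ha); last by lia.
  by rewrite (regs_below_le _ hb)//; lia.
- move=> x a [Ra ha]; exists (x.+1 + Ra).
  by rewrite leq_addr (regs_below_le _ ha)//; lia.
Qed.

Definition small w (s : state) :=
  (forall x, reg s x < 2 ^ w) /\ (forall a, mem s a < 2 ^ w).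

Lemma exec_small inp w c s s' t : exec inp w c s s' t -> small w s -> small w s'.
Proof.
elim=> {c s s' t} //=.
- move=> x e s h [hr hm]; split=> //= y; by case: eqP.
- move=> x y s [hr hm]; split=> //= a; by case: eqP.
- by move=> *; auto.
- by move=> *; auto.
Qed.

(** The log grows at its end, so [foldr] restores the latest entry first and the oldest value of a
    cell prevails. *)
Definition undo (L : seq (nat * nat)) (m : nat -> nat) : nat -> nat :=
  foldr (fun e m => [eta m with e.1 |-> e.2]) m L.

Definition region (mm : nat -> nat) r : nat -> nat := fun a => mm (8 * a + r).

Record simrel R (sg : state) (L : seq (nat * nat)) (s : state) : Prop := Simrel {
  sim_reg : forall x, x < R -> reg s (rin x) = reg sg x;
  sim_mem : forall a, mem s (8 * a) = mem sg a;
  sim_lp : reg s 30 = size L;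
  sim_log : forall i, i < size L ->
    mem s (8 * i + 3) = 8 * (nth (0, 0) L i).1 /\ mem s (8 * i + 4) = (nth (0, 0) L i).2 }.

(** The exceptions are what a simulation or an undo may change: global 15 is the log length, region
    0 the simulated memory, regions 3 and 4 the log. *)
Definition keeps (s s' : state) :=
  (forall i, i < NG -> i != 15 -> reg s' i.*2 = reg s i.*2) /\
  (forall a r, r < 8 -> r \notin [:: 0; 3; 4] -> mem s' (8 * a + r) = mem s (8 * a + r)).

Lemma keeps_trans s1 s2 s3 : keeps s1 s2 -> keeps s2 s3 -> keeps s1 s3.
Proof.
by move=> [r1 m1] [r2 m2]; split=> *; [rewrite r2// r1 | rewrite m2// m1].
Qed.

Lemma setr_keeps s x v : keeps s (setr s (rin x) v).
Proof. by split=> //= i _ _; rewrite even_rin. Qed.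

Lemma setr_temp_keeps s x v : (40 <= x) -> keeps s (setr s x v).
Proof.
move=> x40; split=> //= i iN _; case: eqP => // e.
by move: x40; rewrite -e; lia.
Qed.

Section Sim.
Variables (R jin w w' : nat) (inp inp' : seq nat).
Hypothesis ww : w' + 4 <= w.

Definition small_entry (e : nat * nat) := (e.1 < 2 ^ w') && (e.2 < 2 ^ w').

Lemma small_addr x c : x < 2 ^ w' -> c < 8 -> 8 * x + c < 2 ^ w.
Proof.
move=> hx hc; apply: leq_trans (_ : 2 ^ (w' + 4) <= _); last by rewrite leq_exp2l.
by rewrite expnD; lia.
Qed.

Lemma w_ge16 : 16 <= 2 ^ w.
Proof.
apply: leq_trans (_ : 2 ^ (w' + 4) <= _); last by rewrite leq_exp2l.
by rewrite expnD leq_pmull// expn_gt0.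
Qed.

Hypothesis hjin : jin = 1 \/ jin = 2.

Let input s := forall a, mem s (8 * a + jin) = nth 0 inp' a.

Lemma keeps_input s s' : keeps s s' -> input s -> input s'.
Proof. by move=> [_ h] hi a; rewrite h//; case: hjin => ->. Qed.

Lemma sim_setr sg L s x v : simrel R sg L s -> simrel R (setr sg x v) L (setr s (rin x) v).
Proof.
move=> [hr hm hl hlog]; split=> //=.
  by move=> y yR; rewrite rin_eq; case: eqP => // _; exact: hr.
by rewrite rin_even.
Qed.

Lemma sim_temp sg L s x v : simrel R sg L s -> 40 <= x -> ~~ odd x ->
  simrel R sg L (setr s x v).
Proof.
move=> [hr hm hl hlog] x40 xe; split=> //=.
  move=> y yR; rewrite ifF; first exact: hr.
  by apply/eqP => e; move: xe; rewrite -e /rin /= odd_double.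
by rewrite ifF//; lia.
Qed.

Lemma sim_push sg L s x y : simrel R sg L s -> small w' sg -> x < R -> y < R ->
  8 * size L + 8 < 2 ^ w ->
  exists s', [/\ exec inp w (push_write x y) s s' 13,
    simrel R (setm sg (reg sg x) (reg sg y)) (rcons L (reg sg x, mem sg (reg sg x))) s' &
    keeps s s'].
Proof.
move=> [hr hm hl hlog] [sr sm] xR yR hL.
have hx := hr x xR; have hy := hr y yR; have w16 := w_ge16.
have ex := @slexec inp w (push_write x y) s.
have ok : slok inp w (push_write x y) s.
  rewrite /= !rin_even hx hm hl /=.
  have := @small_addr _ 0 (sr x) isT; rewrite addn0 => h1.
  have h2 : mem sg (reg sg x) < 2 ^ w.
    by apply: leq_trans (sm _) _; rewrite leq_exp2l//; lia.
  by do !split=> //; lia.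
move: (ex ok) => {}ex.
eexists; split; first exact: ex.
  split=> /=.
  - move=> z zR; rewrite !rin_even; exact: hr.
  - move=> a; rewrite !rin_even hx hy hl hm.
    rewrite eqn_mul2l /=; case: eqP => // _.
    by rewrite !ifF ?hm//; lia.
  - by rewrite hl size_rcons addn1.
  - move=> i; rewrite size_rcons ltnS !rin_even hx hl hm /= -addnA => iL.
    have -> : (8 * i + 3 == 8 * reg sg x) = false by lia.
    have -> : (8 * i + 4 == 8 * reg sg x) = false by lia.
    have -> : (8 * i + 3 == 8 * size L + (3 + 1)) = false by lia.
    have -> : (8 * i + 4 == 8 * size L + 3) = false by lia.
    rewrite !eqn_add2r eqn_mul2l /= nth_rcons.
    move: iL; rewrite leq_eqVlt => /orP[/eqP ->|iL]; first by rewrite ltnn !eqxx.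
    by rewrite (ltn_eqF iL) iL; exact: hlog.
split=> /=.
  move=> i iN i15; rewrite !ifF//; lia.
move=> a r r8; rewrite !inE !negb_or => /and3P[r0 r3 r4].
by rewrite !rin_even hx hl !ifF//; lia.
Qed.

(** The factor 13 is the length of [push_write], the longest translation of one instruction. A step
    logs at most one cell, so the log is no longer than the run. Four extra bits in [w] accommodate
    addresses multiplied by 8 plus a region number. *)
Lemma sim_correct c sg sg' t : exec inp' w' c sg sg' t -> regs_below R c -> small w' sg ->
  forall s L, simrel R sg L s -> input s -> 8 * (size L + t) + 8 < 2 ^ w ->
  exists s' L' t', [/\ exec inp w (sim jin c) s s' t', t' <= 13 * t,
    simrel R sg' (L ++ L') s', keeps s s' &
    [/\ undo L' (mem sg') = mem sg, size L' <= t & all small_entry L']].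
Proof.
have w16 := w_ge16.
have wle v : v < 2 ^ w' -> v < 2 ^ w.
  by move=> h; apply: leq_trans h _; rewrite leq_exp2l//; lia.
elim=> {c sg sg' t}.
- move=> sg _ _ s L sr _ _; exists s, [::], 1; rewrite cats0.
  by split=> //; exact: exec_skip.
- move=> x [v|o y z|y|y] sg hv /= /andP[xR hR] [ssr ssm] s L sr hi hL.
  + exists (setr s (rin x) v), [::], 1; rewrite cats0; split=> //.
    * by apply: exec_set => //; exact: wle.
    * exact: sim_setr.
    * exact: setr_keeps.
  + case/andP: hR => yR zR.
    exists (setr s (rin x) (eval_binop o (reg sg y) (reg sg z))), [::], 1; rewrite cats0.
    split=> //.
    * by apply: exec_set; [rewrite /= !(sim_reg sr) | exact: wle].
    * exact: sim_setr.
    * exact: setr_keeps.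
  + pose s1 := setr (setr s 40 8) 40 (8 * reg sg y).
    exists (setr s1 (rin x) (mem sg (reg sg y))), [::], (1 + (1 + 1)); rewrite cats0; split=> //.
    * apply: (@exec_seq _ _ _ _ _ (setr s 40 8)); first by apply: exec_set => //; lia.
      apply: (@exec_seq _ _ _ _ _ s1).
        apply: exec_set; first by rewrite /= rin_even (sim_reg sr).
        by have := @small_addr _ 0 (ssr y) isT; rewrite addn0.
      by apply: exec_set; [rewrite /= (sim_mem sr) | exact: wle].
    * by apply: sim_setr; do 2! [apply: sim_temp => //].
    * by apply: keeps_trans (setr_keeps _ _ _); do 2! [apply: keeps_trans (setr_temp_keeps _ _ _) => //].
  + pose s1 := setr (setr s 40 8) 40 (8 * reg sg y).
    pose s2 := setr (setr s1 42 jin) 40 (8 * reg sg y + jin).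
    have j8 : jin < 8 by case: hjin => ->.
    exists (setr s2 (rin x) (nth 0 inp' (reg sg y))), [::], (1 + (1 + (1 + (1 + 1)))); rewrite cats0; split=> //.
    * apply: (@exec_seq _ _ _ _ _ (setr s 40 8)); first by apply: exec_set => //; lia.
      apply: (@exec_seq _ _ _ _ _ s1).
        apply: exec_set; first by rewrite /= rin_even (sim_reg sr).
        by have := @small_addr _ 0 (ssr y) isT; rewrite addn0.
      apply: (@exec_seq _ _ _ _ _ (setr s1 42 jin)); first by apply: exec_set => //; lia.
      apply: (@exec_seq _ _ _ _ _ s2); first by apply: exec_set => //; exact: small_addr.
      by apply: exec_set; [rewrite /= hi | exact: wle].
    * by apply: sim_setr; do 4! [apply: sim_temp => //].
    * by apply: keeps_trans (setr_keeps _ _ _); do 4! [apply: keeps_trans (setr_temp_keeps _ _ _) => //].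
- move=> x y sg /= /andP[xR yR] ssm s L sr hi hL; have [ssr' ssm'] := ssm.
  have [|s' [ex sr' ks]] := sim_push sr ssm xR yR; first by lia.
  exists s', [:: (reg sg x, mem sg (reg sg x))], 13; split=> //.
    by rewrite cats1.
  split=> //=; last by rewrite /small_entry /= ssr' ssm'.
  by apply: functional_extensionality => a /=; case: eqP => [->|].
- move=> c1 c2 sg s1 s2 t1 t2 x1 IH1 x2 IH2 /= /andP[R1 R2] ssm s L sr hi hL.
  have [|s1' [L1 [t1' [e1 le1 sr1 k1 [u1 z1 a1]]]]] := IH1 R1 ssm s L sr hi; first by lia.
  have [|s2' [L2 [t2' [e2 le2 sr2 k2 [u2 z2 a2]]]]] :=
    IH2 R2 (exec_small x1 ssm) s1' _ sr1 (keeps_input k1 hi); first by rewrite size_cat; lia.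
  exists s2', (L1 ++ L2), (t1' + t2'); split.
  + exact: exec_seq e1 e2.
  + by lia.
  + by rewrite catA.
  + exact: keeps_trans k1 k2.
  + rewrite size_cat leq_add// all_cat a1 a2; split=> //.
    by rewrite -u1 -u2 /undo foldr_cat.
- move=> x c1 c2 sg s1 t hx x1 IH1 /= /and3P[xR R1 R2] ssm s L sr hi hL.
  have [|s1' [L1 [t1' [e1 le1 sr1 k1 [u1 z1 a1]]]]] := IH1 R1 ssm s L sr hi; first by lia.
  exists s1', L1, t1'.+1; split=> //; [|by lia|by split=> //; lia].
  by apply: exec_if_true e1; rewrite (sim_reg sr).
- move=> x c1 c2 sg s1 t hx x1 IH1 /= /and3P[xR R1 R2] ssm s L sr hi hL.
  have [|s1' [L1 [t1' [e1 le1 sr1 k1 [u1 z1 a1]]]]] := IH1 R2 ssm s L sr hi; first by lia.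
  exists s1', L1, t1'.+1; split=> //; [|by lia|by split=> //; lia].
  by apply: exec_if_false e1; rewrite (sim_reg sr).
- move=> x c sg hx /= /andP[xR _] ssm s L sr hi hL.
  exists s, [::], 1; rewrite cats0; split=> //.
  by apply: exec_while_false; rewrite (sim_reg sr).
- move=> x c sg s1 s2 t1 t2 hx x1 IH1 x2 IH2 /= /andP[xR R1] ssm s L sr hi hL.
  have [|s1' [L1 [t1' [e1 le1 sr1 k1 [u1 z1 a1]]]]] := IH1 R1 ssm s L sr hi; first by lia.
  have [||s2' [L2 [t2' [e2 le2 sr2 k2 [u2 z2 a2]]]]] :=
    IH2 _ (exec_small x1 ssm) s1' _ sr1 (keeps_input k1 hi).
  + by rewrite /= xR.
  + by rewrite size_cat; lia.
  exists s2', (L1 ++ L2), (t1' + t2').+1; split.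
  + by apply: exec_while_true e1 e2; rewrite (sim_reg sr).
  + by lia.
  + by rewrite catA.
  + exact: keeps_trans k1 k2.
  + rewrite size_cat all_cat a1 a2; split=> //; last by lia.
    by rewrite -u1 -u2 /undo foldr_cat.
Qed.

Definition zero_regs := foldr (fun x c => Seq (Assign (rin x) (Const 0)) c) Skip (iota 0 R).

Lemma zero_regs_correct s : exists s', [/\ exec inp w zero_regs s s' R.+1,
   forall x, x < R -> reg s' (rin x) = 0, mem s' = mem s &
   forall i, reg s' i.*2 = reg s i.*2].
Proof.
have w16 := w_ge16.
suff h l s0 : exists s', [/\
    exec inp w (foldr (fun x c => Seq (Assign (rin x) (Const 0)) c) Skip l) s0 s' (size l).+1,
   forall x, (x \in l) || (reg s0 (rin x) == 0) -> reg s' (rin x) = 0, mem s' = mem s0 &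
   forall i, reg s' i.*2 = reg s0 i.*2].
  have [s' [ex h1 h2 h3]] := h (iota 0 R) s; exists s'; split=> //.
    by rewrite size_iota in ex.
  by move=> x xR; apply: h1; rewrite mem_iota xR.
elim: l s0 => [|y l IH] s0 /=.
  by exists s0; split=> //; [exact: exec_skip | move=> x /eqP].
have [s' [ex h1 h2 h3]] := IH (setr s0 (rin y) 0); exists s'; split=> //.
- rewrite -add1n; apply: exec_seq ex; apply: exec_set => //; lia.
- move=> x hx; apply: h1; rewrite /= rin_eq; move: hx; rewrite inE.
  by case: eqP => //= _; rewrite orbT.
- by move=> i; rewrite h3 /= even_rin.
Qed.

End Sim.

Definition undo_last :=
  seqs (Assign 42 (Const 1)) [:: Assign 30 (Bin Defs.Sub 30 42);
    Assign 42 (Const 8); Assign 42 (Bin Mul 42 30); Assign 44 (Const 3);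
    Assign 42 (Bin Add 42 44); Assign 44 (ReadMem 42); Assign 46 (Const 1);
    Assign 42 (Bin Add 42 46); Assign 46 (ReadMem 42); WriteMem 44 46;
    Assign 40 (Bin Lt 32 30)].

(* Register 30 holds the length of the log, register 32 the length to return to. *)
Definition undo_to_mark := Seq (Assign 40 (Bin Lt 32 30)) (While 40 undo_last).

Record logged (mu : nat -> nat) (L : seq (nat * nat)) (s : state) : Prop := Logged {
  logged_mem : forall a, mem s (8 * a) = mu a;
  logged_lp : reg s 30 = size L;
  logged_log : forall i, i < size L ->
    mem s (8 * i + 3) = 8 * (nth (0, 0) L i).1 /\ mem s (8 * i + 4) = (nth (0, 0) L i).2 }.

(** Induction from the end of the log, where entries are popped. Each entry costs the 12
    instructions of [undo_last] and one loop test. *)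
Lemma undo_correct inp w mu L L' s : logged mu (L ++ L') s -> reg s 32 = size L ->
  8 * size (L ++ L') + 8 < 2 ^ w ->
  (forall e, e \in L' -> 8 * e.1 < 2 ^ w /\ e.2 < 2 ^ w) -> 
  runs inp w undo_to_mark s (13 * size L' + 2)
    (fun s' => logged (undo L' mu) L s' /\ keeps s s').
Proof.
move=> lg hmark hw hsm.
have w16 : 8 < 2 ^ w by lia.
pose s0 := setr s 40 (size L < size L + size L').
have ex0 : exec inp w (Assign 40 (Bin Lt 32 30)) s s0 1.
  apply: exec_set; last by apply: leq_ltn_trans (leq_b1 _) _; lia.
  by rewrite /= hmark (logged_lp lg) size_cat.
suff [s' [ex lg' k']] : exists s', [/\ exec inp w (While 40 undo_last) s0 s' (13 * size L' + 1), logged (undo L' mu) L s' & keeps s0 s'].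
  apply: runs_exec (exec_seq ex0 ex) _ _; first by lia.
  by split=> //; apply: keeps_trans (setr_temp_keeps _ _ (leqnn _)) k'.
have lg0 : logged mu (L ++ L') s0 by case: lg.
have hmark0 : reg s0 32 = size L by [].
have hc0 : reg s0 40 = (size L < size L + size L') by [].
clear lg hmark ex0; clearbody s0.
elim/last_ind: L' mu s0 hw hsm lg0 hmark0 hc0
  => [|L' [a v] IH] mu s0 hw hsm [hm hl hlog] hmark hc.
  exists s0; split=> //; last by rewrite cats0 in hl hlog.
  by apply: exec_while_false; rewrite hc addn0 ltnn.
rewrite -rcons_cat in hl hlog hw; rewrite size_rcons in hc.
rewrite size_rcons in hl hlog hw.
have [h3 h4] := hlog _ (ltnSn _); rewrite nth_rcons ltnn eqxx /= in h3 h4.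
have [ha hv] : 8 * a < 2 ^ w /\ v < 2 ^ w.
  by apply: (hsm (a, v)); rewrite mem_rcons inE eqxx.
set n := size (L ++ L') in hl h3 h4 hw *.
set body := undo_last.
have ok : slok inp w body s0.
  rewrite /= hl hmark subn1 /= -addnA h3 /= h4.
  by do !split=> //; try lia; apply: leq_ltn_trans (leq_b1 _) _; lia.
have ex := slexec ok.
set s1 := slrun inp body s0 in ex.
have lg1 : logged [eta mu with a |-> v] (L ++ L') s1.
  split.
  - move=> b; rewrite /= hl subn1 /= -addnA h3 h4 eqn_mul2l /=.
    by case: eqP.
  - by rewrite /= hl subn1.
  - move=> i iL; have [] := hlog i (ltnW iL); rewrite nth_rcons iL => h5 h6.
    by rewrite /= hl subn1 /= -addnA h3 h4 !ifF//; lia.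
have [|e eL'|||s' [ex' lg' k']] := IH _ s1 _ _ lg1.
- by rewrite -/n; lia.
- by apply: hsm; rewrite mem_rcons inE eL' orbT.
- by rewrite /= hmark.
- by rewrite /= hmark hl subn1 /= /n size_cat.
exists s'; split.
- rewrite size_rcons (_ : _ + 1 = (12 + (13 * size L' + 1)).+1); last by lia.
  by apply: exec_while_true ex ex'; rewrite hc; lia.
- by rewrite /undo foldr_rcons.
- apply: keeps_trans k'; split.
    by move=> i iN i15; rewrite /= !ifF//; lia.
  move=> b r r8; rewrite !inE !negb_or => /and3P[r0 r3 r4].
  by rewrite /= hl subn1 /= -addnA h3 ifF//; lia.
Qed.

(** * Clause codes and the branching step *)
Section Codes.
Variables (l k : nat).

(** A clause code has [k] digits in base [l.+1]: the digit [x.+1] stands for literal [x], and 0 is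
    padding. Every set of at most [k] literals thus has a code below [l.+1 ^ k]. *)
Fixpoint isin (k c x : nat) : bool :=
  if k is k'.+1 then (c %% l.+1 == x.+1) || isin k' (c %/ l.+1) x else false.

Definition code (s : seq nat) := foldr (fun x c => x.+1 + l.+1 * c) 0 s.

Lemma isin0 j x : isin j 0 x = false.
Proof. by elim: j => //= j IH; rewrite mod0n div0n IH. Qed.

Lemma isin_code j s x : all (ltn^~ l) s -> size s <= j -> isin j (code s) x = (x \in s).
Proof.
elim: s j => [|y s IH] j; first by rewrite isin0.
case: j => //= j /andP[yl sl] sj.
rewrite addnC mulnC modnMDl modn_small ?ltnS// divnMDl// divn_small ?ltnS// addn0.
by rewrite IH// inE eqSS eq_sym.
Qed.

Lemma code_lt s : all (ltn^~ l) s -> code s < l.+1 ^ size s.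
Proof.
elim: s => //= y s IH /andP[yl /IH h]; rewrite expnS; nia.
Qed.

Lemma code_inj s s' : all (ltn^~ l) s -> all (ltn^~ l) s' -> code s = code s' -> s = s'.
Proof.
elim: s s' => [|y s IH] [|z s'] //=.
  move=> /andP[yl hs] /andP[zl hs'] e.
  have ey : y = z.
    have := congr1 (modn^~ l.+1) e; rewrite !(addnC _.+1) !(mulnC l.+1) !modnMDl.
    by rewrite !modn_small ?ltnS// => -[].
  by rewrite ey (IH s')//; move: e; rewrite ey => /addnI/eqP; rewrite eqn_mul2l => /eqP.
Qed.

Definition decode (c : nat) : {set 'I_l} := [set x : 'I_l | isin k c x].

Lemma decode_surj (C : {set 'I_l}) : #|C| <= k ->
  exists2 c, c < l.+1 ^ k & decode c = C.
Proof.
move=> Ck; pose s := [seq val x | x <- enum C].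
have sl : all (ltn^~ l) s by apply/allP => _ /mapP[x _ ->]; exact: ltn_ord.
have szs : size s = #|C| by rewrite size_map cardE.
exists (code s).
  by apply: leq_trans (code_lt sl) _; rewrite leq_pexp2l// szs.
apply/setP => x; rewrite inE isin_code// ?szs// mem_map; last exact: val_inj.
by rewrite mem_enum.
Qed.

Lemma card_decode c : #|decode c| <= k.
Proof.
rewrite /decode; elim: k c => [|j IH] c /=.
  by rewrite (_ : [set _ | _] = set0) ?cards0//; apply/setP => x; rewrite !inE.
apply: leq_trans (_ : #|[set x : 'I_l | c %% l.+1 == x.+1] :|: [set x : 'I_l | isin j (c %/ l.+1) x]| <= _).
  by apply/subset_leq_card/subsetP => x; rewrite !inE.
apply: leq_trans (leq_card_setU _ _) _; rewrite -[j.+1]add1n; apply: leq_add => //.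
apply/card_le1_eqP => x y; rewrite !inE => /eqP -> /eqP[e].
by apply: val_inj.
Qed.

Lemma has_ord M (p : nat -> bool) : l <= M ->
  has (fun x => (x < l) && p x) (iota 0 M) = [exists x : 'I_l, p x].
Proof.
move=> lM; apply/hasP/existsP => [[x _ /andP[xl px]]|[x px]].
  by exists (Ordinal xl).
by exists (val x); rewrite ?mem_iota ?ltn_ord ?(leq_trans _ lM)//=.
Qed.

Lemma has_code M (p : {set 'I_l} -> bool) : l.+1 ^ k <= M ->
  has (fun c => p (decode c)) (iota 0 M) = [exists C : {set 'I_l}, (#|C| <= k) && p C].
Proof.
move=> kM; apply/hasP/existsP => [[c _ pc]|[C /andP[/decode_surj[c lt <-] pc]]].
  by exists (decode c); rewrite card_decode.
by exists c; rewrite ?mem_iota ?(leq_trans lt).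
Qed.

(** A set has several codes, since digits can be permuted or repeated. Counting only least codes
    turns the cardinality of a family of sets into a sum over numbers. *)
Definition canon M c := ~~ has (fun c' => (c' < c) && (decode c' == decode c)) (iota 0 M).

Lemma canonP M c : c < M ->
  reflect (forall c', c' < c -> decode c' != decode c) (canon M c).
Proof.
move=> cM; apply: (iffP hasPn) => h c'.
  move=> lt; have := h c'; rewrite mem_iota lt /=; apply.
  exact: ltn_trans cM.
by move=> _; rewrite negb_and -leqNgt; case: leqP => //= /h.
Qed.

Lemma canon_exists M c : c < M -> exists2 c', c' < M & canon M c' /\ decode c' = decode c.
Proof.
move=> cM; have ex : exists c', decode c' == decode c by exists c.
case: (ex_minnP ex) => c' /eqP e min.
have c'M : c' < M by apply: leq_ltn_trans cM; exact: min.
exists c' => //; split=> //; apply/canonP => // c'' lt; rewrite e.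
by apply/negP => /min; lia.
Qed.

Lemma canon_uniq M c c' : c < M -> c' < M -> canon M c -> canon M c' ->
  decode c = decode c' -> c = c'.
Proof.
move=> cM c'M /canonP -/(_ cM) h /canonP -/(_ c'M) h' e.
by case: (ltngtP c c') => // [/h'|/h]; rewrite e eqxx.
Qed.

Lemma card_canon M (p : {set 'I_l} -> bool) : l.+1 ^ k <= M ->
  (forall C, p C -> #|C| <= k) ->
  #|[set C | p C]| = count (fun c => canon M c && p (decode c)) (iota 0 M).
Proof.
move=> kM pk; rewrite -size_filter; set s := filter _ _.
have us : uniq s by rewrite filter_uniq ?iota_uniq.
have sP c : c \in s -> [/\ c < M, canon M c & p (decode c)].
  by rewrite mem_filter mem_iota => /andP[/andP[]].
have dinj : {in s &, injective decode}.
  by move=> c c' /sP[h1 h2 _] /sP[h1' h2' _]; exact: (canon_uniq (M := M)).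
have um : uniq (map decode s) by rewrite map_inj_in_uniq.
rewrite -(size_map decode) -(card_uniqP um).
apply: eq_card => C; rewrite inE; apply/idP/mapP => [pC|[c /sP[_ _ pc] ->//]].
have [c0 c0M e0] := decode_surj (pk _ pC).
have [c cM [cc e]] := canon_exists (leq_trans c0M kM).
exists c; last by rewrite e e0.
by rewrite mem_filter mem_iota cM cc e e0 pC.
Qed.

End Codes.

Definition orE a b := O OLt (K 0) (O OAdd a b).
Definition andE a b := O OMul a b.
Definition notE a := O OEq a (K 0).
Definition impE a b := orE (notE a) b.
Definition leE a b := O OLt a (O OAdd b (K 1)).
Definition ifE c a b := O OAdd (O OMul c a) (O OMul (notE c) b).
Definition exE a := O OLt (K 0) (Sum a).
Definition allE a := notE (exE (notE a)).
(** [call2] evaluates [a] under the binder of [b]. Its arguments here are only variables and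
    globals, for which this shift suffices. *)
Definition sh e := if e is V i then V i.+1 else e.
Definition call2 f a b := Let b (Let (sh a) f).

Fixpoint litE k ec ex :=
  if k is k'.+1 then
    orE (O OEq (O OMod ec (G 4)) (O OAdd ex (K 1))) (litE k' (O ODiv ec (G 4)) ex)
  else K 0.

Section Expr.
Variable k : nat.

(* The arguments of the following expressions are the topmost variables. *)
Definition subE := allE (impE (andE (O OLt (V 0) (G 3)) (litE k (V 1) (V 0)))
                              (litE k (V 2) (V 0))).
Definition sizeE := Sum (andE (O OLt (V 0) (G 3)) (litE k (V 1) (V 0))).
Definition eqE := andE subE (call2 subE (V 1) (V 0)).
Definition memE := Rd false (O OAdd (O OMul (G 10) (G 6)) (V 0)).
Definition minE :=
  andE memE (notE (exE (andE memE (andE subE (notE (call2 subE (V 1) (V 0))))))).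
Definition canonE := notE (exE (andE (O OLt (V 0) (V 1)) eqE)).
Definition corollaE := andE minE (andE (call2 subE (V 1) (V 0)) (O OEq sizeE (V 2))).
Definition countE := Sum (andE canonE corollaE).
Definition thE (th : nat -> nat) :=
  foldr (fun j acc => O OAdd (O OMul (O OEq (V 2) (K j)) (K (th j))) acc)
    (K 0) (iota 0 k.+1).
Definition flowerE th := andE (O OLt (K 0) sizeE) (andE (O OLt (K 0) (V 2))
  (andE (O OEq (O OAdd sizeE (V 2)) (V 1)) (leE (thE th) countE))).
(** The triple of [H], [s] and [i] is coded by [(s * k.+1 + i) * l.+1 ^ k + h], where [h] is a code
    of [H], so that numerical order refines the lexicographic order on sizes. *)
Definition letHsi z e :=
  Let (O OMod (O ODiv z (G 5)) (K k.+1))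
    (Let (O ODiv (O ODiv (sh z) (G 5)) (K k.+1)) (Let (O OMod (sh (sh z)) (G 5)) e)).
(** A sum cannot stop early, so the least index of a flower is obtained as the number of [z] with no
    flower at or below [z]. The value is [M] when there is no flower. *)
Definition findE th := Sum (notE (exE (andE (leE (V 0) (V 1)) (letHsi (V 0) (flowerE th))))).
Definition heartE := orE (Let (G 18) memE) (letHsi (G 11) (call2 eqE (G 18) (V 0))).
Definition petalE := orE (Let (G 18) memE) (letHsi (G 11) (exE (andE corollaE
  (allE (impE (O OLt (V 0) (G 3)) (O OEq (litE k (G 18) (V 0))
    (andE (litE k (V 1) (V 0)) (notE (litE k (V 2) (V 0)))))))))).
End Expr.

Section Eval.
Variables (inp g : seq nat) (m : nat -> nat).
Notation ev := (eval inp g m).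
Notation M := (nth 0 g 6).

Lemma ev_or env a b (p q : bool) : ev env a = p -> ev env b = q ->
  ev env (orE a b) = (p || q).
Proof. by move=> /= -> ->; case: p; case: q. Qed.

Lemma ev_and env a b (p q : bool) : ev env a = p -> ev env b = q ->
  ev env (andE a b) = (p && q).
Proof. by move=> /= -> ->; case: p; case: q. Qed.

Lemma ev_not env a (p : bool) : ev env a = p -> ev env (notE a) = ~~ p.
Proof. by move=> /= ->; case: p. Qed.

Lemma ev_imp env a b (p q : bool) : ev env a = p -> ev env b = q ->
  ev env (impE a b) = (p ==> q).
Proof. by move=> /= -> ->; case: p; case: q. Qed.

Lemma ev_iff env a b (p q : bool) : ev env a = p -> ev env b = q ->
  ev env (O OEq a b) = (p == q).
Proof. by move=> /= -> ->; case: p; case: q. Qed.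

Lemma ev_if env c a b (p : bool) : ev env c = p ->
  ev env (ifE c a b) = if p then ev env a else ev env b.
Proof. by move=> /= ->; case: p; rewrite /= ?mul1n ?mul0n ?addn0. Qed.

Lemma ev_le env a b : ev env (leE a b) = (ev env a <= ev env b).
Proof. by rewrite /= addn1 ltnS. Qed.

Lemma ev_sum env a (p : nat -> bool) : (forall i, i < M -> ev (i :: env) a = p i) ->
  ev env (Sum a) = count p (iota 0 M).
Proof.
move=> h /=; rewrite -sum1_count sumnE big_map [RHS]big_mkcond /=.
apply: eq_big_seq => i; rewrite mem_iota => /andP[_ iM]; exact: h.
Qed.

Lemma ev_ex env a (p : nat -> bool) : (forall i, i < M -> ev (i :: env) a = p i) ->
  ev env (exE a) = has p (iota 0 M).
Proof. by move=> /ev_sum h; rewrite has_count -h. Qed.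

Lemma ev_all env a (p : nat -> bool) : (forall i, i < M -> ev (i :: env) a = p i) ->
  ev env (allE a) = all p (iota 0 M).
Proof.
move=> h; rewrite -[all _ _]negbK -has_predC; apply/ev_not/ev_ex => i iM.
by apply: ev_not; exact: h.
Qed.

Variables (l k : nat) (F : {set {set 'I_l}}).
Hypothesis g3 : nth 0 g 3 = l.
Hypothesis g4 : nth 0 g 4 = l.+1.
Hypothesis g5 : nth 0 g 5 = l.+1 ^ k.
Hypothesis lM : l <= M.
Hypothesis kM : k.+1 * k.+1 * l.+1 ^ k <= M.
Hypothesis hF : forall c, c < M ->
  m (8 * (nth 0 g 10 * M + c) + 5) = (decode l k c \in F).
Hypothesis Fk : {in F, forall C : {set 'I_l}, #|C| <= k}.
Notation dec := (decode l k).

Lemma kM' : l.+1 ^ k <= M.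
Proof. by apply: leq_trans kM; rewrite leq_pmull. Qed.

Lemma ev_in env j ec ex :
  ev env (litE j ec ex) = isin l j (ev env ec) (ev env ex).
Proof.
elim: j ec => // j IH ec; rewrite [litE _ _ _]/= (ev_or (p := ev env ec %% l.+1 == (ev env ex).+1) _ (IH _)).
  by rewrite /= g4.
by rewrite /= g4 addn1.
Qed.

Lemma all_ord (p : nat -> bool) :
  all (fun x => (x < l) ==> p x) (iota 0 M) = [forall x : 'I_l, p x].
Proof.
apply: negb_inj; rewrite -has_predC negb_forall -(has_ord (fun x => ~~ p x) lM).
by apply: eq_has => x /=; rewrite negb_imply.
Qed.

Lemma ev_sub c c' env : ev (c :: c' :: env) (subE k) = (dec c \subset dec c').
Proof.
rewrite (@ev_all _ _ (fun x => (x < l) ==> (isin l k c x ==> isin l k c' x))).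
  rewrite all_ord; congr nat_of_bool; apply/forallP/subsetP => h x.
    by rewrite !inE; apply/implyP.
  by apply/implyP => hx; have := h x; rewrite !inE; exact.
move=> x _; rewrite (@ev_imp _ _ _ ((x < l) && isin l k c x) (isin l k c' x)) ?ev_in//.
  by congr nat_of_bool; case: (x < l).
by apply: ev_and; rewrite ?ev_in//= g3.
Qed.

Lemma ev_sub_call c c' env : ev (c :: c' :: env) (call2 (subE k) (V 1) (V 0)) =
  (dec c' \subset dec c).
Proof. exact: (ev_sub c' c (c :: c' :: env)). Qed.

Lemma ev_size c env : ev (c :: env) (sizeE k) = #|dec c|.
Proof.
rewrite (@ev_sum _ _ (fun x => (x < l) && isin l k c x)); last first.
  by move=> x _; apply: ev_and; rewrite ?ev_in//= g3.
rewrite -size_filter cardE -(size_map val).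
apply/perm_size/uniq_perm.
- by rewrite filter_uniq ?iota_uniq.
- by rewrite map_inj_uniq ?enum_uniq//; exact: val_inj.
move=> x; rewrite mem_filter mem_iota /=; apply/idP/mapP.
  by move=> /andP[/andP[xl xc] _]; exists (Ordinal xl) => //; rewrite mem_enum inE.
move=> [y]; rewrite mem_enum inE => yc ->.
by rewrite ltn_ord yc (leq_trans (ltn_ord y)).
Qed.

Lemma ev_eq c c' env : ev (c :: c' :: env) (eqE k) = (dec c == dec c').
Proof.
by rewrite (ev_and (ev_sub _ _ _) (ev_sub_call _ _ _)) eqEsubset.
Qed.

Lemma ev_mem c env : c < M -> ev (c :: env) memE = (dec c \in F).
Proof. by move=> cM; rewrite /= hF. Qed.

Lemma exists_in_F (p : {set 'I_l} -> bool) :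
  has (fun c => (dec c \in F) && p (dec c)) (iota 0 M) = [exists C in F, p C].
Proof.
rewrite (has_code (fun C => (C \in F) && p C) kM'); apply: eq_existsb => C.
by case: (boolP (C \in F)) => [/Fk ->|] //=; rewrite andbF.
Qed.

Lemma ev_min c env : c < M -> ev (c :: env) (minE k) = (dec c \in minimal F).
Proof.
move=> cM; rewrite (ev_and (ev_mem _ cM) (ev_not (ev_ex
  (p := fun c' => (dec c' \in F) && (dec c' \proper dec c)) _))).
  rewrite (exists_in_F (fun C => C \proper dec c)) inE negb_exists_in.
  by [].
move=> c' c'M; apply: ev_and; first exact: ev_mem.
by rewrite properE; apply: ev_and (ev_sub _ _ _) (ev_not (ev_sub_call _ _ _)).
Qed.

Lemma ev_canon c env : ev (c :: env) (canonE k) = canon l k M c.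
Proof.
apply/ev_not/ev_ex => c' _; apply: ev_and => //; exact: ev_eq.
Qed.

Lemma ev_corolla c h s env : c < M ->
  ev (c :: h :: s :: env) (corollaE k) = (dec c \in corolla F s (dec h)).
Proof.
move=> cM; rewrite inE; apply: ev_and; first exact: ev_min.
apply: ev_and; first exact: ev_sub_call.
by rewrite /eval -/(ev (c :: h :: s :: env) (sizeE k)) ev_size.
Qed.

Lemma ev_count h s env : ev (h :: s :: env) (countE k) = #|corolla F s (dec h)|.
Proof.
rewrite (@ev_sum _ _ (fun c => canon l k M c && (dec c \in corolla F s (dec h)))).
  rewrite -(card_canon (p := fun C => C \in corolla F s (dec h)) kM').
    by apply: eq_card => C; rewrite inE.
  by move=> C; rewrite inE => /andP[/minimalP[/Fk]].
by move=> c cM; apply: ev_and; [exact: ev_canon | exact: ev_corolla].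
Qed.

Lemma ev_th th a b i env : i <= k -> ev (a :: b :: i :: env) (thE k th) = th i.
Proof.
move=> ik; rewrite /thE; have : i \in iota 0 k.+1 by rewrite mem_iota.
have := iota_uniq 0 k.+1.
have out s : i \notin s -> ev (a :: b :: i :: env) (foldr
  (fun j acc => O OAdd (O OMul (O OEq (V 2) (K j)) (K (th j))) acc) (K 0) s) = 0.
  elim: s => //= j s IH; rewrite inE negb_or => /andP[/negbTE -> /IH ->].
  by [].
elim: (iota 0 k.+1) => //= j s IH /andP[js us]; rewrite inE.
case: (eqVneq i j) => [e _|ne /= his]; last by rewrite IH.
by rewrite out ?e// addn0 mul1n.
Qed.

Lemma ev_flower th h s i env : i <= k ->
  ev (h :: s :: i :: env) (flowerE k th) = flower th F s i (dec h).
Proof.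
move=> ik; rewrite /flower; apply: ev_and.
  by rewrite /eval -/(ev (h :: s :: i :: env) (sizeE k)) ev_size.
apply: ev_and => //; apply: ev_and.
  by rewrite /eval -/(ev (h :: s :: i :: env) (sizeE k)) ev_size.
by rewrite ev_le ev_count ev_th.
Qed.

Definition zH z := z %% l.+1 ^ k.
Definition zi z := (z %/ l.+1 ^ k) %% k.+1.
Definition zs z := z %/ l.+1 ^ k %/ k.+1.

Lemma ev_letHsi0 z e env : ev (z :: env) (letHsi k (V 0) e) =
  ev (zH z :: zs z :: zi z :: z :: env) e.
Proof. by rewrite /= g5. Qed.

Lemma ev_letHsi z e env : ev env (letHsi k (G z) e) =
  ev (zH (nth 0 g z) :: zs (nth 0 g z) :: zi (nth 0 g z) :: env) e.
Proof. by rewrite /= g5. Qed.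

Definition zflower th z := flower th F (zs z) (zi z) (dec (zH z)).

Lemma zflower_of th s i h : h < l.+1 ^ k -> i <= k ->
  zflower th ((s * k.+1 + i) * l.+1 ^ k + h) = flower th F s i (dec h).
Proof.
move=> hk ik; rewrite /zflower /zs /zi /zH.
rewrite modnMDl divnMDl ?expn_gt0// (modn_small hk) (divn_small hk) addn0.
by rewrite modnMDl divnMDl// (@modn_small i) ?ltnS// (@divn_small i) ?ltnS// addn0.
Qed.

Definition zfind th := find (zflower th) (iota 0 M).

Lemma ev_find th env : ev env (findE k th) = zfind th.
Proof.
rewrite (@ev_sum _ _ (fun z => ~~ has (fun z' => (z' <= z) && zflower th z') (iota 0 M))).
  rewrite /zfind; set p := zflower th.
  have -> : count (fun z => ~~ has (fun z' => (z' <= z) && p z') (iota 0 M)) (iota 0 M) =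
            count (fun z => z < find p (iota 0 M)) (iota 0 M).
    apply: eq_in_count => z; rewrite mem_iota add0n => /andP[_ zM].
    apply/hasPn/idP => [h|zf z'].
      rewrite ltnNge; apply/negP => fz.
      have hp : has p (iota 0 M) by rewrite has_find size_iota (leq_ltn_trans fz).
      have := nth_find 0 hp; rewrite nth_iota ?add0n; last by rewrite (leq_ltn_trans fz).
      by move=> pf; have := h (find p (iota 0 M)); rewrite mem_iota add0n fz pf (leq_ltn_trans fz) => // /(_ isT).
    rewrite mem_iota => /andP[_ z'M]; rewrite negb_and; case: (leqP z' z) => //= zz.
    have := before_find 0 (leq_ltn_trans zz zf); rewrite nth_iota ?add0n// => -> //.
  have le : find p (iota 0 M) <= M by rewrite -[X in _ <= X](size_iota 0) find_size.
  move: le; set f := find _ _ => le.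
  rewrite -[X in iota 0 X](subnKC le) iotaD count_cat add0n.
  rewrite (_ : count _ (iota 0 _) = f); last first.
    rewrite -[RHS](size_iota 0) -[RHS]count_predT; apply: eq_in_count => z.
    by rewrite mem_iota => /andP[_ ->].
  rewrite (_ : count _ _ = 0) ?addn0//; apply/eqP; rewrite -leqn0 leqNgt -has_count.
  by apply/hasPn => z; rewrite mem_iota -leqNgt => /andP[].
move=> z zM; apply/ev_not/ev_ex => z' z'M; apply: ev_and; first exact: ev_le.
by rewrite ev_letHsi0 ev_flower// /zi -ltnS ltn_pmod.
Qed.

Lemma zfind_flower th : zfind th < M -> (forall i, 0 < th i) ->
  let z := zfind th in first_flower th F (zs z) (zi z) (dec (zH z)).
Proof.
move=> zM th0 z; have hz : has (zflower th) (iota 0 M) by rewrite has_find size_iota.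
have := nth_find 0 hz; rewrite nth_iota ?add0n// => fz; split=> // s' i' H' fl'.
have [/and4P[H0 i0 /eqP Hs _]] := fl'.
have [C CF Cs] := flower_size th0 fl'; have sk := Fk CF.
have [h hk eh] := @decode_surj l k H' ltac:(lia).
have ik : i' <= k by lia.
rewrite -eh -zflower_of// in fl'.
set z' := _ + h in fl'.
have zz' : z <= z'.
  rewrite leqNgt; apply/negP => lt; have := before_find 0 lt.
  by rewrite nth_iota ?add0n ?fl'//; exact: ltn_trans zM.
have e1 : zs z' = s' /\ zi z' = i'.
  rewrite /zs /zi /z' divnMDl ?expn_gt0// (divn_small hk) addn0.
  by rewrite modnMDl divnMDl// (@modn_small i') ?ltnS// (@divn_small i') ?ltnS// addn0.
have le1 : z %/ l.+1 ^ k <= z' %/ l.+1 ^ k by exact: leq_div2r.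
have le2 : zs z <= s' by rewrite -e1.1; exact: leq_div2r.
move: le2; rewrite leq_eqVlt => /orP[/eqP e2|]; [right|by left]; split=> //.
rewrite -e1.2 /zi.
have := divn_eq (z %/ l.+1 ^ k) k.+1; have := divn_eq (z' %/ l.+1 ^ k) k.+1.
by rewrite -/(zs z) -/(zs z') e1.1 e2; lia.
Qed.

(** Clause and petal sizes of a flower are at most [k], so its index is below
    [k.+1 * k.+1 * l.+1 ^ k] and the search up to [M] is exhaustive. *)
Lemma zfind_none th : zfind th = M -> (forall i, 0 < th i) ->
  forall s i H, ~~ flower th F s i H.
Proof.
move=> e th0 s i H; apply/negP => fl.
have hn : ~~ has (zflower th) (iota 0 M) by rewrite has_find size_iota -/(zfind th) e ltnn.
have [/and4P[H0 i0 /eqP Hs _]] := fl.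
have [C CF Cs] := flower_size th0 fl; have sk := Fk CF.
have [h hk eh] := @decode_surj l k H ltac:(lia).
have ik : i <= k by lia.
rewrite -eh -zflower_of// in fl.
move/hasPn: hn => /(_ ((s * k.+1 + i) * l.+1 ^ k + h)); rewrite fl => /(_ _)/negP; apply=> //.
rewrite mem_iota /=; apply: leq_trans kM.
apply: leq_trans (_ : (s * k.+1 + i).+1 * l.+1 ^ k <= _); first by rewrite mulSn addnC ltn_add2r.
by rewrite leq_mul2r; apply/orP; right; nia.
Qed.

Lemma ev_heart env :
  m (8 * (nth 0 g 10 * M + nth 0 g 18) + 5) = (dec (nth 0 g 18) \in F) ->
  let z := nth 0 g 11 in
  ev env (heartE k) = (dec (nth 0 g 18) \in dec (zH z) |: F).
Proof.
move=> hc z; rewrite in_setU1 orbC; apply: ev_or; first exact: hc.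
by rewrite ev_letHsi; exact: ev_eq.
Qed.

Lemma ev_petal env : nth 0 g 18 < M ->
  let z := nth 0 g 11 in
  ev env (petalE k) = (dec (nth 0 g 18) \in F :|: petals F (zs z) (dec (zH z))).
Proof.
move=> cM z; rewrite inE; apply: ev_or; first exact: ev_mem.
rewrite ev_letHsi; set c := nth 0 g 18.
rewrite (@ev_ex _ _ (fun C => (dec C \in corolla F (zs z) (dec (zH z))) &&
    (dec c == dec C :\: dec (zH z)))); last first.
  move=> C CM; apply: ev_and; first exact: ev_corolla.
  rewrite (@ev_all _ _ (fun x => (x < l) ==> (isin l k c x == isin l k C x && ~~ isin l k (zH z) x))).
    rewrite all_ord; congr nat_of_bool; apply/forallP/eqP => [h|/setP h x].
      by apply/setP => x; rewrite !inE (eqP (h x)) andbC.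
    by have := h x; rewrite !inE => ->; rewrite andbC.
  move=> x xM; apply: ev_imp; first by rewrite /= g3.
  apply: ev_iff; first exact: ev_in.
  by apply: ev_and; [exact: ev_in | apply/ev_not/ev_in].
rewrite (has_code (fun C => (C \in corolla F (zs z) (dec (zH z))) && (dec c == C :\: dec (zH z))) kM').
congr nat_of_bool; apply/existsP/imsetP => [[C /and3P[_ h /eqP e]]|[C h e]].
  by exists C.
exists C; rewrite h e eqxx !andbT.
by apply: Fk; move: h; rewrite inE => /andP[/minimalP[]].
Qed.

End Eval.

(** * Gap instances as expressions *)
Section LeafExpr.
Variable k : nat.

(** Coordinate [j] belongs to the [j]-th minimal clause in the order of least codes. *)
Definition rankE := Sum (andE (canonE k) (andE (minE k) (O OLt (V 0) (V 1)))).
Definition selE := andE (canonE k) (andE (minE k) (O OEq rankE (V 1))).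
Definition varE := O ODiv (V 0) (K 2).
Definition bitE x i := O OEq (O OMod (O OShr x i) (K 2)) (O OMod (V 0) (K 2)).
Definition satDE := andE (O OLt varE (G 7)) (bitE (V 3) varE).
Definition satQE := andE (leE (G 7) varE) (bitE (V 3) (O OSub varE (G 7))).
Definition badE sat := exE (andE selE (allE (impE (O OLt (V 0) (G 3))
  (impE (litE k (V 1) (V 0)) (notE sat))))).
Definition lastE := O OEq (O OAdd (V 0) (K 1)) (G 9).
Definition cellE comp neg abs :=
  ifE (O OEq comp (K 0)) neg (ifE (O OEq comp (K 1)) abs (K 1)).
Definition triN := O OMul (K 3) (G 8).
(** Cell [G 18] of the encoded data set: two header cells, then sign, numerator and denominator of
    each coordinate. In the last coordinate, point [i] has the entry [i]. *)
Definition pointE :=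
  let a := O OSub (G 18) (K 2) in
  ifE (O OEq (G 18) (K 0)) (G 8) (ifE (O OEq (G 18) (K 1)) (G 9)
  (Let (O ODiv (O ODiv a (K 3)) (G 9)) (Let (O OMod (O ODiv a (K 3)) (G 9))
    (cellE (O OMod a (K 3)) (andE (notE lastE) (notE (badE satDE)))
      (ifE lastE (V 1) (ifE (badE satDE) triN (G 8))))))).
Definition queryE :=
  let a := O OSub (G 18) (K 3) in
  ifE (O OEq (G 18) (K 0)) (K 0) (ifE (O OEq (G 18) (K 1)) (O OMul (K 2) (G 8))
  (ifE (O OEq (G 18) (K 2)) (K 1)
  (Let (G 14) (Let (O ODiv a (K 3))
    (cellE (O OMod a (K 3)) (andE (notE lastE) (badE satQE))
      (ifE lastE (K 0) (ifE (badE satQE) triN (G 8)))))))).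

(** Clauses have varying lengths, so their positions in the input are tabulated, each from the
    position and size of the preceding clause. *)
Definition posE := ifE (O OEq (G 18) (K 0)) (K 2)
  (Let (Rd true (O OSub (G 18) (K 1)))
    (O OAdd (O OAdd (V 0) (K 1)) (O OMul (K 2) (In (V 0))))).
Definition initE := exE (andE (O OLt (V 0) (G 2)) (Let (Rd true (V 0))
  (allE (impE (O OLt (V 0) (G 3)) (O OEq (litE k (G 18) (V 0))
    (exE (andE (O OLt (V 0) (In (V 2)))
      (O OEq (V 1) (O OAdd (O OMul (K 2) (In (O OAdd (V 2) (O OAdd (K 2) (O OMul (K 2) (V 0))))))
        (In (O OAdd (V 2) (O OAdd (K 1) (O OMul (K 2) (V 0)))))))))))))).
End LeafExpr.

Section Leaf.
Variables (l k M : nat) (Fm : {set {set 'I_l}}) (q : nat).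
Hypothesis kM : l.+1 ^ k <= M.
Hypothesis lM : l <= M.
Hypothesis Fk : {in Fm, forall C : {set 'I_l}, #|C| <= k}.
Notation dec := (decode l k).

Definition rank c := count (fun c' => canon l k M c' && ((dec c' \in Fm) && (c' < c))) (iota 0 M).
Definition sel c j := canon l k M c && ((dec c \in Fm) && (rank c == j)).
(** A literal whose variable lies in the other block counts as false, so a clause fails exactly when
    both halves of the assignment miss it. *)
Definition satD (y x : nat) := (y %/ 2 < q) && ((x %/ 2 ^ (y %/ 2)) %% 2 == y %% 2).
Definition satQ (y x : nat) := (q <= y %/ 2) && ((x %/ 2 ^ (y %/ 2 - q)) %% 2 == y %% 2).
Definition bad (sat : nat -> nat -> bool) j x :=
  has (fun c => sel c j && [forall y in dec c, ~~ sat (val y) x]) (iota 0 M).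
Definition dataBad := bad satD.
Definition queryBad := bad satQ.

Lemma rank_lt_mono c c' : c < M -> canon l k M c -> dec c \in Fm -> c < c' ->
  rank c < rank c'.
Proof.
move=> cM cc cF lt; rewrite /rank -!size_filter.
set s := filter _ _; set s' := filter _ _.
have us : uniq (c :: s).
  rewrite /= filter_uniq ?iota_uniq// andbT mem_filter negb_and !negb_and.
  by rewrite ltnn !orbT.
apply: (uniq_leq_size us) => x; rewrite inE => /orP[/eqP ->|].
  by rewrite mem_filter cc cF lt mem_iota.
rewrite !mem_filter => /andP[/and3P[-> -> h] ->]; rewrite andbT/=.
exact: ltn_trans lt.
Qed.

Lemma rank_lt c : c < M -> canon l k M c -> dec c \in Fm -> rank c < #|Fm|.
Proof.
move=> cM cc cF; have -> : #|Fm| = #|[set C | C \in Fm]|.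
  by apply: eq_card => C; rewrite inE.
rewrite (card_canon kM)//; apply: leq_trans (rank_lt_mono cM cc cF cM) _.
by rewrite /rank; apply: sub_count => x /and3P[-> ->].
Qed.

Lemma sel_uniq c c' j : c < M -> c' < M -> sel c j -> sel c' j -> c = c'.
Proof.
move=> cM c'M /and3P[cc cF /eqP r] /and3P[cc' cF' /eqP r'].
have h := rank_lt_mono cM cc cF; have h' := rank_lt_mono c'M cc' cF'.
by case: (ltngtP c c') => // [/h|/h']; rewrite r r' ltnn.
Qed.

(** Coordinates beyond the number of clauses select no clause and are never bad, so any [d] that is
    large enough will do. *)
Lemma models_bad d x y : #|Fm| <= d ->
  models (fun z : 'I_l => satD z x || satQ z y) Fm =
  [forall j : 'I_d, ~~ (dataBad j x && queryBad j y)].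
Proof.
move=> Fd; apply/forall_inP/forallP => [h j|h C CF].
  apply/negP => /andP[/hasP[c]]; rewrite mem_iota => /andP[_ cM] /andP[sc /forall_inP nc].
  move=> /hasP[c']; rewrite mem_iota => /andP[_ c'M] /andP[sc' /forall_inP nc'].
  rewrite -(sel_uniq cM c'M sc sc') in nc'.
  have /and3P[_ cF _] := sc; have /exists_inP[z zc] := h _ cF.
  by rewrite (negbTE (nc _ zc)) (negbTE (nc' _ zc)).
apply: contraT => /exists_inPn hn.
have [c0 c0M e0] := decode_surj (Fk CF).
have [c cM [cc e]] := canon_exists l k (leq_trans c0M kM).
rewrite e0 in e.
have rd : rank c < d by apply: leq_trans Fd; apply: rank_lt; rewrite ?e.
have sc : sel c (Ordinal rd) by rewrite /sel cc e CF /= eqxx.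
case/negP: (h (Ordinal rd)); apply/andP; split; apply/hasP; exists c;
  rewrite ?mem_iota ?sc//= e; apply/forall_inP => z /hn; by rewrite negb_or => /andP[].
Qed.

Variables (N d : nat).

Definition dneg i j := (j.+1 != d) && ~~ dataBad j i.
Definition dabs i j :=
  if j.+1 == d then i else if dataBad j i then 3 * N else N.
Definition qneg i j := (j.+1 != d) && queryBad j i.
Definition qabs i j :=
  if j.+1 == d then 0 else if queryBad j i then 3 * N else N.

Definition cell (comp : nat) (neg : bool) (abs : nat) : nat :=
  nth 1 [:: nat_of_bool neg; abs] comp.

Definition pointv a :=
  if a == 0 then N else if a == 1 then d else
  let a' := a - 2 in let i := a' %/ 3 %/ d in let j := (a' %/ 3) %% d in
  cell (a' %% 3) (dneg i j) (dabs i j).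

Definition queryv y a :=
  if a == 0 then 0 else if a == 1 then 2 * N else if a == 2 then 1 else
  let a' := a - 3 in let j := a' %/ 3 in
  cell (a' %% 3) (qneg y j) (qabs y j).

Lemma dabs_le i j : i <= N -> dabs i j <= 3 * N.
Proof. by clear kM lM Fk; rewrite /dabs; case: ifP => _; [|case: ifP => _]; lia. Qed.

Lemma qabs_le i j : qabs i j <= 3 * N.
Proof. by clear kM lM Fk; rewrite /qabs; case: ifP => _; [|case: ifP => _]; lia. Qed.

Lemma cell_le c neg abs : cell c neg abs <= maxn 1 abs.
Proof. by case: c => [|[|[|c]]] //=; rewrite ?leq_maxl ?leq_maxr//; case: neg; rewrite leq_max. Qed.

Lemma queryv_le y a : queryv y a <= maxn 1 (3 * N).
Proof.
rewrite /queryv; do 3! [case: ifP => _; first by rewrite ?leq_max ?leq_mul2r ?orbT].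
by apply: leq_trans (cell_le _ _ _) _; rewrite geq_max leq_maxl leq_max qabs_le orbT.
Qed.

Lemma pointv_le a : 0 < N -> 0 < d -> a < 2 + N * (d * 3) -> pointv a <= maxn d (3 * N).
Proof.
move=> N0 d0 ha; have N3 : N <= 3 * N by rewrite leq_pmull.
rewrite /pointv; case: eqP => [_|a0]; first by rewrite leq_max N3 orbT.
case: eqP => [_|a1]; first by rewrite leq_maxl.
have i_le : (a - 2) %/ 3 %/ d <= N.
  by apply: ltnW; rewrite !ltn_divLR// -mulnA; clear -a0 a1 ha; lia.
apply: leq_trans (cell_le _ _ _) _.
by rewrite geq_max !leq_max dabs_le// d0 orbT.
Qed.

End Leaf.

Section EvalLeaf.
Variables (inp g : seq nat) (m : nat -> nat).
Notation ev := (eval inp g m).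
Notation M := (nth 0 g 6).
Variables (l k : nat) (F : {set {set 'I_l}}) (q N d : nat).
Hypothesis g3 : nth 0 g 3 = l.
Hypothesis g4 : nth 0 g 4 = l.+1.
Hypothesis g5 : nth 0 g 5 = l.+1 ^ k.
Hypothesis lM : l <= M.
Hypothesis kM : k.+1 * k.+1 * l.+1 ^ k <= M.
Hypothesis hF : forall c, c < M ->
  m (8 * (nth 0 g 10 * M + c) + 5) = (decode l k c \in F).
Hypothesis Fk : {in F, forall C : {set 'I_l}, #|C| <= k}.
Hypothesis g7 : nth 0 g 7 = q.
Hypothesis g8 : nth 0 g 8 = N.
Hypothesis g9 : nth 0 g 9 = d.
Notation dec := (decode l k).
Notation Fm := (minimal F).

Lemma ev_rank c env : ev (c :: env) (rankE k) = rank k M Fm c.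
Proof.
apply: ev_sum => c' c'M; apply: ev_and; first exact: ev_canon.
by apply: ev_and; first exact: ev_min.
Qed.

Lemma ev_sel c j env : c < M -> ev (c :: j :: env) (selE k) = sel k M Fm c j.
Proof.
move=> cM; apply: ev_and; first exact: ev_canon.
apply: ev_and; first exact: ev_min.
by rewrite /eval -/(ev (c :: j :: env) (rankE k)) ev_rank.
Qed.

Lemma ev_bad satE (sat : nat -> nat -> bool) j x env :
  (forall y c, ev (y :: c :: j :: x :: env) satE = sat y x) ->
  ev (j :: x :: env) (badE k satE) = bad k M Fm sat j x.
Proof.
move=> hs; apply: ev_ex => c cM; apply: ev_and; first exact: ev_sel.
rewrite (@ev_all _ _ _ _ _ (fun y => (y < l) ==> (isin l k c y ==> ~~ sat y x))).
  rewrite (all_ord lM (fun y => isin l k c y ==> ~~ sat y x)); congr nat_of_bool; apply: eq_forallb => y.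
  by rewrite inE.
move=> y _; apply: ev_imp; first by rewrite /= g3.
by apply: ev_imp; [exact: ev_in | apply/ev_not/hs].
Qed.

Lemma ev_dataBad j x env : ev (j :: x :: env) (badE k satDE) = dataBad k M Fm q j x.
Proof.
apply: ev_bad => y c; apply: ev_and; first by rewrite /= g7.
by rewrite /=.
Qed.

Lemma ev_queryBad j x env : ev (j :: x :: env) (badE k satQE) = queryBad k M Fm q j x.
Proof.
apply: ev_bad => y c; apply: ev_and; first by rewrite ev_le /= g7.
by rewrite /= g7.
Qed.

Lemma ev_eqK env a c : ev env (O OEq a (K c)) = (ev env a == c).
Proof. by []. Qed.

Lemma ev_last j env : ev (j :: env) lastE = (j.+1 == d).
Proof. by rewrite /= g9 addn1. Qed.

Lemma ev_cell env comp ne ae (neg : bool) abs : ev env ne = neg -> ev env ae = abs ->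
  ev env (cellE comp ne ae) = cell (ev env comp) neg abs.
Proof.
move=> h1 h2; rewrite (ev_if _ _ (ev_eqK _ _ _)) h1.
by rewrite (ev_if _ _ (ev_eqK _ _ _)) h2 /cell; case: (ev env comp) => [|[|[|c]]].
Qed.

Lemma ev_point env : ev env (pointE k) = pointv k M Fm q N d (nth 0 g 18).
Proof.
rewrite (ev_if _ _ (ev_eqK _ _ _)) (ev_if _ _ (ev_eqK _ _ _)) /pointv.
rewrite -[ev env (G 18)]/(nth 0 g 18) -[ev env (G 8)]/(nth 0 g 8) -[ev env (G 9)]/(nth 0 g 9).
rewrite g8 g9; case: eqP => // _; case: eqP => // _.
set a := O OSub _ _; rewrite -[LHS]/(ev [:: ev [:: ev env (O ODiv (O ODiv a (K 3)) (G 9)) & env]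
   (O OMod (O ODiv a (K 3)) (G 9)), ev env (O ODiv (O ODiv a (K 3)) (G 9)) & env]
   (cellE (O OMod a (K 3)) (andE (notE lastE) (notE (badE k satDE)))
      (ifE lastE (V 1) (ifE (badE k satDE) triN (G 8))))).
set i := ev env (O ODiv _ _); set j := ev _ (O OMod (O ODiv _ _) _).
rewrite (@ev_cell _ _ _ _ (dneg k M Fm q d i j) (dabs k M Fm q N d i j)).
- by rewrite /= /i /j /= g9.
- apply: ev_and; apply: ev_not; [exact: ev_last | exact: ev_dataBad].
- rewrite (ev_if _ _ (ev_last _ _)) (ev_if _ _ (ev_dataBad _ _ _)) /dabs.
  by case: ifP => // _; rewrite /= g8.
Qed.

Lemma ev_query env : ev env (queryE k) = queryv k M Fm q N d (nth 0 g 14) (nth 0 g 18).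
Proof.
rewrite !(ev_if _ _ (ev_eqK _ _ _)) /queryv.
rewrite -[ev env (G 18)]/(nth 0 g 18) -[ev env (O OMul _ _)]/(2 * nth 0 g 8) g8.
case: eqP => // _; case: eqP => // _; case: eqP => // _.
set a := O OSub _ _; rewrite -[LHS]/(ev [:: ev [:: nth 0 g 14 & env]
   (O ODiv a (K 3)), nth 0 g 14 & env]
   (cellE (O OMod a (K 3)) (andE (notE lastE) (badE k satQE))
      (ifE lastE (K 0) (ifE (badE k satQE) triN (G 8))))).
set i := nth 0 g 14; set j := ev _ (O ODiv _ _).
rewrite (@ev_cell _ _ _ _ (qneg k M Fm q d i j) (qabs k M Fm q N d i j))//.
- apply: ev_and; [apply: ev_not; exact: ev_last | exact: ev_queryBad].
- rewrite (ev_if _ _ (ev_last _ _)) (ev_if _ _ (ev_queryBad _ _ _)) /qabs.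
  by case: ifP => // _; rewrite /= g8.
Qed.

End EvalLeaf.

(** * Reading the input formula *)
Lemma bits_exist (p : nat -> bool) q :
  exists2 x, x < 2 ^ q & forall i, i < q -> odd (x %/ 2 ^ i) = p i.
Proof.
elim: q p => [|q IH] p; first by exists 0.
have [x xq hx] := IH (fun i => p i.+1).
exists (p 0 + 2 * x); first by rewrite expnS; have := leq_b1 (p 0); nia.
case=> [|i] iq.
  by rewrite expn0 divn1 (oddD (p 0)) mul2n odd_double addbF oddb.
rewrite expnS divnMA -hx// (_ : (p 0 + 2 * x) %/ 2 = x)//.
by rewrite addnC mulnC divnMDl// divn_small ?addn0//; case: (p 0).
Qed.

Lemma eq_nat_of_bool (a b : bool) : (a == b :> nat) = (a == b).
Proof. by case: a; case: b. Qed.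

Section Cnf.
Variables (n k : nat) (F : cnf n).
Notation l := (2 * n).

Definition litnat (t : literal n) : nat := 2 * t.2 + t.1.

Lemma litnat_lt t : litnat t < l.
Proof. by rewrite /litnat; have := ltn_ord t.2; have := leq_b1 t.1; lia. Qed.

Lemma litnat_inj : injective litnat.
Proof.
move=> [b i] [b' i'] e0; have e : 2 * i + b = 2 * i' + b' := e0.
have eb : b = b'.
  by have := congr1 odd e; rewrite (oddD (2 * i)) (oddD (2 * i')) !mul2n !odd_double !oddb.
by rewrite eb in e *; congr pair; apply: val_inj => /=; lia.
Qed.

Lemma litnat_div t : litnat t %/ 2 = t.2.
Proof. by rewrite /litnat mulnC divnMDl// divn_small ?addn0//; case: t.1. Qed.

Lemma litnat_mod t : litnat t %% 2 = t.1.
Proof. by rewrite /litnat mulnC modnMDl modn_small//; case: t.1. Qed.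

Definition clause_set (C : seq (literal n)) : {set 'I_l} :=
  [set x : 'I_l | val x \in [seq litnat t | t <- C]].

Definition formula_set : {set {set 'I_l}} :=
  [set X in [seq clause_set C | C <- F]].

Lemma models_formula (f : {ffun 'I_n -> bool}) (v : nat -> bool) :
  (forall t, v (litnat t) = (f t.2 == t.1)) ->
  models (fun x : 'I_l => v x) formula_set = satisfies f F.
Proof.
move=> hv; apply/forall_inP/allP => h.
  move=> C CF; have /exists_inP[x] : [exists x in clause_set C, v (val x)].
    by apply: h; rewrite inE map_f.
  rewrite inE => /mapP[t tC e] vx; apply/hasP; exists t => //.
  by rewrite -hv -e.
move=> X; rewrite inE => /mapP[C /h/hasP[t tC ft] ->].
apply/exists_inP; exists (Ordinal (litnat_lt t)); last by rewrite /= hv.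
by rewrite inE; apply/mapP; exists t.
Qed.

Lemma satisfiable_split q :
  satisfiable F = [exists x : 'I_(2 ^ q), [exists y : 'I_(2 ^ (n - q)),
    models (fun z : 'I_l => satD q z x || satQ q z y) formula_set]].
Proof.
apply/existsP/existsP => [[f hf]|[x /existsP[y hm]]].
  pose p i := if insub i is Some j then f j else false.
  have pE (i : 'I_n) : p i = f i by rewrite /p valK.
  have [x xq hx] := bits_exist p q.
  have [y yq hy] := bits_exist (fun i => p (q + i)) (n - q).
  exists (Ordinal xq); apply/existsP; exists (Ordinal yq).
  rewrite (models_formula (f := f) (v := fun z => satD q z x || satQ q z y))//.
  move=> t; rewrite /satD /satQ litnat_div litnat_mod -pE !modn2 !eq_nat_of_bool.
  case: ltnP => tq /=; first by rewrite hx// orbF.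
  by rewrite hy ?subnKC// ltn_sub2r// (leq_ltn_trans tq).
exists [ffun i : 'I_n => if i < q then odd (x %/ 2 ^ i) else odd (y %/ 2 ^ (i - q))].
rewrite -(models_formula (v := fun z => satD q z x || satQ q z y))//.
move=> t; rewrite /satD /satQ litnat_div litnat_mod ffunE !modn2 !eq_nat_of_bool.
by case: ltnP => tq /=; rewrite ?orbF.
Qed.

Definition enc_clause (C : seq (literal n)) : seq nat :=
  size C :: flatten [seq [:: nat_of_bool t.1; nat_of_ord t.2] | t <- C].

Definition posv i := 2 + sumn [seq 1 + 2 * size C | C <- take i F].

Lemma size_enc_clause C : size (enc_clause C) = 1 + 2 * size C.
Proof. by rewrite /= add1n; congr S; elim: C => //= t C ->; lia. Qed.

Lemma posvS i : i < size F -> posv i.+1 = posv i + 1 + 2 * size (nth [::] F i).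
Proof.
by move=> iF; rewrite /posv (take_nth [::] iF) map_rcons sumn_rcons; lia.
Qed.

Lemma nth_encode i o : i < size F -> o < 1 + 2 * size (nth [::] F i) ->
  nth 0 (encode_cnf F) (posv i + o) = nth 0 (enc_clause (nth [::] F i)) o.
Proof.
move=> iF ho; rewrite /posv -addnA add2n.
rewrite -[LHS]/(nth 0 (flatten [seq enc_clause C | C <- F])
  (sumn [seq 1 + 2 * size C | C <- take i F] + o)).
elim: F i iF ho => // C F' IH [|i] iF ho.
  by rewrite -[LHS]/(nth 0 (enc_clause C ++ flatten (map enc_clause F')) o) nth_cat size_enc_clause ho.
rewrite -[flatten _]/(enc_clause C ++ flatten (map enc_clause F')) nth_cat size_enc_clause.
rewrite -[sumn _]/(1 + 2 * size C + sumn [seq 1 + 2 * size C | C <- take i F']).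
by rewrite -addnA ltnNge leq_addr addKn IH.
Qed.

Lemma encode_size i : i < size F -> nth 0 (encode_cnf F) (posv i) = size (nth [::] F i).
Proof. by move=> iF; rewrite -[posv i]addn0 nth_encode. Qed.

Lemma nth_pairs (C : seq (literal n)) t0 t : t < size C ->
  nth 0 (enc_clause C) (1 + 2 * t) = (nth t0 C t).1 /\
  nth 0 (enc_clause C) (2 + 2 * t) = (nth t0 C t).2.
Proof.
rewrite !addSn add0n /=; elim: C t => //= u C IH [|t] tC; first by rewrite muln0.
by rewrite !mulnS !add2n /=; exact: IH.
Qed.

Lemma encode_lit i t t0 : i < size F -> t < size (nth [::] F i) ->
  2 * nth 0 (encode_cnf F) (posv i + (2 + 2 * t)) +
    nth 0 (encode_cnf F) (posv i + (1 + 2 * t)) = litnat (nth t0 (nth [::] F i) t).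
Proof.
move=> iF tC; rewrite !nth_encode//; try lia.
by have [-> ->] := nth_pairs t0 tC.
Qed.

Hypothesis hF : is_kcnf k F.

Lemma size_clause C : C \in F -> size C <= k.
Proof. by case/andP: hF => _ /allP h /h. Qed.

(** Clauses are distinct as sequences, though perhaps not as sets; [code] is injective on sequences,
    which is what the count needs. *)
Lemma size_formula : size F <= l.+1 ^ k.
Proof.
case/andP: hF => uF _.
pose f C := code l [seq litnat t | t <- C].
have lt C : all (ltn^~ l) [seq litnat t | t <- C].
  by apply/allP => _ /mapP[t _ ->]; exact: litnat_lt.
have inj : injective f.
  by move=> C C' /(code_inj (lt C) (lt C')) /(inj_map litnat_inj).
rewrite -(size_map f) -[X in _ <= X](size_iota 0); apply: uniq_leq_size.
  by rewrite map_inj_uniq.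
move=> _ /mapP[C CF ->]; rewrite mem_iota /= add0n.
apply: leq_trans (code_lt (lt C)) _; rewrite size_map.
by rewrite leq_pexp2l// size_clause.
Qed.

Lemma formula_set_size : {in formula_set, forall C : {set 'I_l}, #|C| <= k}.
Proof.
move=> X; rewrite inE => /mapP[C CF ->]; apply: leq_trans (size_clause CF).
rewrite -(size_map litnat) cardE -(size_map val); apply: uniq_leq_size.
  by rewrite map_inj_uniq ?enum_uniq//; exact: val_inj.
by move=> x /mapP[y]; rewrite mem_enum inE => h ->.
Qed.

Lemma posv_le i : posv i <= 2 + size F * (1 + 2 * k).
Proof.
rewrite /posv leq_add2l.
have : all (fun C => size C <= k) F by case/andP: hF.
elim: F i => // C F' IH [|i] // /andP[hC hF'].
rewrite -[sumn _]/(1 + 2 * size C + sumn [seq 1 + 2 * size C | C <- take i F']).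
by rewrite -[size (C :: F')]/(size F').+1 (mulSn (size F')) leq_add ?IH// leq_add2l leq_mul2l.
Qed.

Lemma encode_le Y a : n <= Y -> size F <= Y -> k <= Y -> 0 < Y ->
  nth 0 (encode_cnf F) a <= Y.
Proof.
move=> nY FY kY Y0; have [lt|ge] := ltnP a (size (encode_cnf F)); last by rewrite nth_default.
have /allP : all (leq^~ Y) (encode_cnf F); last by apply; rewrite mem_nth.
rewrite /encode_cnf /= nY FY /=; apply/allP => z /flattenP[_ /mapP[C CF ->]].
rewrite inE => /orP[/eqP ->|/flattenP[_ /mapP[t _ ->]]].
  exact: leq_trans (size_clause CF) kY.
rewrite !inE => /orP[] /eqP ->; first by apply: leq_trans (leq_b1 _) Y0.
exact: leq_trans (ltnW (ltn_ord t.2)) nY.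
Qed.

Section EvalInit.
Variables (g : seq nat) (m : nat -> nat).
Notation ev := (eval (encode_cnf F) g m).
Notation M := (nth 0 g 6).
Hypothesis g2 : nth 0 g 2 = size F.
Hypothesis g3 : nth 0 g 3 = l.
Hypothesis g4 : nth 0 g 4 = l.+1.
Hypothesis lM : l <= M.
Hypothesis kM : k <= M.
Hypothesis FM : size F <= M.

Lemma ev_pos i env : nth 0 g 18 = i -> i < size F ->
  (0 < i -> m (8 * i.-1 + 6) = posv i.-1) -> ev env posE = posv i.
Proof.
move=> e iF hm; rewrite (ev_if _ _ (ev_eqK _ _ _ _ _ _)) [ev env (G 18)]/= e.
case: i e iF hm => [|i] e iF hm; first by rewrite /posv take0.
rewrite -[LHS]/(m (8 * (nth 0 g 18 - 1) + 6) + 1 +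
  2 * nth 0 (encode_cnf F) (m (8 * (nth 0 g 18 - 1) + 6))).
by rewrite e subn1 hm// encode_size ?posvS//; exact: ltnW.
Qed.

Lemma ev_init env : (forall i, i < size F -> m (8 * i + 6) = posv i) ->
  ev env (initE k) = (decode l k (nth 0 g 18) \in formula_set).
Proof.
move=> hm; set c := nth 0 g 18.
rewrite (@ev_ex _ _ _ _ _ (fun i => (i < size F) && (decode l k c == clause_set (nth [::] F i)))).
  congr nat_of_bool; rewrite inE; apply/hasP/mapP => [[i _ /andP[iF /eqP ->]]|[C CF ->]].
    by exists (nth [::] F i); rewrite ?mem_nth.
  exists (index C F); first by rewrite mem_iota (leq_trans _ FM) ?index_mem.
  by rewrite index_mem CF nth_index ?eqxx.
move=> i iM; have [iF|iF] := ltnP i (size F); last by rewrite /= g2 ltnNge iF.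
set C := nth [::] F i.
apply: (ev_and (p := true)); first by rewrite /= g2 iF.
set e1 := allE _.
rewrite -[LHS]/(ev [:: m (8 * i + 6), i & env] e1) hm//.
rewrite (@ev_all _ _ _ _ _ (fun x => (x < l) ==>
   (isin l k c x == (x \in [seq litnat t | t <- C])))).
  rewrite (all_ord lM (fun x => isin l k c x == (x \in [seq litnat t | t <- C]))).
  congr nat_of_bool; apply/forallP/eqP => [h|/setP h x].
    by apply/setP => x; rewrite !inE; apply/eqP.
  by have := h x; rewrite !inE => ->.
move=> x xM; apply: ev_imp; first by rewrite /= g3.
apply: ev_iff; first exact: ev_in.
rewrite (@ev_ex _ _ _ _ _ (fun t => (t < size C) && (x == nth 0 [seq litnat t | t <- C] t))).
  congr nat_of_bool; apply/hasP/idP => [[t _ /andP[tC /eqP ->]]|xC].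
    by rewrite mem_nth ?size_map.
  exists (index x [seq litnat t | t <- C]).
    rewrite mem_iota /= add0n (leq_trans _ kM)// (leq_trans _ (size_clause (mem_nth [::] iF)))//.
    by rewrite -(size_map litnat) index_mem.
  by rewrite -(size_map litnat) index_mem xC nth_index ?eqxx.
move=> t tM; set E := encode_cnf F.
transitivity (nat_of_bool ((t < nth 0 E (posv i)) &&
  (x == 2 * nth 0 E (posv i + (2 + 2 * t)) + nth 0 E (posv i + (1 + 2 * t))))).
  by apply: ev_and.
rewrite encode_size// -/C; case: ltnP => // tC.
have [t0 _] : {t0 : literal n | true} by case: (C) tC => [|t0 ? _] //; exists t0.
by rewrite (nth_map t0)// (encode_lit t0 iF).
Qed.

End EvalInit.
End Cnf.

(** * The k-SAT program *)
Definition call R jin c := Seq (zero_regs R) (sim jin c).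

Lemma call_correct R jin w w' inp inp' c mu L s sg' t :
  w' + 4 <= w -> jin = 1 \/ jin = 2 -> logged mu L s ->
  (forall a, mem s (8 * a + jin) = nth 0 inp' a) ->
  exec inp' w' c (init mu) sg' t -> regs_below R c -> (forall a, mu a < 2 ^ w') ->
  8 * (size L + t) + 8 < 2 ^ w ->
  exists s' L', [/\ runs inp w (call R jin c) s (R.+1 + 13 * t) (eq s'),
    logged (mem sg') (L ++ L') s', forall x, x < R -> reg s' (rin x) = reg sg' x,
    keeps s s' & [/\ undo L' (mem sg') = mu, size L' <= t & all (small_entry w') L']].
Proof.
move=> ww hj lg hin ex hR hmu hw.
have [s1 [x1 z1 m1 e1]] := zero_regs_correct R inp ww hj s.
have k1 : keeps s s1 by split=> *; rewrite ?e1 ?m1.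
have sr : simrel R (init mu) L s1.
  case: lg => h1 h2 h3; split=> //=; rewrite ?m1//.
  by rewrite -h2 -[30]/(15.*2) e1.
have hin1 : forall a, mem s1 (8 * a + jin) = nth 0 inp' a by rewrite m1.
have sm : small w' (init mu) by split=> //= x; rewrite expn_gt0.
have [s2 [L' [t' [x2 le2 sr2 k2 h2]]]] :=
  sim_correct inp ww hj ex hR sm sr hin1 hw.
exists s2, L'; split=> //.
- exists s2, (R.+1 + t'); split=> //; first exact: exec_seq x1 x2.
  by rewrite leq_add2l.
- by case: sr2 => h3 h4 h5 h6; split.
- exact: sim_reg sr2.
- exact: keeps_trans k1 k2.
Qed.

Lemma at_keeps g s s' v : size g = NG -> globals g s -> keeps s s' -> reg s' 30 = v ->
  at_ (set_nth 0 g 15 v) (mem s') s'.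
Proof.
move=> sz hg [k _] hv; split=> // i iN; rewrite nsn; case: eqP => [->//|/eqP ne].
by rewrite k// hg.
Qed.

Fixpoint powE k := if k is k'.+1 then O OMul (G 4) (powE k') else K 1.

Lemma ev_pow inp g m env k : eval inp g m env (powE k) = nth 0 g 4 ^ k.
Proof. by elim: k => //= k ->; rewrite expnS. Qed.

(* Cell [8 * a + j] of the memory is cell [a] of region [j]:
   0 memory of the simulated program, 1 points, 2 query, 3 and 4 undo log
   (addresses and old values), 5 stack of formulas, each a characteristic vector
   over the clause codes [c < M], 6 positions of the clauses in the input.
   Register [2 * i] is global [i]: 0 answer, 1 [n], 2 number of clauses, 3 number
   [l] of literals, 4 [l + 1], 5 [(l + 1) ^ k], 6 [M], 7 [q], 8 [N = 2 ^ q],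
   9 dimension, 10 stack height, 11 index of the flower, 12 number of queries,
   14 current query, 15 log length, 16 log mark, 17 scratch, 18 and 19 [Fill]. *)
Section Program.
Variables (k : nat) (th : nat -> nat) (sdiv cdim : nat) (Pre Query : cmd) (R : nat).

Definition mE := O OAdd (O OMul (K (k.+1 * k.+1)) (G 5)) (O OAdd (G 3) (K k)).
Definition qE := O OAdd (O ODiv (G 1) (K sdiv)) (K 1).
Definition dE := O OMul (K cdim) (G 7).
Definition cntP := O OAdd (K 2) (O OMul (G 8) (O OMul (G 9) (K 3))).
Definition cntQ := O OAdd (K 3) (O OMul (G 9) (K 3)).
Definition off1 := O OMul (G 10) (G 6).
Definition off2 := O OMul (O OAdd (G 10) (K 1)) (G 6).

(** The expressions of the program are collected so that one degree [Deg] and one cost [kap] serve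
    all statements. Region number 8 stands for any smaller one in the address bounds. *)
Definition exprs : seq expr :=
  [:: In (K 0); In (K 1); O OMul (K 2) (G 1); O OAdd (G 3) (K 1); powE k; mE; qE; dE;
      O OSub (G 1) (G 7); K 0; K 1; O OSub (G 10) (K 1); findE k th; O OLt (G 11) (G 6);
      O OAdd (G 10) (K 2); G 2; G 6; cntP; cntQ; off1; off2;
      addr 8 (O OAdd (K 0) (G 18)); addr 8 (O OAdd off1 (G 18)); addr 8 (O OAdd off2 (G 18));
      posE; initE k; petalE k; heartE k; pointE k; queryE k;
      O OSub (G 14) (K 1); O OLt (K 0) (O OAdd (G 0) (G 17)); G 15; G 12].

Ltac in_exprs := rewrite /exprs /=; tauto.

Definition Deg := sumn (map deg exprs) + 5.
Definition kap M := sumn (map (cost M) exprs) + 10.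

Lemma sumn_in (f : expr -> nat) (l : seq expr) e : List.In e l -> f e <= sumn (map f l).
Proof.
elim: l => //= a l IH [->|/IH]; first exact: leq_addr.
by move=> h; apply: leq_trans h (leq_addl _ _).
Qed.

Lemma deg_in e : List.In e exprs -> deg e + 5 <= Deg.
Proof. by move=> /(sumn_in deg); rewrite /Deg; lia. Qed.

Lemma cost_in M e : List.In e exprs -> cost M e + 10 <= kap M.
Proof. by move=> /(sumn_in (cost M)); rewrite /kap; lia. Qed.

(** Register 1 is [rin 0], the answer of the simulated query. The mark in global 16 is the log
    length right after preprocessing, so undoing stops at the data structure. *)
Definition query_step :=
  Seq (SetG 14 (O OSub (G 14) (K 1)))
  (Seq (Fill 2 (K 0) cntQ (queryE k))
  (Seq (call R 2 Query)
  (Seq (copy 34 1)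
  (Seq (SetG 0 (O OLt (K 0) (O OAdd (G 0) (G 17))))
       undo_to_mark)))).

(** The final undo has mark 0 and returns the simulated memory to its empty state for the next
    leaf. *)
Definition leaf :=
  Seq (Fill 1 (K 0) cntP (pointE k))
  (Seq (call R 1 Pre)
  (Seq (SetG 16 (G 15))
  (Seq (SetG 14 (G 12))
  (Seq (While 28 query_step)
  (Seq (SetG 16 (K 0)) undo_to_mark))))).

(** The order matters: the petal formula needs the whole parent and goes to the next stack slot,
    after which the heart formula can replace the parent cell by cell. *)
Definition branch :=
  Seq (Fill 5 off2 (G 6) (petalE k))
  (Seq (Fill 5 off1 (G 6) (heartE k)) (SetG 10 (O OAdd (G 10) (K 2)))).

Definition node :=
  Seq (SetG 10 (O OSub (G 10) (K 1)))
  (Seq (SetG 11 (findE k th))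
  (Seq (SetG 17 (O OLt (G 11) (G 6))) (If 34 branch leaf))).

Definition setup :=
  seqs (SetG 1 (In (K 0))) [:: SetG 2 (In (K 1)); SetG 3 (O OMul (K 2) (G 1));
    SetG 4 (O OAdd (G 3) (K 1)); SetG 5 (powE k); SetG 6 mE; SetG 7 qE;
    Assign 16 (Const 1); Assign 16 (Bin Shl 16 14); SetG 9 dE;
    SetG 17 (O OSub (G 1) (G 7)); Assign 24 (Const 1); Assign 24 (Bin Shl 24 34);
    Fill 6 (K 0) (G 2) posE; Fill 5 (K 0) (G 6) (initE k); SetG 10 (K 1)].

Definition solver := Seq setup (While 20 node).

(** * Correctness on a fixed formula *)

Section Run.
Variables (n : nat) (F : cnf n).
Hypothesis hF : is_kcnf k F.
Notation l := (2 * n).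
Notation inp := (encode_cnf F).
Notation F0 := (formula_set F).
Definition pMc := l.+1 ^ k.
Definition pM := k.+1 * k.+1 * pMc + (l + k).
Definition pq := n %/ sdiv + 1.
Definition pN := 2 ^ pq.
Definition pd := cdim * pq.
Definition pY := 2 ^ (n - pq).

Definition glob ans sp z y lp mk t i c :=
  [:: ans; n; size F; l; l.+1; pMc; pM; pq; pN; pd; sp; z; pY; 0; y; lp; mk; t; i; c].

Definition sat (X : {set {set 'I_l}}) := [exists x : 'I_pN, [exists y : 'I_pY,
  models (fun z : 'I_l => satD pq z x || satQ pq z y) X]].

(** The interface to the nearest neighbour programs. Inputs are described cell by cell, with 0 past
    the end, because the simulation reads them from memory. *)
Definition decided w' T1 T2 (X : {set {set 'I_l}}) := exists ip iq sg t, [/\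
  forall a, nth 0 ip a = if a < 2 + pN * (pd * 3) then pointv k pM X pq pN pd a else 0,
  forall y a, nth 0 (iq y) a = if a < 3 + pd * 3 then queryv k pM X pq pN pd y a else 0,
  exec ip w' Pre (init empty_mem) sg t, t <= T1 &
  forall y, exists sg' t', [/\ exec (iq y) w' Query (init (mem sg)) sg' t', t' <= T2 &
    (reg sg' 0 != 0) =
      [exists x : 'I_pN, models (fun z : 'I_l => satD pq z x || satQ pq z y) X]]].

Variables (w w' Y T1 T2 Pot : nat).
Hypothesis Y2 : 1 < Y.
Hypothesis Yw : Y ^ Deg < 2 ^ w.
Hypothesis ww : w' + 4 <= w.
Hypothesis Tw : 8 * (T1 + T2) + 8 < 2 ^ w.
Hypothesis TY : T1 + T2 <= Y.
Hypothesis wY : 2 ^ w' <= Y.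
Hypothesis PotY : Pot + 2 <= Y.
Hypothesis MY : pM <= Y.
Hypothesis qY : pq <= Y.
Hypothesis YY : pY <= Y.
Hypothesis PY : 2 + pN * (pd * 3) <= Y.
Hypothesis NY : 3 * pN <= Y.
Hypothesis QY : 3 + pd * 3 <= Y.
Hypothesis posY : 2 + size F * (1 + 2 * k) <= Y.

Hypothesis cdim0 : 0 < cdim.
Hypothesis RP : regs_below R Pre.
Hypothesis RQ : regs_below R Query.
Hypothesis R0 : 0 < R.

Hypothesis leaf_ok : forall X : {set {set 'I_l}},
  {in X, forall C : {set 'I_l}, #|C| <= k} -> #|X| <= pd.-1 -> decided w' T1 T2 X.

Lemma q_gt0 : 0 < pq. Proof. by rewrite /pq addn1. Qed.
Lemma N_gt0 : 0 < pN. Proof. by rewrite expn_gt0. Qed.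
Lemma d_gt0 : 0 < pd. Proof. by rewrite muln_gt0 cdim0 q_gt0. Qed.

Lemma lM : l <= pM. Proof. by rewrite /pM; lia. Qed.
Lemma kMc : k.+1 * k.+1 * l.+1 ^ k <= pM. Proof. by rewrite /pM /pMc leq_addr. Qed.
Lemma kM : k <= pM. Proof. by rewrite /pM; lia. Qed.
Lemma McM : pMc <= pM.
Proof. by apply: leq_trans kMc; rewrite leq_pmull. Qed.
Lemma FM : size F <= pM.
Proof. by apply: leq_trans (size_formula hF) McM. Qed.

Lemma inp_le a : nth 0 inp a <= Y.
Proof.
apply: (encode_le hF); last by rewrite ltnW.
- by apply: leq_trans MY; rewrite /pM; lia.
- exact: leq_trans FM MY.
- exact: leq_trans kM MY.
Qed.

Definition mbound (m : nat -> nat) := forall (b : bool) a, m (8 * a + (5 + b)) <= Y.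

Lemma bounded_list g m : all (leq^~ Y) g -> mbound m -> bounded inp g m Y.
Proof.
move=> /allP hg hm; split=> // [i|i]; first exact: inp_le.
by have [lt|ge] := ltnP i (size g); [apply: hg; rewrite mem_nth | rewrite nth_default].
Qed.

Lemma nY : n <= Y. Proof. by apply: leq_trans MY; rewrite /pM; lia. Qed.
Lemma FY : size F <= Y. Proof. exact: leq_trans FM MY. Qed.
Lemma lY : l.+1 <= Y.
Proof.
apply: leq_trans MY; rewrite /pM.
have : 0 < k.+1 * k.+1 * pMc by rewrite !muln_gt0 expn_gt0.
by set A := _ * pMc; lia.
Qed.
Lemma dY : pd <= Y. Proof. by apply: leq_trans QY; lia. Qed.

Lemma glob_le ans sp z y lp mk t i c : ans <= Y -> sp <= Y -> z <= Y -> y <= Y ->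
  lp <= Y -> mk <= Y -> t <= Y -> i <= Y -> c <= Y ->
  all (leq^~ Y) (glob ans sp z y lp mk t i c).
Proof.
have hMc := leq_trans McM MY; have hN : pN <= Y by lia.
have hl : l <= Y by exact: ltnW lY.
move=> h1 h2 h3 h4 h5 h6 h7 h8 h9.
by rewrite /glob /= h1 h2 h3 h4 h5 h6 h7 h8 h9 nY FY hl lY hMc MY qY hN dY YY.
Qed.

Lemma cost_mono M M' e : M <= M' -> cost M e <= cost M' e.
Proof.
move=> le; elim: e => //= [o a ha b hb|b a ha|a ha|a ha|a ha b hb].
- by rewrite leq_add2r leq_add.
- by rewrite leq_add2r.
- by rewrite leq_add2r.
- by rewrite leq_add2r leq_mul// leq_add2r.
- by rewrite leq_add2r leq_add.
Qed.

(** For the start of [setup], when global 6 has not been computed yet; the cost is compared with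
    that for [pM] by monotonicity. *)
Lemma runs_setE0 i e g m s : List.In e exprs -> size g = NG -> nth 0 g gM <= pM ->
  all (leq^~ Y) g -> mbound m -> i < NG -> at_ g m s ->
  runs inp w (SetG i e) s (kap pM) (at_ (set_nth 0 g i (eval inp g m [::] e)) m).
Proof.
move=> he sz hM hg hm iN st.
have D1 := deg_in he; have C1 := cost_in pM he; have C2 := cost_mono e hM.
apply: (runs_weaken (runs_set Yw sz (bounded_list hg hm) _ iN st)) => //.
  exact: leq_trans (leq_addr _ _) D1.
by apply: leq_trans C1; rewrite leq_add.
Qed.

Lemma runs_setE i e g m s : List.In e exprs -> size g = NG -> nth 0 g gM = pM ->
  all (leq^~ Y) g -> mbound m -> i < NG -> at_ g m s ->
  runs inp w (SetG i e) s (kap pM) (at_ (set_nth 0 g i (eval inp g m [::] e)) m).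
Proof.
move=> he sz hM hg hm iN st.
have D1 := deg_in he; have C1 := cost_in pM he.
apply: (runs_weaken (runs_set Yw sz (bounded_list hg hm) _ iN st)) => //; first by lia.
by rewrite hM; lia.
Qed.

Lemma deg_addr j e : j <= 8 -> deg (addr j e) <= deg (addr 8 e).
Proof. by rewrite /=; lia. Qed.

Lemma runs_fillE j off cnt e g m s offv nn val :
  List.In (addr 8 (O OAdd off (G 18))) exprs -> List.In cnt exprs -> List.In e exprs ->
  j <= 8 -> size g = NG -> nth 0 g gM = pM -> all (leq^~ Y) g -> mbound m ->
  nn <= Y -> (forall k, k < nn -> val k <= Y) ->
  let gk k c := set_nth 0 (set_nth 0 g 18 k) 19 c in
  (forall k c mk, k <= nn -> filled j offv k val m mk ->
     [/\ eval inp (gk k c) mk [::] off = offv, eval inp (gk k c) mk [::] cnt = nn &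
         k < nn -> eval inp (gk k c) mk [::] e = val k]) ->
  eval inp (set_nth 0 g 18 0) m [::] cnt = nn ->
  at_ g m s ->
  runs inp w (Fill j off cnt e) s ((nn + 2) * (4 * kap pM))
    (fun s' => exists2 m', filled j offv nn val m m' & at_ (gk nn 0) m' s').
Proof.
move=> ho hc he j8 sz hM hg hm nY vY gk hk h0 st.
have D1 := deg_in ho; have D2 := deg_in hc; have D3 := deg_in he.
have C1 := cost_in pM ho; have C2 := cost_in pM hc; have C3 := cost_in pM he.
have Da := deg_addr (O OAdd off (G 18)) j8.
apply: (runs_weaken (runs_fill Yw sz (bounded_list hg hm) _ _ _ _ nY vY hk h0 st)) => //; try by lia.
rewrite /fill_cost hM -(cost_addr _ 8).
set c1 := cost _ (addr 8 _) in C1 *; set c2 := cost _ cnt in C2 *; set c3 := cost _ e in C3 *.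
set K := kap pM in C1 C2 C3 *.
apply: leq_trans (_ : 4 * K + nn.+1 * (4 * K) <= _); last by nia.
by apply: leq_add; [lia | rewrite leq_mul2l; apply/orP; right; lia].
Qed.

Definition form (m : nat -> nat) j (X : {set {set 'I_l}}) :=
  forall c, c < pM -> m (8 * (j * pM + c) + 5) = (decode l k c \in X).

Lemma filled_out j off nn val m m' a r : filled j off nn val m m' -> r < 8 -> j < 8 ->
  [\/ r <> j, a < off | off + nn <= a] -> m' (8 * a + r) = m (8 * a + r).
Proof. by move=> [_ h] r8 j8 hd; apply: h => i ii e; case: hd => hd; lia. Qed.

Lemma filled_bound j off nn val m m' : j < 8 -> filled j off nn val m m' ->
  (forall i, i < nn -> val i <= Y) -> mbound m -> mbound m'.
Proof.
move=> j8 hf hv hm b a; have b1 := leq_b1 b.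
have [e|ne] := eqVneq (5 + b) j; last by rewrite (filled_out hf) ?hm//; [lia | apply: Or31; apply/eqP].
have [lt|ge] := ltnP a off; first by rewrite (filled_out hf) ?hm//; [lia | apply: Or32].
have [lt'|ge'] := ltnP a (off + nn).
  by have := hf.1 (a - off); rewrite subnKC// -e => ->; [apply: hv|]; lia.
by rewrite (filled_out hf) ?hm//; [lia | apply: Or33].
Qed.

Lemma branch_correct (X : {set {set 'I_l}}) m s ans sp z y lp mk t i c :
  {in X, forall C : {set 'I_l}, #|C| <= k} -> form m sp X -> mbound m ->
  ans <= Y -> sp + 2 <= Y -> z <= Y -> y <= Y -> lp <= Y -> mk <= Y -> t <= Y ->
  at_ (glob ans sp z y lp mk t i c) m s -> i <= Y -> c <= Y ->
  runs inp w branch s (2 * ((pM + 2) * (4 * kap pM)) + kap pM) (fun s' => exists m',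
    [/\ at_ (glob ans (sp + 2) z y lp mk t pM 0) m' s',
        form m' sp (decode l k (zH l k z) |: X),
        form m' sp.+1 (X :|: petals X (zs l k z) (decode l k (zH l k z))),
        forall a r, r < 8 -> r <> 5 \/ a < sp * pM -> m' (8 * a + r) = m (8 * a + r) &
        mbound m']).
Proof.
move=> Xk fX bm ansY spY zY yY lpY mkY tY st iY cY.
have sp1 : sp <= Y by lia.
pose v1 c := nat_of_bool (decode l k c \in X :|: petals X (zs l k z) (decode l k (zH l k z))).
pose v2 c := nat_of_bool (decode l k c \in decode l k (zH l k z) |: X).
have v1Y i0 : i0 < pM -> v1 i0 <= Y by move=> _; apply: leq_trans (leq_b1 _) (ltnW Y2).
have v2Y i0 : i0 < pM -> v2 i0 <= Y by move=> _; apply: leq_trans (leq_b1 _) (ltnW Y2).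
rewrite (_ : 2 * _ + _ = (pM + 2) * (4 * kap pM) + ((pM + 2) * (4 * kap pM) + kap pM)); last first.
  by rewrite mul2n -addnn -addnA.
apply: runs_seq (runs_fillE (j := 5) (offv := (sp + 1) * pM) (nn := pM) (val := v1)
   _ _ _ _ _ _ _ bm MY v1Y _ _ st) _ => //.
- by in_exprs.
- by in_exprs.
- by in_exprs.
- exact: glob_le.
- move=> i0 c0 mk0 i0M fl; split=> // lt.
  have fX' : form mk0 sp X.
    move=> c1 c1M; rewrite (filled_out fl)//; first exact: fX.
    by apply: Or32; rewrite mulnDl mul1n ltn_add2l.
  exact: (@ev_petal inp (glob ans sp z y lp mk t i0 c0) mk0 l k X
    erefl erefl erefl lM kMc fX' Xk [::] lt).
move=> s1 [m1 fl1 st1].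
have {}st1 : at_ (glob ans sp z y lp mk t pM 0) m1 s1 := st1.
have bm1 : mbound m1 := filled_bound (j := 5) isT fl1 v1Y bm.
have fX1 : form m1 sp X.
  move=> c1 c1M; rewrite (filled_out fl1)//; first exact: fX.
  by apply: Or32; rewrite mulnDl mul1n ltn_add2l.
apply: runs_seq (runs_fillE (j := 5) (offv := sp * pM) (nn := pM) (val := v2)
   _ _ _ _ _ _ _ bm1 MY v2Y _ _ st1) _ => //.
- by in_exprs.
- by in_exprs.
- by in_exprs.
- exact: glob_le.
- move=> i0 c0 mk0 i0M fl; split=> // lt.
  have fX' : mk0 (8 * (sp * pM + i0) + 5) = (decode l k i0 \in X).
    rewrite (filled_out fl)//; first exact: fX1.
    by apply: Or33.
  exact: (@ev_heart inp (glob ans sp z y lp mk t i0 c0) mk0 l k X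
    erefl erefl erefl lM [::] fX').
move=> s2 [m2 fl2 st2].
have {}st2 : at_ (glob ans sp z y lp mk t pM 0) m2 s2 := st2.
have bm2 : mbound m2 := filled_bound (j := 5) isT fl2 v2Y bm1.
apply: (runs_weaken (runs_setE (e := O OAdd (G 10) (K 2)) _ _ _ _ bm2 (isT : 10 < NG) st2)) => //.
- by in_exprs.
- exact: glob_le.
move=> s3 st3; exists m2; split=> //.
- by move=> c1 c1M; rewrite fl2.1.
- move=> c1 c1M; rewrite (filled_out fl2)//; last first.
    by apply: Or33; rewrite mulSn; lia.
  by have := fl1.1 _ c1M; rewrite addn1 => ->.
- move=> a r r8 h; rewrite (filled_out fl2)//; last first.
    by case: h; [apply: Or31 | apply: Or32].
  rewrite (filled_out fl1)//; case: h; [exact: Or31|] => h.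
  by apply: Or32; rewrite mulnDl mul1n; lia.
Qed.

(** * Running one leaf *)

Section LeafRun.
Variables (X : {set {set 'I_l}}) (sp z : nat) (ip : seq nat) (iq : nat -> seq nat).
Variables (sg : state) (tp : nat) (a0 : bool) (m0 : nat -> nat).
Notation Xm := (minimal X).
Hypothesis Xk : {in X, forall C : {set 'I_l}, #|C| <= k}.
Hypothesis fX0 : form m0 sp X.
Hypothesis bm0 : mbound m0.
Hypothesis spY : sp <= Y.
Hypothesis zY : z <= Y.
Hypothesis ipE : forall a,
  nth 0 ip a = if a < 2 + pN * (pd * 3) then pointv k pM Xm pq pN pd a else 0.
Hypothesis iqE : forall y a,
  nth 0 (iq y) a = if a < 3 + pd * 3 then queryv k pM Xm pq pN pd y a else 0.
Hypothesis preE : exec ip w' Pre (init empty_mem) sg tp.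
Hypothesis tpT : tp <= T1.

Definition res (y : nat) :=
  [exists x : 'I_pN, models (fun z : 'I_l => satD pq z x || satQ pq z y) Xm].

Hypothesis queryP : forall y, exists sg' t',
  [/\ exec (iq y) w' Query (init (mem sg)) sg' t', t' <= T2 & (reg sg' 0 != 0) = res y].

Definition same56 (m m' : nat -> nat) :=
  forall (b : bool) a, m' (8 * a + (5 + b)) = m (8 * a + (5 + b)).

(** Reading past the end of an input yields 0, and the copy of the input in memory has to agree. *)
Definition clean2 (m : nat -> nat) := forall a, 3 + pd * 3 <= a -> m (8 * a + 2) = 0.

Definition clean1 (m : nat -> nat) :=
  forall a, 2 + pN * (pd * 3) <= a -> m (8 * a + 1) = 0.

Lemma form_same m m' j Z : same56 m m' -> form m j Z -> form m' j Z.
Proof. by move=> h f c cM; rewrite -(f c cM); exact: (h false). Qed.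

Lemma mbound_same m m' : same56 m m' -> mbound m -> mbound m'.
Proof. by move=> h f b a; rewrite h. Qed.

Lemma same56_trans m1 m2 m3 : same56 m1 m2 -> same56 m2 m3 -> same56 m1 m3.
Proof. by move=> h h' b a; rewrite h' h. Qed.

Lemma same56_keeps s s' : keeps s s' -> same56 (mem s) (mem s').
Proof. by move=> [_ h] b a; rewrite h//; case: b. Qed.

Lemma same56_filled j off nn val m m' : j < 5 -> filled j off nn val m m' -> same56 m m'.
Proof.
move=> j5 hf b a; have b1 := leq_b1 b.
by rewrite (filled_out hf)//; [lia | lia | apply: Or31; lia].
Qed.

(** Queries are asked in decreasing order, and those from [y] on have been asked; [a0] is the answer
    before this leaf. The simulated memory is always that left by [Pre]. *)
Record query_inv (L : seq (nat * nat)) (y : nat) (s : state) : Prop := QueryInv {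
  qi_y : y <= pY;
  qi_at : exists ans t i c, [/\ at_ (glob ans sp z y (size L) (size L) t i c) (mem s) s,
    [&& t <= Y, i <= Y & c <= Y], ans <= 1 &
    (ans != 0) = a0 || [exists y' : 'I_pY, (y <= y') && res y']];
  qi_log : logged (mem sg) L s;
  qi_same : same56 m0 (mem s);
  qi_clean : clean2 (mem s);
  qi_in : clean1 (mem s) }.

Definition query_time := kap pM + ((3 + pd * 3 + 2) * (4 * kap pM) +
  ((R.+1 + 13 * T2) + (1 + (kap pM + (13 * T2 + 2))))).

Lemma sg_small : small w' sg.
Proof. by apply: exec_small preE _; split=> *; rewrite /= expn_gt0. Qed.

Lemma query_step_correct L y s : size L <= T1 -> 0 < y -> query_inv L y s ->
  runs inp w query_step s query_time (query_inv L y.-1).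
Proof.
move=> LT y0 [yP [ans [t [i [c [st /and3P[tY iY cY] ans1 ansE]]]]] lg sm cl ins].
have bm : mbound (mem s) := mbound_same sm bm0.
have LY : size L <= Y by lia.
have yY : y <= Y := leq_trans yP YY.
have ansY : ans <= Y by lia.
have y1Y : y - 1 <= Y by lia.
have in1 : List.In (O OSub (G 14) (K 1)) exprs by in_exprs.
have in2 : List.In (addr 8 (O OAdd (K 0) (G 18))) exprs by in_exprs.
have in3 : List.In cntQ exprs by in_exprs.
have in4 : List.In (queryE k) exprs by in_exprs.
have in5 : List.In (O OLt (K 0) (O OAdd (G 0) (G 17))) exprs by in_exprs.
have g0 := glob_le ansY spY zY yY LY LY tY iY cY.
apply: runs_seq (runs_setE in1 _ _ g0 bm (isT : 14 < NG) st) _ => // s1 st1.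
have {}st1 : at_ (glob ans sp z (y - 1) (size L) (size L) t i c) (mem s) s1 := st1.
have g1 := glob_le ansY spY zY y1Y LY LY tY iY cY.
have qvY a : a < 3 + pd * 3 -> queryv k pM Xm pq pN pd (y - 1) a <= Y.
  move=> _; apply: leq_trans; first exact: queryv_le.
  by rewrite geq_max NY ltnW.
apply: runs_seq (runs_fillE (j := 2) (offv := 0) (nn := 3 + pd * 3)
  in2 in3 in4 _ _ _ g1 bm QY qvY _ _ st1) _ => //.
  move=> i0 c0 mk0 _ fl; split=> // _.
  have fX' : form mk0 sp X.
    exact: form_same (same56_trans sm (same56_filled (j := 2) isT fl)) fX0.
  exact: (@ev_query inp (glob ans sp z (y - 1) (size L) (size L) t i0 c0) mk0 l k X
    pq pN pd erefl erefl lM kMc fX' Xk erefl erefl erefl [::]).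
move=> s2 [m2 fl2 st2].
have {}st2 : at_ (glob ans sp z (y - 1) (size L) (size L) t (3 + pd * 3) 0) m2 s2 := st2.
have em2 : mem s2 = m2 by case: st2.
have sm2 : same56 m0 m2 := same56_trans sm (same56_filled (j := 2) isT fl2).
have lg2 : logged (mem sg) L s2.
  case: lg => h1 h2 h3; split.
  - by move=> a; rewrite em2 -[8 * a]addn0 (filled_out fl2)//; [rewrite addn0|apply: Or31].
  - exact: (st2.1 15 isT).
  - move=> i0 i0L; have [h4 h5] := h3 i0 i0L.
    by rewrite em2 !(filled_out fl2) ?h4 ?h5//; apply: Or31.
have hin : forall a, mem s2 (8 * a + 2) = nth 0 (iq (y - 1)) a.
  move=> a; rewrite em2 iqE; case: ltnP => ha; first by rewrite -(fl2.1 _ ha).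
  by rewrite (filled_out fl2) ?cl//; apply: Or33.
have [sg' [t' [exq t'T resE]]] := queryP (y - 1).
have hmu : forall a, mem sg a < 2 ^ w' by case: sg_small.
have hLt : 8 * (size L + t') + 8 < 2 ^ w.
  by apply: leq_ltn_trans Tw; rewrite leq_add2r leq_mul2l leq_add.
have [s3 [L' [run3 lg3 reg3 k3 [un3 sz3 al3]]]] :=
  @call_correct R 2 w w' inp (iq (y - 1)) Query (mem sg) L s2 sg' t' ww (or_intror erefl)
    lg2 hin exq RQ hmu hLt.
apply: runs_seq (runs_weaken run3 _ (fun s' q => q)) _.
  by rewrite leq_add2l leq_mul2l t'T.
move=> _ <-.
have szLL' : size (L ++ L') <= T1 + T2 by rewrite size_cat leq_add// (leq_trans sz3).
have szLL : size (L ++ L') <= Y := leq_trans szLL' TY.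
have w'w : w' <= w := leq_trans (leq_addr 4 w') ww.
have st3 : at_ (glob ans sp z (y - 1) (size (L ++ L')) (size L) t (3 + pd * 3) 0) (mem s3) s3 :=
  at_keeps (g := glob ans sp z (y - 1) (size L) (size L) t (3 + pd * 3) 0) erefl st2.1 k3 (logged_lp lg3).
have r0 : reg sg' 0 < 2 ^ w'.
  have sm0 : small w' (init (mem sg)) by split=> //= x; rewrite expn_gt0.
  by have [h _] := exec_small exq sm0.
pose s4 := setr s3 34 (reg sg' 0).
have st4 : at_ (glob ans sp z (y - 1) (size (L ++ L')) (size L) (reg sg' 0) (3 + pd * 3) 0) (mem s3) s4.
  exact: (@at_set _ _ _ 17 _ isT st3).
apply: runs_seq (runs_exec (t := 1) (s' := s4) (Q := eq s4) _ _ _) _ => //.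
  apply: exec_set; first by rewrite /= lorn; exact: (reg3 0 R0).
  by apply: leq_trans r0 _; rewrite leq_exp2l.
move=> _ <-.
have rY : reg sg' 0 <= Y by apply: leq_trans wY; exact: ltnW.
have sm3 : same56 m0 (mem s3) by rewrite -em2 in sm2; exact: same56_trans sm2 (same56_keeps k3).
have bm3 : mbound (mem s3) := mbound_same sm3 bm0.
have nlY : 3 + pd * 3 <= Y := QY.
have g4 := glob_le ansY spY zY y1Y szLL LY rY nlY (leq0n Y).
apply: runs_seq (runs_setE in5 _ _ g4 bm3 (isT : 0 < NG) st4) _ => // s5 st5.
pose ans' := nat_of_bool (0 < ans + reg sg' 0).
have {}st5 : at_ (glob ans' sp z (y - 1) (size (L ++ L')) (size L) (reg sg' 0) (3 + pd * 3) 0) (mem s3) s5 := st5.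
have em5 : mem s5 = mem s3 by case: st5.
have lg5 : logged (mem sg') (L ++ L') s5.
  case: lg3 => h1 h2 h3; split; rewrite ?em5//.
  exact: (st5.1 15 isT).
have hun : forall e, e \in L' -> 8 * e.1 < 2 ^ w /\ e.2 < 2 ^ w.
  move=> e /(allP al3) /andP[h1 h2]; split.
    by have := small_addr ww h1 (isT : 0 < 8); rewrite addn0.
  by apply: leq_trans h2 _; rewrite leq_exp2l.
have hw5 : 8 * size (L ++ L') + 8 < 2 ^ w.
  by apply: leq_ltn_trans Tw; rewrite leq_add2r leq_mul2l szLL'.
apply: (runs_weaken (undo_correct inp lg5 (st5.1 16 isT) hw5 hun)).
  by rewrite leq_add2r leq_mul2l (leq_trans sz3).
(* By [un3], undoing the entries of this query brings back the memory left by [Pre]. *)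
move=> s6 [lg6 k6]; rewrite un3 in lg6.
have st6 : at_ (glob ans' sp z (y - 1) (size L) (size L) (reg sg' 0) (3 + pd * 3) 0) (mem s6) s6 :=
  at_keeps (g := glob ans' sp z (y - 1) (size (L ++ L')) (size L) (reg sg' 0) (3 + pd * 3) 0)
    erefl st5.1 k6 (logged_lp lg6).
have k36 a r : r < 8 -> r \notin [:: 0; 3; 4] -> mem s6 (8 * a + r) = m2 (8 * a + r).
  by move=> r8 hr; rewrite k6.2// em5 k3.2// em2.
split=> //.
- exact: leq_trans (leq_pred _) yP.
- exists ans', (reg sg' 0), (3 + pd * 3), 0; rewrite -subn1; split=> //.
  + by rewrite rY nlY.
  + exact: leq_b1.
  + rewrite /ans' eqb0 negbK addn_gt0 !lt0n ansE resE -orbA; congr orb.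
    apply/orP/existsP => [[/existsP[y' /andP[h1 h2]]|h]|[y' /andP[h1 h2]]].
    * by exists y'; rewrite h2 andbT (leq_trans (leq_subr _ _) h1).
    * have lt : y - 1 < pY by apply: leq_trans yP; rewrite subn1 prednK.
      by exists (Ordinal lt); rewrite /= leqnn.
    * move: h1; rewrite leq_eqVlt => /orP[/eqP e|h1]; first by right; rewrite e.
      left; apply/existsP; exists y'; rewrite h2 andbT.
      by move: h1; rewrite subn1 prednK.
- by apply: same56_trans sm3 _; rewrite -em5; exact: same56_keeps.
- by move=> a ha; rewrite k36// (filled_out fl2) ?cl//; apply: Or33.
- by move=> a ha; rewrite k36// (filled_out fl2) ?ins//; apply: Or31.
Qed.

Definition clean (m : nat -> nat) := [/\ forall a, m (8 * a) = 0,
  clean1 m & clean2 m].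

Definition leaf_time := (2 + pN * (pd * 3) + 2) * (4 * kap pM) + ((R.+1 + 13 * T1) +
  (kap pM + (kap pM + ((pY * query_time.+1).+1 + (kap pM + (13 * T1 + 2)))))).

Lemma leaf_run ans y mk t i c s : a0 = (ans != 0) -> ans <= 1 -> clean m0 ->
  at_ (glob ans sp z y 0 mk t i c) m0 s ->
  y <= Y -> mk <= Y -> t <= Y -> i <= Y -> c <= Y ->
  runs inp w leaf s leaf_time (fun s' => exists ans' y' mk' t' i' c',
    [/\ at_ (glob ans' sp z y' 0 mk' t' i' c') (mem s') s',
        [&& y' <= Y, mk' <= Y, t' <= Y, i' <= Y & c' <= Y],
        ans' <= 1 /\ (ans' != 0) = a0 || sat X, clean (mem s') & same56 m0 (mem s')]).
Proof.
move=> a0E ans1 [cl0 cl1 cl2] st yY mkY tY iY cY.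
have ansY : ans <= Y := leq_trans ans1 (ltnW Y2).
have in1 : List.In (addr 8 (O OAdd (K 0) (G 18))) exprs by in_exprs.
have in2 : List.In cntP exprs by in_exprs.
have in3 : List.In (pointE k) exprs by in_exprs.
have in4 : List.In (G 15) exprs by in_exprs.
have in5 : List.In (G 12) exprs by in_exprs.
have inK : List.In (K 0) exprs by in_exprs.
have z0Y := leq0n Y.
have g0 := glob_le ansY spY zY yY z0Y mkY tY iY cY.
set np := 2 + pN * (pd * 3).
have pvY a : a < np -> pointv k pM Xm pq pN pd a <= Y.
  move=> ha; apply: leq_trans; first exact: (pointv_le _ _ _ _ N_gt0 d_gt0 ha).
  by rewrite geq_max dY NY.
apply: runs_seq (runs_fillE (j := 1) (offv := 0) (nn := np)
  in1 in2 in3 _ _ _ g0 bm0 PY pvY _ _ st) _ => //.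
  move=> i0 c0 mk0 _ fl; split=> // _.
  have fX' : form mk0 sp X := form_same (same56_filled (j := 1) isT fl) fX0.
  exact: (@ev_point inp (glob ans sp z y 0 mk t i0 c0) mk0 l k X
    pq pN pd erefl erefl lM kMc fX' Xk erefl erefl erefl [::]).
move=> s2 [m2 fl2 st2].
have {}st2 : at_ (glob ans sp z y 0 mk t np 0) m2 s2 := st2.
have em2 : mem s2 = m2 by case: st2.
have sm2 : same56 m0 m2 := same56_filled (j := 1) isT fl2.
have lg2 : logged empty_mem [::] s2.
  split=> //; last exact: (st2.1 15 isT).
  by move=> a; rewrite em2 -[8 * a]addn0 (filled_out fl2)// ?addn0 ?cl0//; apply: Or31.
have hin : forall a, mem s2 (8 * a + 1) = nth 0 ip a.
  move=> a; rewrite em2 ipE; case: ltnP => ha; first by rewrite -(fl2.1 _ ha).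
  by rewrite (filled_out fl2) ?cl1//; apply: Or33.
have hmu a : empty_mem a < 2 ^ w' by rewrite expn_gt0.
have hLt : 8 * (size (@nil (nat * nat)) + tp) + 8 < 2 ^ w.
  apply: leq_ltn_trans Tw; rewrite add0n leq_add2r leq_mul2l.
  exact: leq_trans tpT (leq_addr _ _).
have [s3 [L [run3 lg3 reg3 k3 [un3 sz3 al3]]]] :=
  @call_correct R 1 w w' inp ip Pre empty_mem [::] s2 sg tp ww (or_introl erefl)
    lg2 hin preE RP hmu hLt.
apply: runs_seq (runs_weaken run3 _ (fun s' q => q)) _.
  by rewrite leq_add2l leq_mul2l tpT.
move=> _ <-; rewrite cat0s in lg3.
have LT : size L <= T1 := leq_trans sz3 tpT.
have LY : size L <= Y := leq_trans LT (leq_trans (leq_addr _ _) TY).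
have st3 : at_ (glob ans sp z y (size L) mk t np 0) (mem s3) s3 :=
  at_keeps (g := glob ans sp z y 0 mk t np 0) erefl st2.1 k3 (logged_lp lg3).
have k3' a r : r < 8 -> r \notin [:: 0; 3; 4] -> mem s3 (8 * a + r) = m2 (8 * a + r).
  by move=> r8 hr; rewrite k3.2// em2.
have sm3 : same56 m0 (mem s3).
  by apply: same56_trans sm2 _; rewrite -em2; exact: same56_keeps.
have bm3 : mbound (mem s3) := mbound_same sm3 bm0.
have g3 := glob_le ansY spY zY yY LY mkY tY PY z0Y.
apply: runs_seq (runs_setE in4 _ _ g3 bm3 (isT : 16 < NG) st3) _ => // s4 st4.
have {}st4 : at_ (glob ans sp z y (size L) (size L) t np 0) (mem s3) s4 := st4.
have g4 := glob_le ansY spY zY yY LY LY tY PY z0Y.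
apply: runs_seq (runs_setE in5 _ _ g4 bm3 (isT : 14 < NG) st4) _ => // s5 st5.
have {}st5 : at_ (glob ans sp z pY (size L) (size L) t np 0) (mem s3) s5 := st5.
have em5 : mem s5 = mem s3 by case: st5.
have hQ : query_inv L pY s5.
  split=> //; rewrite ?em5//.
  - exists ans, t, np, 0; rewrite -em5; split=> //; first by rewrite em5.
    + by rewrite tY PY.
    + rewrite a0E; case: existsP => [[y' /andP[h _]]|]; last by rewrite orbF.
      by move: (ltn_ord y'); rewrite ltnNge h.
  - case: lg3 => h1 h2 h3; split=> //; rewrite ?em5//; exact: (st5.1 15 isT).
  - by move=> a ha; rewrite k3'// (filled_out fl2)// ?cl2//; apply: Or31.
  - by move=> a ha; rewrite k3'// (filled_out fl2)// ?cl1//; apply: Or33.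
have QIs y0 s0 : query_inv L y0 s0 -> reg s0 28 = y0.
  by case=> _ [ans' [t' [i' [c' [[h _] _ _ _]]]]] *; exact: (h 14 isT).
have hstep y0 s0 : query_inv L y0 s0 -> reg s0 28 != 0 ->
   runs inp w query_step s0 query_time (fun s' => exists2 y1, y1 < y0 & query_inv L y1 s').
  move=> hq; rewrite (QIs _ _ hq) -lt0n => y00.
  apply: runs_weaken (query_step_correct LT y00 hq) (leqnn _) _ => s' h.
  by exists y0.-1 => //; rewrite prednK.
apply: runs_seq (runs_while hstep hQ) _ => s6 [r6 [y6 hq6]].
have y60 : y6 = 0 by rewrite -(QIs _ _ hq6).
rewrite y60 in hq6; case: hq6 => _ [ans' [t' [i' [c' [st6 /and3P[t'Y i'Y c'Y] ans'1 ansE]]]]] lg6 sm6 cl6 in6.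
have ans'Y : ans' <= Y := leq_trans ans'1 (ltnW Y2).
have g6 := glob_le ans'Y spY zY z0Y LY LY t'Y i'Y c'Y.
have bm6 : mbound (mem s6) := mbound_same sm6 bm0.
apply: runs_seq (runs_setE inK _ _ g6 bm6 (isT : 16 < NG) st6) _ => // s7 st7.
have {}st7 : at_ (glob ans' sp z 0 (size L) 0 t' i' c') (mem s6) s7 := st7.
have em7 : mem s7 = mem s6 by case: st7.
have lg7 : logged (mem sg) ([::] ++ L) s7.
  case: lg6 => h1 h2 h3; split=> //; rewrite ?em7//; exact: (st7.1 15 isT).
have w'w : w' <= w := leq_trans (leq_addr 4 w') ww.
have hun : forall e, e \in L -> 8 * e.1 < 2 ^ w /\ e.2 < 2 ^ w.
  move=> e /(allP al3) /andP[h1 h2]; split.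
    by have := small_addr ww h1 (isT : 0 < 8); rewrite addn0.
  by apply: leq_trans h2 _; rewrite leq_exp2l.
have hw7 : 8 * size ([::] ++ L) + 8 < 2 ^ w.
  apply: leq_ltn_trans Tw; rewrite leq_add2r leq_mul2l /=.
  exact: leq_trans LT (leq_addr _ _).
apply: (runs_weaken (undo_correct inp lg7 (st7.1 16 isT) hw7 hun)).
  by rewrite leq_add2r leq_mul2l LT.
move=> s8 [lg8 k8]; rewrite un3 in lg8.
have st8 : at_ (glob ans' sp z 0 0 0 t' i' c') (mem s8) s8 :=
  at_keeps (g := glob ans' sp z 0 (size L) 0 t' i' c') erefl st7.1 k8 (logged_lp lg8).
have k8' a r : r < 8 -> r \notin [:: 0; 3; 4] -> mem s8 (8 * a + r) = mem s6 (8 * a + r).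
  by move=> r8 hr; rewrite k8.2// em7.
exists ans', 0, 0, t', i', c'; split=> //.
- by rewrite t'Y i'Y c'Y.
- split=> //; rewrite ansE; congr orb; apply/existsP/existsP.
    move=> [y' /= /existsP[x hx]]; exists x; apply/existsP; exists y'.
    by rewrite -models_minimal.
  move=> [x /existsP[y' hx]]; exists y'; apply/existsP; exists x.
  by rewrite models_minimal.
- split; first exact: logged_mem lg8.
    by move=> a ha; rewrite k8'// in6.
  by move=> a ha; rewrite k8'// cl6.
- by apply: same56_trans sm6 _; rewrite -em7; exact: same56_keeps.
Qed.

End LeafRun.

Hypothesis th_gt0 : forall i, 0 < th i.
Variable Phi : nat -> nat -> nat.
Hypothesis Phi_step : forall a p Z s i H, branches th F0 a p Z ->
  first_flower th Z s i H -> Phi a.+1 p + Phi a.+1 p.+1 < Phi a p.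
Hypothesis Phi_gt0 : forall a p Z, branches th F0 a p Z -> 0 < Phi a p.
Hypothesis PhiPot : Phi 0 0 <= Pot.
Hypothesis leaf_small : forall a p Z, branches th F0 a p Z ->
  (forall s i H, ~~ flower th Z s i H) -> #|minimal Z| <= pd.-1.

Lemma F0k a p Z : branches th F0 a p Z -> {in Z, forall C : {set 'I_l}, #|C| <= k}.
Proof. exact: (branches_size th_gt0 (formula_set_size hF)). Qed.

Lemma sat_branch Z s H : sat Z = sat (H |: Z) || sat (Z :|: petals Z s H).
Proof.
rewrite /sat; apply/existsP/orP => [[x /existsP[y]]|].
  by rewrite (models_branch _ _ s H) => /orP[h|h]; [left|right];
    apply/existsP; exists x; apply/existsP; exists y.
by move=> [] /existsP[x /existsP[y h]]; exists x; apply/existsP; exists y;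
  rewrite (models_branch _ _ s H) h ?orbT.
Qed.

Notation item := ({set {set 'I_l}} * (nat * nat))%type.
Definition item0 : item := (set0, (0, 0)).
(** The variant of the main loop: a leaf removes a positive term, and a branch replaces a term by
    two with a smaller sum. Its initial value bounds both the number of nodes visited and the height
    of the stack. *)
Definition pot (st : seq item) := sumn [seq Phi e.2.1 e.2.2 | e <- st].

Record tree_inv (r : nat) (s : state) : Prop := TreeInv {
  ti : exists (st : seq item) ans z y mk t i c, [/\
    at_ (glob ans (size st) z y 0 mk t i c) (mem s) s,
    [&& z <= Y, y <= Y, mk <= Y, t <= Y, i <= Y & c <= Y],
    forall e, e \in st -> branches th F0 e.2.1 e.2.2 e.1,
    forall j, j < size st -> form (mem s) j (nth item0 st j).1 &
    [/\ r = pot st, ans <= 1 & (ans != 0) || has (fun e => sat e.1) st = sat F0]];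
  ti_pot : r <= Pot;
  ti_clean : clean (mem s);
  ti_bound : mbound (mem s) }.

Definition branch_time := 2 * ((pM + 2) * (4 * kap pM)) + kap pM.
Definition node_time := kap pM + (kap pM + (kap pM + (branch_time + leaf_time).+1)).

Lemma size_pot (st : seq item) : (forall e, e \in st -> branches th F0 e.2.1 e.2.2 e.1) ->
  size st <= pot st.
Proof.
elim: st => //= e st IH h; rewrite -add1n leq_add//.
  by apply: (Phi_gt0 (h e _)); rewrite inE eqxx.
by apply: IH => e' e'st; apply: h; rewrite inE e'st orbT.
Qed.

Lemma pot_rcons st e : pot (rcons st e) = pot st + Phi e.2.1 e.2.2.
Proof. by rewrite /pot map_rcons sumn_rcons. Qed.

Lemma node_correct r s : tree_inv r s -> reg s 20 != 0 ->
  runs inp w node s node_time (fun s' => exists2 r', r' < r & tree_inv r' s').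
Proof.
case=> [[st [ans [z [y [mk [t [i [c [sta /and5P[zY yY mkY tY /andP[iY cY]] hbr hform [rE ans1 satE]]]]]]]]]] rP cl bm] r20.
have sp0 : reg s 20 = size st := sta.1 10 isT.
rewrite sp0 in r20; move: r20 sta hbr hform rE satE {sp0}.
case: (lastP st) => // {}st [Z [a p]] _ sta hbr hform rE satE.
have brZ : branches th F0 a p Z by apply: (hbr (Z, (a, p))); rewrite mem_rcons inE eqxx.
have hbr' e : e \in st -> branches th F0 e.2.1 e.2.2 e.1.
  by move=> h; apply: hbr; rewrite mem_rcons inE h orbT.
have Zk := F0k brZ.
have ansY : ans <= Y := leq_trans ans1 (ltnW Y2).
have szP : size (rcons st (Z, (a, p))) <= Pot by apply: leq_trans rP; rewrite rE size_pot.
have spP : size st + 2 <= Y.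
  apply: leq_trans PotY; rewrite leq_add2r; apply: leq_trans szP.
  by rewrite size_rcons.
have spY : size st <= Y := leq_trans (leq_addr _ _) spP.
have sp1Y : size (rcons st (Z, (a, p))) <= Y := leq_trans szP (leq_trans (leq_addr _ _) PotY).
have z0Y := leq0n Y.
have in1 : List.In (O OSub (G 10) (K 1)) exprs by in_exprs.
have in2 : List.In (findE k th) exprs by in_exprs.
have in3 : List.In (O OLt (G 11) (G 6)) exprs by in_exprs.
have fZ : form (mem s) (size st) Z.
  have := hform (size st); rewrite size_rcons nth_rcons ltnn eqxx /=; exact.
have hform' j : j < size st -> form (mem s) j (nth item0 st j).1.
  by move=> lt; have := hform j; rewrite size_rcons nth_rcons lt; apply; exact: ltnW.
have g0 := glob_le ansY sp1Y zY yY z0Y mkY tY iY cY.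
apply: runs_seq (runs_setE in1 _ _ g0 bm (isT : 10 < NG) sta) _ => // s1 st1.
have {}st1 : at_ (glob ans (size st) z y 0 mk t i c) (mem s) s1.
  by move: st1; rewrite size_rcons /= subn1.
have g1 := glob_le ansY spY zY yY z0Y mkY tY iY cY.
apply: runs_seq (runs_setE in2 _ _ g1 bm (isT : 11 < NG) st1) _ => // s2.
set g := glob ans (size st) z y 0 mk t i c.
rewrite (@ev_find inp g (mem s) l k Z erefl erefl erefl lM kMc fZ Zk th [::]).
set z' := zfind g k Z th => st2.
have {}st2 : at_ (glob ans (size st) z' y 0 mk t i c) (mem s) s2 := st2.
have z'M : z' <= pM by rewrite -[X in _ <= X](size_iota 0) find_size.
have z'Y : z' <= Y := leq_trans z'M MY.
have g2 := glob_le ansY spY z'Y yY z0Y mkY tY iY cY.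
apply: runs_seq (runs_setE in3 _ _ g2 bm (isT : 17 < NG) st2) _ => // s3 st3.
pose t' := nat_of_bool (z' < pM).
have {}st3 : at_ (glob ans (size st) z' y 0 mk t' i c) (mem s) s3 := st3.
have t'Y : t' <= Y := leq_trans (leq_b1 _) (ltnW Y2).
have r34 : reg s3 34 = (z' < pM) := st3.1 17 isT.
have [lt|ge] := ltnP z' pM.
- have ff := @zfind_flower g l k Z erefl erefl erefl lM kMc Zk th lt th_gt0.
  rewrite -/z' in ff.
  have [s4 [t4 [x4 le4 [m4 [st4 fh fp oth bm4]]]]] :=
    branch_correct Zk fZ bm ansY spP z'Y yY z0Y mkY t'Y st3 iY cY.
  exists s4, t4.+1; split.
  + by apply: exec_if_true x4; rewrite r34 lt.
  + by rewrite ltnS (leq_trans le4)// leq_addr.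
  pose H := decode l k (zH l k z').
  pose st' : seq item := rcons (rcons st (H |: Z, (a.+1, p))) (Z :|: petals Z (zs l k z') H, (a.+1, p.+1)).
  have em4 : mem s4 = m4 by case: st4.
  have step := Phi_step brZ ff.
  exists (pot st').
    by rewrite rE /st' !pot_rcons /= -addnA ltn_add2l.
  split.
  + exists st', ans, z', y, mk, t', pM, 0; split.
    * by rewrite em4 /st' !size_rcons -addn2.
    * by rewrite z'Y yY mkY t'Y MY.
    * move=> e; rewrite !(mem_rcons, inE) => /or3P[/eqP ->|/eqP ->|/hbr'//].
        exact: branches_petals brZ ff.
      exact: branches_heart brZ ff.
    * move=> j; rewrite !size_rcons em4 !nth_rcons !size_rcons ltnS leq_eqVlt.
      move=> /orP[/eqP ->|]; first by rewrite ltnn eqxx.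
      move=> lt1; rewrite lt1; move: lt1; rewrite ltnS leq_eqVlt.
      move=> /orP[/eqP ->|lt1]; first by rewrite ltnn eqxx.
      rewrite lt1 => c1 c1M; rewrite oth//; first exact: hform'.
      right; apply: leq_trans (_ : j.+1 * pM <= _); first by rewrite mulSn addnC ltn_add2r.
      by rewrite leq_mul2r lt1 orbT.
    * split=> //; rewrite /st' -satE !has_rcons /= (sat_branch Z (zs l k z') H).
      by rewrite orbA [sat (_ :|: _) || _]orbC -!orbA; congr orb; do !case: sat => //; rewrite ?orbT.
  + apply: leq_trans rP; rewrite rE /st' !pot_rcons /= -addnA leq_add2l; exact: ltnW.
  + rewrite em4; case: cl => c0 c1 c2; split=> [x|x hx|x hx].
    * by rewrite -[8 * x]addn0 oth// ?addn0 ?c0//; left.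
    * by rewrite oth ?c1//; left.
    * by rewrite oth ?c2//; left.
  + by rewrite em4.
- have z'E : z' = pM by apply/eqP; rewrite eqn_leq z'M.
  have nof := @zfind_none g l k Z erefl erefl erefl lM kMc Zk th z'E th_gt0.
  have small := leaf_small brZ nof.
  have mZk : {in minimal Z, forall C : {set 'I_l}, #|C| <= k}.
    by move=> D /minimalP[/Zk].
  have [ip [iq [sg [tp [ipE iqE preE tpT qP]]]]] := leaf_ok mZk small.
  have em3 : mem s3 = mem s by case: st3.
  have [s4 [t4 [x4 le4 [ans' [y' [mk' [t4' [i' [c' [st4 /and5P[y'Y mk'Y t4'Y i'Y c'Y] [ans'1 ansE] cl4 sm4]]]]]]]]]] :=
    leaf_run Zk fZ bm spY z'Y ipE iqE preE tpT qP erefl ans1 cl st3 yY mkY t'Y iY cY.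
  exists s4, t4.+1; split.
  + by apply: exec_if_false x4; rewrite r34 z'E ltnn.
  + by rewrite ltnS (leq_trans le4)// leq_addl.
  exists (pot st); first by rewrite rE pot_rcons -addn1 leq_add2l (Phi_gt0 brZ).
  split=> //.
  + exists st, ans', z', y', mk', t4', i', c'; split=> //.
    * by rewrite z'Y y'Y mk'Y t4'Y i'Y.
    * by move=> j lt; apply: form_same sm4 (hform' j lt).
    * by split=> //; rewrite ansE -satE has_rcons orbA.
  + by apply: leq_trans rP; rewrite rE pot_rcons leq_addr.
  + exact: mbound_same sm4 bm.
Qed.

Definition setup_time := 16 * kap pM + (size F + 2) * (4 * kap pM) + (pM + 2) * (4 * kap pM).

Lemma Yltw : Y < 2 ^ w.
Proof. by apply: leq_ltn_trans Yw; rewrite -{1}(expn1 Y) leq_pexp2l ?(ltnW Y2)// /Deg addnS. Qed.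

Lemma setup_correct : runs inp w setup (init empty_mem) setup_time (tree_inv (Phi 0 0)).
Proof.
have nY' := nY; have FY' := FY; have lY' := lY; have dY' := dY.
have l0Y : l <= Y := ltnW lY'.
have McY : pMc <= Y := leq_trans McM MY.
have NY' : pN <= Y by apply: leq_trans NY; rewrite leq_pmull.
have Y1 : 0 < Y := ltnW Y2.
have kap1 : 1 <= kap pM by rewrite /kap addnS.
have bm : mbound empty_mem by move=> b a.
have st : at_ (nseq 20 0) empty_mem (init empty_mem) by split=> // i _; rewrite nth_nseq if_same.
pose g1 := [:: 0; n; 0; 0; 0; 0; 0; 0; 0; 0; 0; 0; 0; 0; 0; 0; 0; 0; 0; 0].
pose g2 := [:: 0; n; size F; 0; 0; 0; 0; 0; 0; 0; 0; 0; 0; 0; 0; 0; 0; 0; 0; 0].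
pose g3 := [:: 0; n; size F; l; 0; 0; 0; 0; 0; 0; 0; 0; 0; 0; 0; 0; 0; 0; 0; 0].
pose g4 := [:: 0; n; size F; l; l.+1; 0; 0; 0; 0; 0; 0; 0; 0; 0; 0; 0; 0; 0; 0; 0].
pose g5 := [:: 0; n; size F; l; l.+1; pMc; 0; 0; 0; 0; 0; 0; 0; 0; 0; 0; 0; 0; 0; 0].
pose g6 := [:: 0; n; size F; l; l.+1; pMc; pM; 0; 0; 0; 0; 0; 0; 0; 0; 0; 0; 0; 0; 0].
pose g7 := [:: 0; n; size F; l; l.+1; pMc; pM; pq; 0; 0; 0; 0; 0; 0; 0; 0; 0; 0; 0; 0].
pose g8 := [:: 0; n; size F; l; l.+1; pMc; pM; pq; pN; 0; 0; 0; 0; 0; 0; 0; 0; 0; 0; 0].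
pose g9 := [:: 0; n; size F; l; l.+1; pMc; pM; pq; pN; pd; 0; 0; 0; 0; 0; 0; 0; 0; 0; 0].
pose g10 := [:: 0; n; size F; l; l.+1; pMc; pM; pq; pN; pd; 0; 0; 0; 0; 0; 0; 0; n - pq; 0; 0].
have h0 : all (leq^~ Y) (nseq 20 0) by [].
have h1 : all (leq^~ Y) g1 by rewrite /g1 /= nY'.
have h2 : all (leq^~ Y) g2 by rewrite /g2 /= nY' FY'.
have h3 : all (leq^~ Y) g3 by rewrite /g3 /= nY' FY' l0Y.
have h4 : all (leq^~ Y) g4 by rewrite /g4 /= nY' FY' l0Y lY'.
have h5 : all (leq^~ Y) g5 by rewrite /g5 /= nY' FY' l0Y lY' McY.
have h6 : all (leq^~ Y) g6 by rewrite /g6 /= nY' FY' l0Y lY' McY MY.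
have h8 : all (leq^~ Y) g8 by rewrite /g8 /= nY' FY' l0Y lY' McY MY qY NY'.
have h9 : all (leq^~ Y) g9 by rewrite /g9 /= nY' FY' l0Y lY' McY MY qY NY' dY'.
have h10 := glob_le (leq0n Y) (leq0n Y) (leq0n Y) (leq0n Y) (leq0n Y) (leq0n Y)
  (leq_trans (leq_subr pq n) nY') (leq0n Y) (leq0n Y).
have i1 : List.In (In (K 0)) exprs by in_exprs.
have i2 : List.In (In (K 1)) exprs by in_exprs.
have i3 : List.In (O OMul (K 2) (G 1)) exprs by in_exprs.
have i4 : List.In (O OAdd (G 3) (K 1)) exprs by in_exprs.
have i5 : List.In (powE k) exprs by in_exprs.
have i6 : List.In mE exprs by in_exprs.
have i7 : List.In qE exprs by in_exprs.
have i9 : List.In dE exprs by in_exprs.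
have i10 : List.In (O OSub (G 1) (G 7)) exprs by in_exprs.
have i11 : List.In (addr 8 (O OAdd (K 0) (G 18))) exprs by in_exprs.
have i12 : List.In (G 2) exprs by in_exprs.
have i13 : List.In posE exprs by in_exprs.
have i14 : List.In (G 6) exprs by in_exprs.
have i15 : List.In (initE k) exprs by in_exprs.
have i16 : List.In (K 1) exprs by in_exprs.
set K := kap pM in kap1.
set C1 := (size F + 2) * (4 * K); set C2 := (pM + 2) * (4 * K).
suff : runs inp w setup (init empty_mem)
   (K + (K + (K + (K + (K + (K + (K + (1 + (1 + (K + (K + (1 + (1 + (C1 + (C2 + K)))))))))))))))
   (tree_inv (Phi 0 0)).
  move=> h; apply: (runs_weaken h) => //; rewrite /setup_time -/K -/C1 -/C2.
  by clear -kap1; lia.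
rewrite /setup /seqs.
apply: runs_seq (runs_setE0 i1 _ _ h0 bm _ st) _ => // s1 st1.
have {}st1 : at_ g1 empty_mem s1 := st1.
apply: runs_seq (runs_setE0 i2 _ _ h1 bm _ st1) _ => // s2 st2.
have {}st2 : at_ g2 empty_mem s2 := st2.
apply: runs_seq (runs_setE0 i3 _ _ h2 bm _ st2) _ => // s3 st3.
have {}st3 : at_ g3 empty_mem s3 := st3.
apply: runs_seq (runs_setE0 i4 _ _ h3 bm _ st3) _ => // s4 st4.
have {}st4 : at_ g4 empty_mem s4 by move: st4; rewrite /= addn1.
apply: runs_seq (runs_setE0 i5 _ _ h4 bm _ st4) _ => // s5 st5.
have {}st5 : at_ g5 empty_mem s5 by move: st5; rewrite ev_pow.
apply: runs_seq (runs_setE0 i6 _ _ h5 bm _ st5) _ => // s6 st6.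
have {}st6 : at_ g6 empty_mem s6 := st6.
apply: runs_seq (runs_setE i7 _ _ h6 bm _ st6) _ => // s7 st7.
have {}st7 : at_ g7 empty_mem s7 := st7.
have w1 : 1 < 2 ^ w := leq_ltn_trans Y1 Yltw.
apply: runs_seq (runs_exec (t := 1) (s' := setr s7 16 1) (Q := eq (setr s7 16 1)) _ _ _) _ => //.
  exact: exec_set.
move=> _ <-; set s8 := setr _ _ _.
apply: runs_seq (runs_exec (t := 1) (s' := setr s8 16 pN) (Q := eq (setr s8 16 pN)) _ _ _) _ => //.
  apply: exec_set; last exact: leq_ltn_trans NY' Yltw.
  by rewrite /= (st7.1 7 isT) /= mul1n.
move=> _ <-; set s9 := setr _ _ _.
have st9 : at_ g8 empty_mem s9.
  exact: (@at_set _ _ _ 8 pN isT (@at_set _ _ _ 8 1 isT st7)).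
apply: runs_seq (runs_setE i9 _ _ h8 bm _ st9) _ => // s10 st10.
have {}st10 : at_ g9 empty_mem s10 := st10.
apply: runs_seq (runs_setE i10 _ _ h9 bm _ st10) _ => // s11 st11.
have {}st11 : at_ g10 empty_mem s11 := st11.
apply: runs_seq (runs_exec (t := 1) (s' := setr s11 24 1) (Q := eq (setr s11 24 1)) _ _ _) _ => //.
  exact: exec_set.
move=> _ <-; set s12 := setr _ _ _.
apply: runs_seq (runs_exec (t := 1) (s' := setr s12 24 pY) (Q := eq (setr s12 24 pY)) _ _ _) _ => //.
  apply: exec_set; last exact: leq_ltn_trans YY Yltw.
  by rewrite /= (st11.1 17 isT) /= mul1n.
move=> _ <-; set s13 := setr _ _ _.
have st13 : at_ (glob 0 0 0 0 0 0 (n - pq) 0 0) empty_mem s13.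
  exact: (@at_set _ _ _ 12 pY isT (@at_set _ _ _ 12 1 isT st11)).
have pvY i : i < size F -> posv F i <= Y.
  by move=> _; exact: leq_trans (posv_le hF i) posY.
apply: runs_seq (runs_fillE (j := 6) (offv := 0) (nn := size F) (val := posv F)
  i11 i12 i13 _ _ _ h10 bm FY' pvY _ _ st13) _ => //.
  move=> i0 c0 mk0 i0F fl; split=> // lt.
  apply: (@ev_pos n F (glob 0 0 0 0 0 0 (n - pq) i0 c0) mk0 i0 [::]) => // i00.
  by have := fl.1 i0.-1; rewrite add0n; apply; rewrite prednK.
move=> s14 [m14 fl14 st14].
have {}st14 : at_ (glob 0 0 0 0 0 0 (n - pq) (size F) 0) m14 s14 := st14.
have bm14 : mbound m14 := filled_bound (j := 6) isT fl14 pvY bm.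
pose v1 c := nat_of_bool (decode l k c \in F0).
have v1Y i0 : i0 < pM -> v1 i0 <= Y by move=> _; apply: leq_trans (leq_b1 _) Y1.
have h14 := glob_le (leq0n Y) (leq0n Y) (leq0n Y) (leq0n Y) (leq0n Y) (leq0n Y)
  (leq_trans (leq_subr pq n) nY') FY' (leq0n Y).
apply: runs_seq (runs_fillE (j := 5) (offv := 0) (nn := pM) (val := v1)
  i11 i14 i15 _ _ _ h14 bm14 MY v1Y _ _ st14) _ => //.
  move=> i0 c0 mk0 i0F fl; split=> // lt.
  apply: (@ev_init n k F hF (glob 0 0 0 0 0 0 (n - pq) i0 c0) mk0
    erefl erefl erefl lM kM FM [::]) => i iF.
  by rewrite (filled_out fl)//; [rewrite -(fl14.1 i iF) | apply: Or31].
move=> s15 [m15 fl15 st15].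
have {}st15 : at_ (glob 0 0 0 0 0 0 (n - pq) pM 0) m15 s15 := st15.
have bm15 : mbound m15 := filled_bound (j := 5) isT fl15 v1Y bm14.
have h15 := glob_le (leq0n Y) (leq0n Y) (leq0n Y) (leq0n Y) (leq0n Y) (leq0n Y)
  (leq_trans (leq_subr pq n) nY') MY (leq0n Y).
apply: (runs_weaken (runs_setE i16 _ _ h15 bm15 (isT : 10 < NG) st15)) => // s16 st16.
have {}st16 : at_ (glob 0 1 0 0 0 0 (n - pq) pM 0) m15 s16 := st16.
have em16 : mem s16 = m15 by case: st16.
have out a r : r < 5 -> m15 (8 * a + r) = 0.
  move=> r5; have r8 : r < 8 := leq_trans r5 (isT : 5 <= 8).
  rewrite (filled_out fl15)//; last by apply: Or31 => e; rewrite e in r5.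
  by rewrite (filled_out fl14)//; apply: Or31 => e; rewrite e in r5.
split.
- exists [:: (F0, (0, 0))], 0, 0, 0, 0, (n - pq), pM, 0; split.
  + by rewrite em16.
  + by rewrite !leq0n MY (leq_trans (leq_subr pq n) nY').
  + by move=> e; rewrite inE => /eqP ->; exact: branches_root.
  + move=> [|j] // _ c cM; rewrite em16; exact: (fl15.1 c cM).
  + by rewrite /pot /= addn0 orbF.
- exact: PhiPot.
- by rewrite em16; split=> a *; rewrite ?out// -[8 * a]addn0 out.
- by rewrite em16.
Qed.

Definition solver_time := setup_time + (Pot * node_time.+1).+1.

Lemma solver_correct : runs inp w solver (init empty_mem) solver_time
  (fun s => (reg s 0 != 0) = satisfiable F).
Proof.
apply: (runs_weaken (runs_seq setup_correct (fun s h => runs_while node_correct h))).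
  by rewrite leq_add2l ltnS leq_mul2r PhiPot orbT.
move=> s [s20 [r []]] [st [ans [z [y [mk [t [i [c [sta _ _ _ [_ _ satE]]]]]]]]]] _ _ _.
have st0 : size st = 0 by apply: etrans s20; symmetry; exact: (sta.1 10 isT).
rewrite (sta.1 0 isT) /= (satisfiable_split F pq) -/(sat F0) -satE.
by move/size0nil: st0 => ->; rewrite orbF.
Qed.

End Run.
End Program.

Import Order.TTheory GRing.Theory Num.Theory numFieldNormedType.Exports.
Local Open Scope ring_scope.

(** * The gap in the sup norm *)
Section SupNorm.
Variables (R : realType) (d : nat).
Implicit Type v : 'rV[R]_d.

Lemma rV_norm_le v (r : R) : 0 <= r -> (forall j, `|v 0 j| <= r) -> `|v| <= r.
Proof.
move=> r0 h; rewrite /Num.norm /= mx_normrE; apply: bigmax_le => // -[i j] _ /=.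
by rewrite ord1.
Qed.

Lemma rV_coord_le v j : `|v 0 j| <= `|v|.
Proof.
rewrite [leRHS]/Num.norm /= mx_normrE.
exact: (le_bigmax_cond _ (fun ij : 'I_1 * 'I_d => `|v ij.1 ij.2|) (j := (0, j))).
Qed.
End SupNorm.

Definition srat (neg : bool) (a : nat) : rat := if neg then - (a%:R) else a%:R.

Lemma numq_srat (neg : bool) (a : nat) : numq (srat neg a) = if neg then - a%:Z else a%:Z.
Proof.
rewrite /srat; case: neg; rewrite ?numqN -[a%:R]/((a%:Z)%:~R) ?numq_int//.
Qed.

Lemma denq_srat (neg : bool) (a : nat) : denq (srat neg a) = 1.
Proof. by rewrite /srat; case: neg; rewrite ?denqN -[a%:R]/((a%:Z)%:~R) denq_int. Qed.

Lemma encode_srat (neg : bool) a : (neg -> (0 < a)%N) ->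
  encode_rat (srat neg a) = [:: nat_of_bool neg; a; 1%N].
Proof.
move=> h; rewrite /encode_rat denq_srat numq_srat; congr [:: _; _; _].
  rewrite /srat; case: neg h => h; last by rewrite ltNge ler0n.
  by rewrite oppr_lt0 ltr0n h.
by case: neg {h}; rewrite ?abszN.
Qed.

Lemma has_bits_srat L (neg : bool) a : (a < 2 ^ L)%N -> (0 < L)%N -> has_bits L (srat neg a).
Proof.
move=> h L0; rewrite /has_bits denq_srat numq_srat.
have -> : (`|(if neg then - a%:Z else a%:Z)|%N = a) by case: neg; rewrite ?abszN.
by rewrite h /= (leq_trans _ (ltn_expl L (isT : 1 < 2)%N)).
Qed.

Lemma nth_chunk (T S : Type) (x0 : T) (y0 : S) (f : S -> seq T) sz s a :
  (0 < sz)%N -> (forall y, size (f y) = sz) -> (a < size s * sz)%N ->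
  nth x0 (flatten (map f s)) a = nth x0 (f (nth y0 s (a %/ sz))) (a %% sz).
Proof.
move=> sz0 hf; elim: s a => [|y s IH] a /=; first by rewrite mul0n.
move=> ha; rewrite nth_cat hf; case: ltnP => [lt|le].
  by rewrite divn_small// modn_small.
rewrite IH; last by move: ha; rewrite mulSn; lia.
have -> : a = (1 * sz + (a - sz))%N by lia.
by rewrite divnMDl// modnMDl mul1n addKn.
Qed.

Lemma size_chunk (T S : Type) (f : S -> seq T) sz s :
  (forall y, size (f y) = sz) -> size (flatten (map f s)) = (size s * sz)%N.
Proof. by move=> hf; elim: s => //= y s IH; rewrite size_cat hf IH mulSn. Qed.

Lemma size_encode_point d (v : 'rV[rat]_d) : size (encode_point v) = (d * 3)%N.
Proof. by rewrite (size_chunk (sz := 3))// size_enum_ord. Qed.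

Lemma nth_encode_point d (v : 'rV[rat]_d) (j0 : 'I_d) a : (a < d * 3)%N ->
  exists2 j : 'I_d, j = (a %/ 3)%N :> nat &
    nth 0%N (encode_point v) a = nth 0%N (encode_rat (v 0 j)) (a %% 3).
Proof.
move=> ha; have jd : (a %/ 3 < d)%N by rewrite ltn_divLR.
exists (Ordinal jd) => //; rewrite (nth_chunk _ j0 (sz := 3))// ?size_enum_ord//.
by congr (nth _ (encode_rat (v _ _)) _); apply: val_inj; rewrite /= nth_enum_ord.
Qed.

Section Instance.
Variables (R : realType) (l k M : nat) (Fm : {set {set 'I_l}}) (q N d : nat).
Hypothesis N0 : (0 < N)%N.
Hypothesis d0 : (0 < d)%N.

Local Notation dn := (dneg k M Fm q d).
Local Notation da := (dabs k M Fm q N d).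
Local Notation qn := (qneg k M Fm q d).
Local Notation qa := (qabs k M Fm q N d).

Definition data_point (i : 'I_N) : 'rV[rat]_d := \row_j srat (dn i j) (da i j).
Definition query_point (y : nat) : 'rV[rat]_d := \row_j srat (qn y j) (qa y j).
Definition radius : rat := srat false (2 * N).

Lemma da_gt0 i j : dn i j -> (0 < da i j)%N.
Proof. by rewrite /dneg /dabs => /andP[/negbTE -> /negbTE ->]. Qed.

Lemma qa_gt0 i j : qn i j -> (0 < qa i j)%N.
Proof. by rewrite /qneg /qabs => /andP[/negbTE -> ->]; lia. Qed.

Lemma nth_cell (neg : bool) a c : (c < 3)%N -> nth 0%N [:: nat_of_bool neg; a; 1%N] c = cell c neg a.
Proof. by case: c => [|[|[|c]]]. Qed.

Lemma encode_points_pointv a : (a < 2 + N * (d * 3))%N ->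
  nth 0%N (encode_points data_point) a = pointv k M Fm q N d a.
Proof.
case: a => [|[|a]] // ha; rewrite /pointv subn2 /= -[nth _ _ _]/(nth 0%N
   (flatten [seq encode_point (data_point i) | i <- enum 'I_N]) a).
have {}ha : (a < N * (d * 3))%N by [].
have sz0 : (0 < d * 3)%N by rewrite muln_gt0 d0.
rewrite (nth_chunk _ (Ordinal N0) (sz := (d * 3)%N)) ?size_enum_ord//; last first.
  by move=> i; rewrite size_encode_point.
set i := nth (Ordinal N0) _ _.
have iE : i = (a %/ 3 %/ d)%N :> nat.
  by rewrite /i nth_enum_ord ?ltn_divLR// mulnC divnMA.
have [j jE ->] := nth_encode_point (data_point i) (Ordinal d0) (ltn_pmod a sz0).
rewrite mxE encode_srat; last exact: da_gt0.
rewrite nth_cell ?ltn_pmod// -iE.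
have -> : (a %% (d * 3) %% 3 = a %% 3)%N by rewrite modn_dvdm// dvdn_mull.
suff -> : (a %/ 3 %% d)%N = j by [].
rewrite jE {1}(divn_eq a (d * 3)) mulnA divnMDl// modnMDl modn_small//.
by rewrite ltn_divLR// ltn_pmod.
Qed.

Lemma encode_points_out a : (2 + N * (d * 3) <= a)%N ->
  nth 0%N (encode_points data_point) a = 0%N.
Proof.
move=> ha; rewrite nth_default//= (size_chunk (sz := (d * 3)%N)) ?size_enum_ord//.
by move=> i; rewrite size_encode_point.
Qed.

Lemma encode_query_queryv y a : (a < 3 + d * 3)%N ->
  nth 0%N (encode_query radius (query_point y)) a = queryv k M Fm q N d y a.
Proof.
rewrite /encode_query /radius encode_srat//.
case: a => [|[|[|a]]] // ha; rewrite /queryv /= subSS subn2 /=.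
have {}ha : (a < d * 3)%N by [].
have [j jE ->] := nth_encode_point (query_point y) (Ordinal d0) ha.
by rewrite mxE encode_srat ?nth_cell ?ltn_pmod -?jE//; exact: qa_gt0.
Qed.

Lemma encode_query_out y a : (3 + d * 3 <= a)%N ->
  nth 0%N (encode_query radius (query_point y)) a = 0%N.
Proof. by move=> ha; rewrite nth_default// size_cat size_encode_point. Qed.

Lemma data_inj : injective data_point.
Proof.
move=> i i' /rowP e; have dd : (d.-1 < d)%N by rewrite prednK.
have := e (Ordinal dd); rewrite !mxE /dneg /dabs /= prednK// eqxx /=.
by move/eqP; rewrite eqr_nat => /eqP /val_inj.
Qed.

Lemma real_point_diff i y j :
  (real_point R (data_point i) - real_point R (query_point y)) 0 j =
   ratr (srat (dn i j) (da i j) - srat (qn y j) (qa y j)).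
Proof. by rewrite !mxE rmorphB. Qed.

(** The admissible pairs of entries are [(3 N, N)], [(- N, - 3 N)] and [(- N, N)], all at distance
    [2 N]; in the last coordinate the distance is [i < N]. *)
Lemma close_pair (i : 'I_N) y :
  (forall j, (j < d.-1)%N -> ~~ (dataBad k M Fm q j i && queryBad k M Fm q j y)) ->
  `|real_point R (data_point i) - real_point R (query_point y)| <= ratr radius.
Proof.
move=> h; apply: rV_norm_le => [|j]; first by rewrite ler0q ler0n.
rewrite real_point_diff -ratr_norm ler_rat /radius /srat /dneg /qneg /dabs /qabs.
case: eqP => [e|ne] /=.
  rewrite subr0 ger0_norm// ler_nat; have := ltn_ord i; lia.
have /h : (j < d.-1)%N by have := ltn_ord j; lia.
have N0' : 0 <= N%:R :> rat by rewrite ler0n.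
rewrite !natrM; case: dataBad; case: queryBad => //= _; rewrite ler_norml; lra.
Qed.

Lemma far_pair (gamma : R) (i : 'I_N) y j : gamma < 3 -> (j < d.-1)%N ->
  dataBad k M Fm q j i -> queryBad k M Fm q j y ->
  gamma * ratr radius <= `|real_point R (data_point i) - real_point R (query_point y)|.
Proof.
move=> g3 jd hd hq; have jd' : (j < d)%N by lia.
apply: le_trans (rV_coord_le _ (Ordinal jd')).
rewrite real_point_diff /radius /srat /dneg /qneg /dabs /qabs /= hd hq.
have -> : (j.+1 == d) = false by lia.
rewrite /= opprK !rmorphD /= !ratr_nat.
have N0' : 0 <= N%:R :> R by rewrite ler0n.
rewrite ger0_norm; last by lra.
by nra.
Qed.

End Instance.

(** * Growth rates *)
Section Growth.
Variable R : realType.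
Implicit Types (f g : nat -> nat) (c eta : R).

Notation two := (2 : R).

Lemma pow2D (x y : R) : two `^ (x + y) = two `^ x * two `^ y.
Proof. by rewrite powRD// pnatr_eq0 implybT. Qed.

Lemma pow2_nat (n : nat) : two `^ n%:R = (2 ^ n)%N%:R.
Proof. by rewrite powR_mulrn// natrX. Qed.

Lemma pow2_le (x y : R) : x <= y -> two `^ x <= two `^ y.
Proof. by apply: ler_powR; rewrite ler1n. Qed.

Lemma pow2_ge1 (x : R) : 0 <= x -> 1 <= two `^ x.
Proof. by move=> h; rewrite -[leLHS](powRr0 two) pow2_le. Qed.

Lemma ln2_ge : 2^-1 <= ln two.
Proof.
have := @le_ln1Dx R (- 2^-1); rewrite (_ : 1 + - 2^-1 = 2^-1); last by lra.
by rewrite lnV ?posrE// => /(_ ltac:(lra)); lra.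
Qed.

Lemma expR_le_pow2 (x : R) : 0 <= x -> expR x <= two `^ (2 * x).
Proof.
move=> x0; rewrite /powR pnatr_eq0 /= ler_expR; have := ln2_ge; nra.
Qed.

Definition growth f c := exists K : R, 0 <= K /\ forall n, (f n)%:R <= K * two `^ (c * n%:R).
(** These are the functions bounded by [2 ^ o(n)]. *)
Definition slow f := forall eta, 0 < eta -> growth f eta.

Lemma growth_le f g c c' : (forall n, f n <= g n)%N -> c <= c' -> growth g c -> growth f c'.
Proof.
move=> fg cc [K [K0 h]]; exists K; split=> // n.
apply: le_trans (_ : (g n)%:R <= _); first by rewrite ler_nat.
apply: le_trans (h n) _; apply: ler_wpM2l => //.
by apply: pow2_le; rewrite ler_wpM2r.
Qed.

Lemma growth_cst a c : 0 <= c -> growth (fun=> a) c.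
Proof.
move=> c0; exists a%:R; split=> // n; rewrite ler_peMr//.
by apply: pow2_ge1; rewrite mulr_ge0.
Qed.

Lemma growthD f g c : growth f c -> growth g c -> growth (fun n => f n + g n)%N c.
Proof.
move=> [K [K0 h]] [K' [K'0 h']]; exists (K + K'); split; first exact: addr_ge0.
by move=> n; rewrite natrD mulrDl lerD.
Qed.

Lemma growthM f g c c' : growth f c -> growth g c' ->
  growth (fun n => f n * g n)%N (c + c').
Proof.
move=> [K [K0 h]] [K' [K'0 h']]; exists (K * K'); split; first exact: mulr_ge0.
by move=> n; rewrite natrM mulrDl pow2D mulrACA ler_pM.
Qed.

Lemma slow_le f g : (forall n, f n <= g n)%N -> slow g -> slow f.
Proof. by move=> fg h eta e0; apply: growth_le fg (lexx _) (h _ e0). Qed.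

Lemma slow_cst a : slow (fun=> a).
Proof. by move=> eta /ltW; exact: growth_cst. Qed.

Lemma slowD f g : slow f -> slow g -> slow (fun n => f n + g n)%N.
Proof. by move=> h h' eta e0; apply: growthD; [exact: h | exact: h']. Qed.

Lemma slowM f g : slow f -> slow g -> slow (fun n => f n * g n)%N.
Proof.
move=> h h' eta e0; rewrite [eta]splitr; apply: growthM; [apply: h | apply: h'];
  by rewrite divr_gt0.
Qed.

Lemma slow_id : slow id.
Proof.
move=> eta e0; have l2 := ln2_ge; have el : 0 < eta * ln two by apply: mulr_gt0 => //; lra.
exists (eta * ln two)^-1; split; first by rewrite invr_ge0 ltW.
move=> n; rewrite mulrC ler_pdivlMr// /powR pnatr_eq0 /=.
apply: le_trans (expR_ge1Dx _).
rewrite (_ : n%:R * (eta * ln two) = eta * n%:R * ln two); [lra | ring].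
Qed.

Lemma slowX f j : slow f -> slow (fun n => f n ^ j)%N.
Proof.
move=> h; elim: j => [|j IH]; first exact: slow_cst.
by apply: (slow_le _ (slowM h IH)) => n; rewrite expnS.
Qed.

Lemma slow_growthM f g c c' : slow f -> growth g c -> c < c' ->
  growth (fun n => f n * g n)%N c'.
Proof.
move=> h h' cc; have -> : c' = (c' - c) + c by rewrite subrK.
by apply: growthM => //; apply: h; rewrite subr_gt0.
Qed.

Lemma growth_bits f c : growth f c -> exists y, forall n, (f n <= 2 ^ (y * n.+1))%N.
Proof.
move=> [K [K0 h]]; pose a := (Num.truncn K).+1; pose b := (Num.truncn `|c|).+1.
have Ka : K <= a%:R by rewrite ltW// truncnS_gt.
have cb : `|c| <= b%:R by rewrite ltW// truncnS_gt.
exists (a + b)%N => n; rewrite -(ler_nat R); apply: le_trans (h n) _.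
apply: le_trans (_ : (2 ^ a)%:R * two `^ (b * n)%:R <= _).
  apply: ler_pM => //; first exact: powR_ge0.
    by apply: le_trans Ka _; rewrite ler_nat ltnW// ltn_expl.
  apply: pow2_le; rewrite natrM ler_wpM2r//; exact: le_trans (ler_norm _) cb.
by rewrite pow2_nat -natrM -expnD ler_nat leq_exp2l//; nia.
Qed.

End Growth.

(** The sum of the binomial coefficients of [a] over [i] for [i <= p]: the leaves of a branching
    tree of depth [a] with at most [p] petal branches on each path. *)
Fixpoint tree (a p : nat) : nat :=
  match a, p with a'.+1, p'.+1 => (tree a' p + tree a' p')%N | _, _ => 1%N end.

Lemma tree_gt0 a p : (0 < tree a p)%N.
Proof. by elim: a p => [|a IH] [|p] //=; rewrite addn_gt0 IH. Qed.

(** The usual generating function bound [(1 + 1 / x) ^ a * x ^ p] on a partial binomial sum, cleared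
    of denominators. *)
Lemma tree_le a p x : (0 < x)%N -> (tree a p * x ^ a <= x.+1 ^ a * x ^ p)%N.
Proof.
move=> x0; elim: a p => [|a IH] [|p] //=; rewrite ?mul1n ?muln1 ?expn_gt0 ?x0//.
  by rewrite leq_exp2r.
have h1 := IH p.+1; have h2 := IH p.
rewrite mulnDl (expnS x a) (expnS x.+1 a) ![(x * _)%N]mulnC !mulnA.
move: h1 h2; rewrite (expnS x p); set A := (x ^ a)%N; set B := (x.+1 ^ a)%N.
set Cp := (x ^ p)%N; set t1 := tree _ _; set t2 := tree _ _ => h1 h2.
apply: leq_trans (_ : (B * (x * Cp) * x + B * Cp * x <= _)%N).
  by rewrite leq_add// leq_mul.
by apply: eq_leq; ring.
Qed.

(** [tree_le] at [x = 2 ^ e]: the factor [(1 + 1 / x) ^ a] is at most [exp (a / x)], hence at most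
    [exp (l / t)]. *)
Lemma tree_pow2 (R : realType) (a p e l t : nat) : (0 < t)%N ->
  (a * t <= 2 ^ e * l)%N ->
  (tree a p)%:R <= 2 `^ (2 * (l%:R / t%:R) + (e * p)%:R) :> R.
Proof.
move=> t0 ha; have x0 : (0 < 2 ^ e)%N by rewrite expn_gt0.
have xR : 0 < (2 ^ e)%:R :> R by rewrite ltr0n.
have tR : 0 < t%:R :> R by rewrite ltr0n.
have : ((tree a p * (2 ^ e) ^ a)%:R <= ((2 ^ e).+1 ^ a * (2 ^ e) ^ p)%:R :> R).
  by rewrite ler_nat tree_le.
rewrite !natrM !natrX -natrX -ler_pdivlMr ?exprn_gt0// mulrAC -expr_div_n.
move/le_trans; apply; rewrite pow2D; apply: ler_pM => //.
- by rewrite exprn_ge0// divr_ge0.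
- by rewrite exprn_ge0.
- apply: (@le_trans _ _ (expR (l%:R / t%:R))); last by apply: expR_le_pow2; rewrite divr_ge0.
  apply: (@le_trans _ _ (expR (a%:R * (2 ^ e)%:R^-1))); last first.
    rewrite ler_expR ler_pdivrMr// mulrAC ler_pdivlMr// -!natrM ler_nat.
    by rewrite [(l * _)%N]mulnC.
  rewrite expRM_natl lerXn2r ?nnegrE ?expR_ge0 ?divr_ge0//.
  apply: le_trans (expR_ge1Dx _); rewrite -addn1 natrD mulrDl divff ?mul1r//.
  by rewrite lt0r_neq0.
- by rewrite -natrM pow2_nat -natrX -expnM.
Qed.

(** * Choice of parameters *)
Definition expb (f : nat -> nat) := exists y, forall n, (f n <= 2 ^ (y * n.+1))%N.

Lemma expbD f g : expb f -> expb g -> expb (fun n => f n + g n)%N.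
Proof.
move=> [a ha] [b hb]; exists (a + b).+1 => n.
apply: leq_trans (leq_add (ha n) (hb n)) _.
rewrite mulSn expnD mulnDl expnD.
set X := (2 ^ (a * _))%N; set Z := (2 ^ (b * _))%N.
have X0 : (0 < X)%N by rewrite expn_gt0.
have Z0 : (0 < Z)%N by rewrite expn_gt0.
have : (2 <= 2 ^ n.+1)%N by rewrite expnS leq_pmulr// expn_gt0.
set U := (2 ^ n.+1)%N => U2; apply: leq_trans (_ : 2 * (X * Z) <= _)%N; last by rewrite leq_mul.
by nia.
Qed.

Lemma expbM f g : expb f -> expb g -> expb (fun n => f n * g n)%N.
Proof.
move=> [a ha] [b hb]; exists (a + b)%N => n.
by rewrite mulnDl expnD leq_mul.
Qed.

Lemma expb_le f g : (forall n, f n <= g n)%N -> expb g -> expb f.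
Proof. by move=> fg [a ha]; exists a => n; exact: leq_trans (fg n) (ha n). Qed.

Section Params.
Variable R : realType.

(** The left side is linear in [u]. With [u = 2 * v], one factor [2 ^ v] outweighs the constants
    divided by [rho] and the other outweighs the growth in [v]. *)
Lemma petal_rate (k : nat) (rho : R) : 0 < rho -> exists u : nat,
  (4 * (4 + 2 * (k + 2 * k * (u + k + 2) + u) * k))%:R <= rho * (2 ^ u)%:R.
Proof.
move=> rho0; pose c2 := (4 + 2 * (k + 2 * k * (k + 2) + 2 * k + 1) * k)%N.
pose v := (Num.truncn ((8 * c2)%:R / rho)).+1.
have hv : (8 * c2)%:R <= rho * (2 ^ v)%:R.
  rewrite -ler_pdivrMl// mulrC; apply: le_trans (_ : v%:R <= _); first by rewrite ltW// truncnS_gt.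
  by rewrite ler_nat ltnW// ltn_expl.
exists (2 * v)%N; apply: (@le_trans _ _ ((8 * c2)%:R * (2 ^ v)%:R)).
  rewrite -natrM ler_nat; apply: leq_trans (_ : 8 * c2 * v.+1 <= _)%N.
    by rewrite /c2; nia.
  by rewrite leq_mul2l ltn_expl.
have -> : (2 ^ (2 * v))%:R = (2 ^ v)%:R * (2 ^ v)%:R :> R.
  by rewrite -natrM -expnD addnn mul2n.
by rewrite mulrA ler_wpM2r.
Qed.

Definition al u := (2 ^ u)%N.
(** This is the [G] of the counting argument, a power of two that is at least
    [al u * (4 + 2 * k)]. *)
Definition hb k u := (2 ^ (u + k + 2))%N.
Definition thr k u i := (al u * hb k u ^ (2 * i - 1))%N.
Definition alen k u n := (k * hb k u ^ (2 * k) * (2 * n))%N.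
Definition plen k u n := (k * (2 * n) %/ al u)%N.
(** [alen] and [plen] are the bounds of [branches_length] for [2 * n] literals; the factor 2 passes
    from leaves to all nodes of the tree. *)
Definition potn k u n := (2 * tree (alen k u n) (plen k u n))%N.

Lemma al_gt0 u : (0 < al u)%N. Proof. by rewrite expn_gt0. Qed.

Lemma hb_ge k u : (al u * (4 + 2 * k) <= hb k u)%N.
Proof.
rewrite /hb -addnA expnD leq_mul2l; apply/orP; right.
by elim: k => // k IH; rewrite (addSn k) expnS; lia.
Qed.

(** In the exponent of [tree_pow2] the depth contributes [4 * n / al u] and the petal branches
    [2 * e * k * n / al u]; by the choice of [u] they sum to at most [rho * n / 4]. *)
Lemma growth_potn k u (rho : R) : 0 < rho ->
  (4 * (4 + 2 * (k + 2 * k * (u + k + 2) + u) * k))%:R <= rho * (2 ^ u)%:R ->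
  growth (potn k u) (rho / 4).
Proof.
move=> rho0; set e := (k + 2 * k * (u + k + 2) + u)%N => hu.
exists 2; split=> // n; rewrite /potn natrM ler_wpM2l//.
have hA : (alen k u n * al u <= 2 ^ e * (2 * n))%N.
  rewrite /alen mulnAC leq_mul2r; apply/orP; right.
  rewrite /hb /al /e -expnM expnD expnD leq_mul// [(_ * (2 * k))%N]mulnC.
  by rewrite leq_mul// ltnW// ltn_expl.
apply: le_trans (tree_pow2 R _ (al_gt0 u) hA) _; apply: pow2_le.
have aR : 0 < (al u)%:R :> R by rewrite ltr0n al_gt0.
have hP : (plen k u n)%:R <= (k * (2 * n))%:R / (al u)%:R :> R.
  by rewrite ler_pdivlMr// -natrM ler_nat leq_trunc_div.
have hP' : (e * plen k u n)%:R <= e%:R * ((k * (2 * n))%:R / (al u)%:R) :> R.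
  by rewrite natrM ler_wpM2l.
apply: le_trans (lerD (lexx _) hP') _.
have -> : 2 * ((2 * n)%:R / (al u)%:R) + e%:R * ((k * (2 * n))%:R / (al u)%:R) =
  (4 * (4 + 2 * e * k))%:R / (al u)%:R / 4 * n%:R :> R.
  by rewrite !(natrM, natrD); field; rewrite lt0r_neq0.
apply: ler_wpM2r => //; apply: ler_wpM2r; first by rewrite invr_ge0.
by rewrite ler_pdivrMr.
Qed.

Lemma slow_cost e (fM : nat -> nat) : slow R fM -> slow R (fun n => cost (fM n) e).
Proof.
move=> hM; elim: e => /= *; repeat first [apply: slowD | apply: slowM | exact: slow_cst | assumption].
Qed.

Lemma slow_pM k : slow R (pM k).
Proof.
rewrite /pM /pMc; apply: slowD.
  apply: slowM; first exact: slow_cst.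
  apply: slowX; apply: (@slow_le _ _ (fun n => 2 * n + 1)%N) => [n|]; first by rewrite addn1.
  apply: slowD; last exact: slow_cst.
  by apply: slowM; [exact: slow_cst | exact: slow_id].
apply: slowD; last exact: slow_cst.
by apply: slowM; [exact: slow_cst | exact: slow_id].
Qed.

Lemma slow_kap k th sdiv cdim : slow R (fun n => kap k th sdiv cdim (pM k n)).
Proof.
apply: slowD; last exact: slow_cst.
elim: (exprs _ _ _ _) => [|e l IH] /=; first exact: slow_cst.
by apply: slowD => //; exact: slow_cost (slow_pM k).
Qed.

(** * Exponential rates of the running times *)

Section Times.
Variables (s : nat) (C delta KA : R).
Hypothesis s0 : (0 < s)%N.
Hypothesis C0 : 0 <= C.
Hypothesis KA0 : 0 <= KA.
Let sR : 0 < s%:R :> R. Proof. by rewrite ltr0n. Qed.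

Definition Tn (c : R) n := Num.truncn (KA * (pN s n)%:R `^ c).

Lemma pq_ge n : n%:R / s%:R <= (pq s n)%:R :> R.
Proof.
rewrite ler_pdivrMr// -natrM ler_nat /pq addn1 ltnW//.
by rewrite -ltn_divLR.
Qed.

Lemma pq_le n : (pq s n)%:R <= n%:R / s%:R + 1 :> R.
Proof. by rewrite /pq natrD lerD2r ler_pdivlMr// -natrM ler_nat leq_trunc_div. Qed.

Lemma pN_pow n (c : R) : (pN s n)%:R `^ c = 2 `^ ((pq s n)%:R * c) :> R.
Proof. by rewrite /pN -pow2_nat -powRrM. Qed.

Lemma growth_pN : growth (pN s) (s%:R^-1 : R).
Proof.
exists 2; split=> // n; rewrite /pN -pow2_nat -{2}(powRr1 (ler0n R 2)) -pow2D.
by apply: pow2_le; rewrite addrC [_^-1 * _]mulrC pq_le.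
Qed.

Lemma Tn_le c n : (Tn c n)%:R <= KA * (pN s n)%:R `^ c.
Proof. by rewrite /Tn truncn_le mulr_ge0// powR_ge0. Qed.

Lemma growth_TC : growth (Tn C) (C / s%:R).
Proof.
exists (KA * 2 `^ C); split; first by rewrite mulr_ge0// powR_ge0.
move=> n; apply: le_trans (Tn_le _ _) _; rewrite -mulrA ler_wpM2l// pN_pow -pow2D.
apply: pow2_le; have := ler_wpM2r C0 (pq_le n).
have -> : C / s%:R * n%:R = n%:R / s%:R * C by ring.
by rewrite mulrDl mul1r; lra.
Qed.

(** The factor 2 absorbs the case that [pq] is [n + 1], where the subtraction in [pY] truncates. *)
Lemma pY_le n : (pY s n)%:R <= 2 * (2 `^ n%:R * 2 `^ (- (pq s n)%:R)) :> R.
Proof.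
rewrite /pY -pow2_nat -{2}(powRr1 (ler0n R 2)) -!pow2D; apply: pow2_le.
have : (pq s n <= n + 1)%N by rewrite /pq leq_add2r leq_div.
rewrite -(ler_nat R) natrD; case: (leqP (pq s n) n) => h; first by rewrite natrB//; lra.
have -> : (n - pq s n = 0)%N by lia.
by lra.
Qed.

(** Answering has exponent [n - pq + (1 - delta) * pq = n - delta * pq], and the summand 1, which
    stands for handling a query, has [n - pq]; both use [pq >= n / s]. *)
Lemma growth_queries (rho : R) : rho <= delta / s%:R -> rho <= s%:R^-1 -> 0 <= delta ->
  growth (fun n => pY s n * (Tn (1 - delta) n + 1))%N (1 - rho).
Proof.
move=> h1 h2 d0; exists (2 * (KA + 1)); split; first by rewrite mulr_ge0// addr_ge0.
move=> n; rewrite natrM natrD.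
apply: (@le_trans _ _ (2 * (2 `^ n%:R * 2 `^ (- (pq s n)%:R)) * (KA * (pN s n)%:R `^ (1 - delta) + 1))).
  by apply: ler_pM; rewrite ?addr_ge0 ?ler0n// ?pY_le// lerD2r Tn_le.
rewrite -!mulrA ler_wpM2l// [leRHS]mulrDl mul1r mulrA mulrDr mulr1.
have n0 : 0 <= n%:R :> R by [].
apply: lerD.
  rewrite mulrCA ler_wpM2l// pN_pow -!pow2D; apply: pow2_le.
  have := ler_wpM2r d0 (pq_ge n); have := ler_wpM2r n0 h1.
  have -> : delta / s%:R * n%:R = n%:R / s%:R * delta by ring.
  by move=> ? ?; lra.
rewrite -pow2D; apply: pow2_le; have := pq_ge n; have := ler_wpM2r n0 h2.
by rewrite [_^-1 * _]mulrC; lra.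
Qed.

End Times.
End Params.

(** The local definitions repeat [query_time], [leaf_time], [branch_time] and [node_time] for plain
    numbers. The subexponential overhead is gathered in the single factor [B]. *)
Lemma time_arith (Kp d r M N T1 T2 Yc Pot m : nat) :
  let B := ((Kp + 1) * (d + 1) * (r + 1) * (M + 2))%N in
  let qt := (Kp + ((3 + d * 3 + 2) * (4 * Kp) +
    ((r.+1 + 13 * T2) + (1 + (Kp + (13 * T2 + 2))))))%N in
  let lt := ((2 + N * (d * 3) + 2) * (4 * Kp) + ((r.+1 + 13 * T1) +
    (Kp + (Kp + ((Yc * qt.+1).+1 + (Kp + (13 * T1 + 2)))))))%N in
  let bt := (2 * ((M + 2) * (4 * Kp)) + Kp)%N in
  let nt := (Kp + (Kp + (Kp + (bt + lt).+1)))%N in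
  (0 < N)%N -> (0 < Pot)%N -> (m <= M)%N ->
  (16 * Kp + (m + 2) * (4 * Kp) + (M + 2) * (4 * Kp) + (Pot * nt.+1).+1 <=
   70 * (B * (Pot * (N + T1 + Yc * (T2 + 1)))))%N.
Proof.
move=> B qt lt bt nt N0 P0 mM.
have B1 : (Kp + 1 <= B)%N by rewrite /B -!mulnA leq_pmulr// !muln_gt0; lia.
have B2 : ((Kp + 1) * (d + 1) <= B)%N by rewrite /B -(mulnA _ (r + 1)%N) leq_pmulr// muln_gt0; lia.
have B3 : (r + 1 <= B)%N.
  by rewrite /B mulnAC mulnC leq_pmulr// !muln_gt0; lia.
have B4 : ((Kp + 1) * (M + 2) <= B)%N.
  rewrite /B -mulnA -mulnA leq_pmul2l ?addn1// mulnA leq_pmull//.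
have hq : (qt.+1 <= 32 * (B * (T2 + 1)))%N.
  have h1 : ((3 + d * 3 + 2) * (4 * Kp) <= 20 * ((Kp + 1) * (d + 1)))%N by clear; nia.
  have h2 : (T2 <= B * T2)%N by rewrite leq_pmull//; lia.
  by rewrite mulnDr muln1 /qt; lia.
have hq' : (Yc * qt.+1 <= 32 * (B * (Yc * (T2 + 1))))%N.
  by apply: leq_trans (leq_mul (leqnn Yc) hq) _; apply: eq_leq; ring.
have hd : ((2 + N * (d * 3) + 2) * (4 * Kp) <= 16 * (N * B))%N.
  apply: leq_trans (_ : 16 * (N * ((Kp + 1) * (d + 1))) <= _)%N.
    by clear -N0; nia.
  by rewrite leq_mul2l leq_mul2l B2 orbT.
set Q := (Yc * (T2 + 1))%N in hq' *.
have hV : (lt <= 32 * (B * (N + T1 + Q)))%N.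
  have h1 : (lt <= 16 * (N * B) + (5 * B + 26 * T1) + 32 * (B * Q) + 2)%N by rewrite /lt; lia.
  have h2 : (T1 <= B * T1)%N by rewrite leq_pmull//; lia.
  have h3 : (B <= N * B)%N by rewrite leq_pmull.
  by rewrite !mulnDr [(B * N)%N]mulnC; lia.
set U := (N + T1 + Q)%N in hV *.
have U0 : (0 < U)%N by rewrite /U; lia.
have hB : (B <= B * U)%N by rewrite leq_pmulr.
have hn : (nt.+1 <= 47 * (B * U))%N by rewrite /nt /bt; lia.
have hP : (Pot * nt.+1 <= 47 * (B * (Pot * U)))%N.
  by apply: leq_trans (leq_mul (leqnn Pot) hn) _; apply: eq_leq; ring.
have hBP : (B <= B * (Pot * U))%N by rewrite leq_pmulr// muln_gt0 P0.
have hm : ((m + 2) * (4 * Kp) <= (M + 2) * (4 * Kp))%N by rewrite leq_mul2r leq_add2r mM orbT.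
lia.
Qed.

(** Data sets have size [2 ^ q] and [c] is an integer, so the prescribed dimension is exactly the
    product that the program computes. *)
Lemma log_dim_pow2 (R : realType) (c q : nat) :
  log_dim (c%:R : R) (2 ^ q)%N = (c * q)%N.
Proof.
have l2 : ln 2 != 0 :> R by apply: lt0r_neq0; have := ln2_ge R; lra.
rewrite /log_dim.
have -> : ln (2 ^ q)%N%:R / ln 2 = q%:R :> R.
  by rewrite natrX lnXn// -[ln 2 *+ q]mulr_natl mulfK.
rewrite -natrM.
by apply: truncn_def; rewrite lexx ltr_nat /=.
Qed.

Lemma log_bits_pow2 q : log_bits (2 ^ q) = q.+1.
Proof. by rewrite /log_bits trunc_expnK. Qed.

Lemma truncn_bound (R : realType) (t : nat) (x y : R) : t%:R <= x * y -> 0 <= y ->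
  (t <= Num.truncn (`|x| * y))%N.
Proof.
move=> h y0; rewrite truncn_ge_nat ?mulr_ge0//; apply: le_trans h _.
by rewrite ler_wpM2r// ler_norm.
Qed.

(** The guarantee at [b = 2], which is enough because all numbers of an instance are at most
    [3 * N < 2 ^ (2 * log_bits N)]. *)
Definition ann_for (R : realType) (gamma C delta KA : R) (Pre Query : cmd) (W' N d : nat) :=
  forall A : 'I_N -> 'rV[rat]_d, injective A ->
    (forall i j, has_bits (2 * log_bits N) (A i 0 j)) ->
    exists (st : state) (t : nat),
    [/\ exec (encode_points A) (W' * log_bits N) Pre (init empty_mem) st t,
        t%:R <= KA * N%:R `^ C &
        forall (r : rat) (x : 'rV[rat]_d),
          0 < r -> has_bits (2 * log_bits N) r ->
          (forall j, has_bits (2 * log_bits N) (x 0 j)) ->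
          (ann_yes R A r x ->
             answers (encode_query r x) (W' * log_bits N) Query (Defs.mem st)
               (KA * N%:R `^ (1 - delta)) true) /\
          (ann_no gamma A r x ->
             answers (encode_query r x) (W' * log_bits N) Query (Defs.mem st)
               (KA * N%:R `^ (1 - delta)) false)].

Section Ann.
Variables (R : realType) (gamma C delta KA : R) (Pre Query : cmd) (W' s cdim k n : nat).
Notation N := (pN s n).
Notation d := (pd s cdim n).
Notation q := (pq s n).
Notation M := (pM k n).
Notation wA := (W' * log_bits N)%N.
Hypothesis g3 : gamma < 3.
Hypothesis cdim0 : (0 < cdim)%N.
Hypothesis ann : ann_for gamma C delta KA Pre Query W' N d.

(** Every query meets the promise: either [y] extends to a satisfying assignment and some point is
    close, or each point has a clause that both halves falsify and all are far. *)
Lemma ann_leaf (X : {set {set 'I_(2 * n)}}) :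
  {in X, forall Cl : {set 'I_(2 * n)}, (#|Cl| <= k)%N} -> (#|X| <= d.-1)%N ->
  decided k s cdim Pre Query wA (Tn s `|KA| C n) (Tn s `|KA| (1 - delta) n) X.
Proof.
move=> Xk Xd.
have N0 : (0 < N)%N := N_gt0 s n.
have d0 : (0 < d)%N := d_gt0 s n cdim0.
have bits b a : (a <= 3 * N)%N -> has_bits (2 * log_bits N) (srat b a).
  move=> ha; rewrite has_bits_srat ?muln_gt0//.
  apply: leq_ltn_trans ha _; rewrite log_bits_pow2.
  have -> : (2 ^ (2 * q.+1) = 4 * (N * N))%N by rewrite mulnS expnD mul2n -addnn expnD.
  by clear -N0; nia.
have ddle i j : (i < N)%N -> (dabs k M X q N d i j <= 3 * N)%N.
  by move=> iN; apply: dabs_le; exact: ltnW.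
have [st [t [ex tT hq]]] := ann (@data_inj _ k M X q N d d0)
   (fun i j => eq_ind_r (has_bits _) (bits _ _ (ddle i j (ltn_ord i))) (mxE _ _ _ _)).
exists (encode_points (@data_point _ k M X q N d)).
exists (fun y => encode_query (radius N) (query_point k M X q N d y)).
exists st, t; split=> //.
- move=> a; case: ltnP => ha; first exact: encode_points_pointv.
  exact: encode_points_out.
- move=> y a; case: ltnP => ha; first exact: encode_query_queryv.
  exact: encode_query_out.
- by apply: truncn_bound tT _; exact: powR_ge0.
move=> y.
have r0 : 0 < radius N by rewrite /radius /srat ltr0n muln_gt0 N0.
have rb : has_bits (2 * log_bits N) (radius N) by apply: bits; rewrite leq_mul2r orbT.
have qb j : has_bits (2 * log_bits N) (query_point k M X q N d y 0 j).
  by rewrite mxE; apply: bits; exact: qabs_le.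
have kM' : ((2 * n).+1 ^ k <= M)%N := McM k n.
have mb (x : 'I_N) := models_bad q kM' Xk x y Xd.
have [hyes hno] := hq _ _ r0 rb qb.
case: (boolP [exists x : 'I_N, models _ X]) => [/existsP[x hx]|/existsPn hx].
- have [|s' [t' [ex' tT' rE]]] := hyes.
    exists x; apply: close_pair => // j jd.
    by move: hx; rewrite mb => /forallP /(_ (Ordinal jd)).
  by exists s', t'; split=> //; apply: truncn_bound tT' _; exact: powR_ge0.
have [|s' [t' [ex' tT' rE]]] := hno.
  move=> x; have := hx x; rewrite mb => /forallPn[j /negPn/andP[h1 h2]].
  exact: far_pair g3 (ltn_ord j) h1 h2.
by exists s', t'; split=> //; apply: truncn_bound tT' _; exact: powR_ge0.
Qed.

End Ann.

Lemma expb_slow (R : realType) f : slow R f -> expb f.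
Proof. by move=> /(_ 1 ltr01) /growth_bits. Qed.

Lemma expb_cst a : expb (fun=> a).
Proof.
exists a => n; apply: leq_trans (ltnW (ltn_expl a (isT : (1 < 2)%N))) _.
by rewrite leq_exp2l// leq_pmulr.
Qed.

Lemma expb_id : expb id.
Proof.
exists 1%N => n; apply: leq_trans (ltnW (ltn_expl n (isT : (1 < 2)%N))) _.
by rewrite mul1n leq_exp2l.
Qed.

Lemma Tn_mono (R : realType) s (KA c c' : R) n : 0 <= KA -> c <= c' ->
  (Tn s KA c n <= Tn s KA c' n)%N.
Proof.
move=> K0 cc; apply: le_truncn; rewrite ler_wpM2l//; apply: ler_powR => //.
by rewrite ler1n N_gt0.
Qed.

Section Exponents.
Variables (R : realType) (x : R).

Lemma le_half : x <= 2^-1 -> 2^-1 <= 1 - x. Proof. by lra. Qed.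

Lemma lt_eps : 0 < x -> 1 - x / 2 - x / 8 < 1 - x / 2. Proof. by lra. Qed.

Lemma lt_eps2 : 0 < x -> x / 4 + (1 - x) < 1 - x / 2 - x / 8. Proof. by lra. Qed.

End Exponents.

(** * Assembling the k-SAT algorithm *)

Section Solve.
Variables (R : realType) (C delta gamma rho : R) (s k u : nat).
Hypothesis delta0 : 0 < delta.
Hypothesis s2 : (2 <= s)%N.
Hypothesis Cs : C / s%:R <= 2^-1.
Hypothesis C0 : 0 <= C.
Hypothesis rho0 : 0 < rho.
Hypothesis rho1 : rho <= s%:R^-1.
Hypothesis rho2 : rho <= delta / s%:R.
Hypothesis hu : (4 * (4 + 2 * (k + 2 * k * (u + k + 2) + u) * k))%:R <= rho * (2 ^ u)%:R.
Hypothesis g3 : gamma < 3.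

(** A bound on all thresholds, so a leaf has at most [1 + 2 * n * (1 + k * sparsity)] minimal
    clauses. Since [s * pq s n > n], the factor in [cdim] provides that many coordinates and one
    more for the index. *)
Definition sparsity := (al u * hb k u ^ (2 * k))%N.
Definition cdim := (s * (2 * (1 + k * sparsity) + 2))%N.

Lemma cdim_gt0 : (0 < cdim)%N.
Proof. by rewrite muln_gt0 addn2 (ltnW s2). Qed.

Lemma thr_gt0 i : (0 < thr k u i)%N.
Proof. by rewrite muln_gt0 !expn_gt0. Qed.

Lemma pd_ge n : (1 + 2 * n * (1 + k * sparsity) <= (pd s cdim n).-1)%N.
Proof.
rewrite /pd /cdim; set c := (1 + k * sparsity)%N.
have hs : (n < s * pq s n)%N by rewrite /pq addn1 mulnC -ltn_divLR// ltnW.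
rewrite (mulnAC s); apply: leq_trans (_ : (n.+1 * (2 * c + 2)).-1 <= _)%N; first by nia.
by rewrite -!subn1; apply: leq_sub2r; rewrite leq_mul2r hs orbT.
Qed.

Section Node.
Variables (n : nat) (F : cnf n).
Hypothesis hF : is_kcnf k F.
Notation F0 := (formula_set F).
Notation l := (2 * n)%N.

(** The number of nodes of a full binary tree with the given number of leaves: one more than its two
    subtrees together, which makes [Phi_step] strict. *)
Definition Phi a p := (2 * tree (alen k u n - a) (plen k u n - p) - 1)%N.

Lemma branch_bounds a p Z : branches (thr k u) F0 a p Z ->
  (a <= alen k u n)%N /\ (p <= plen k u n)%N.
Proof.
move=> br; have [] := branches_length thr_gt0 (al_gt0 u) (hb_ge k u)
  (fun i _ => erefl) (formula_set_size hF) br.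
by rewrite card_ord => h1 h2; split=> //; rewrite leq_divRL ?al_gt0.
Qed.

Lemma Phi_step a p Z st i H : branches (thr k u) F0 a p Z ->
  first_flower (thr k u) Z st i H -> (Phi a.+1 p + Phi a.+1 p.+1 < Phi a p)%N.
Proof.
(* The bounds hold for the petal child too, so both budgets exceed [a] and [p] and no subtraction
   truncates. *)
move=> br ff; have [h1 h2] := branch_bounds (branches_petals br ff).
rewrite /Phi (_ : alen k u n - a = (alen k u n - a.+1).+1)%N; last by lia.
rewrite (_ : plen k u n - p = (plen k u n - p.+1).+1)%N; last by lia.
rewrite [tree _.+1 _.+1]/=; set t1 := tree _ (_.+1); set t2 := tree _ _.
have t10 : (0 < t1)%N by exact: tree_gt0.
have t20 : (0 < t2)%N by exact: tree_gt0.
by clear -t10 t20; lia.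
Qed.

Lemma Phi_gt0 a p : (0 < Phi a p)%N.
Proof. by rewrite /Phi subn_gt0 leq_pmulr// tree_gt0. Qed.

Lemma leaf_small a p Z : branches (thr k u) F0 a p Z ->
  (forall st i H, ~~ flower (thr k u) Z st i H) -> (#|minimal Z| <= (pd s cdim n).-1)%N.
Proof.
move=> br nof; have Zk := branches_size thr_gt0 (formula_set_size hF) br.
apply: leq_trans (minimal_sparse (c := sparsity) Zk nof _) _ => [i ik|].
  rewrite leq_mul2l leq_pexp2l ?orbT ?expn_gt0//; lia.
by rewrite card_ord pd_ge.
Qed.

End Node.

Variables (Pre Query : cmd) (W' RR : nat) (KA : R).
Hypothesis RP : regs_below RR Pre.
Hypothesis RQ : regs_below RR Query.
Hypothesis RR0 : (0 < RR)%N.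
Hypothesis ann : forall N d, (0 < N)%N -> d = log_dim (cdim%:R : R) N ->
  ann_for gamma C delta KA Pre Query W' N d.

Notation T1 := (Tn s `|KA| C).
Notation T2 := (Tn s `|KA| (1 - delta)).

(** The summands are the quantities that [solver_correct] wants below [Y]; one exponential bound on
    their sum yields [Y]. *)
Lemma expb_total : expb (fun n => (potn k u n + 2) + (pM k n + (pq s n + (pY s n +
  ((2 + pN s n * (pd s cdim n * 3)) + (3 * pN s n + ((3 + pd s cdim n * 3) +
  ((2 + pM k n * (1 + 2 * k)) + ((T1 n + T2 n) + (2 ^ (W' * log_bits (pN s n)) + 2))))))))))%N.
Proof.
have s0 : (0 < s)%N := ltnW s2.
have eM : expb (pM k) := expb_slow (@slow_pM R k).
have eq : expb (pq s).
  apply: expb_le (expbD expb_id (expb_cst 1)) => n.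
  by rewrite leq_add2r leq_div.
have ed : expb (fun n => pd s cdim n) by apply: expbM => //; exact: expb_cst.
have eN : expb (pN s) := growth_bits (growth_pN R s0).
have eP : expb (potn k u) := growth_bits (growth_potn rho0 hu).
have eY : expb (pY s).
  by exists 1%N => n; rewrite mul1n /pY leq_exp2l//; lia.
have e1 : expb T1 := growth_bits (growth_TC s0 C0 (normr_ge0 KA)).
have e2 : expb T2.
  apply: expb_le (growth_bits (growth_TC s0 (@ler01 R) (normr_ge0 KA))) => n.
  by apply: Tn_mono; [exact: normr_ge0 | rewrite gerBl ltW].
have eW : expb (fun n => 2 ^ (W' * log_bits (pN s n)))%N.
  exists (2 * W')%N => n; rewrite log_bits_pow2 leq_exp2l// mulnAC mulnC leq_mul2r.
  by have := leq_div n s; rewrite /pq => h; apply/orP; right; lia.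
do !first [assumption | exact: expb_cst | apply: expbD | apply: expbM].
Qed.

Lemma ksat_solvable : ksat_solvable_in_time k (fun n => 2 `^ ((1 - rho / 2) * n%:R) : R).
Proof.
have s0 : (0 < s)%N := ltnW s2.
have sR : (2 : R) <= s%:R by rewrite ler_nat.
have [y hy] := expb_total.
set th := thr k u; set DD := Deg k th s cdim.
pose B n := ((kap k th s cdim (pM k n) + 1) * (pd s cdim n + 1) * (RR + 1) * (pM k n + 2))%N.
have slowB : slow R B.
  apply: slowM; last by apply: slowD; [exact: slow_pM | exact: slow_cst].
  apply: slowM; last exact: slow_cst.
  apply: slowM; first by apply: slowD; [exact: slow_kap | exact: slow_cst].
  apply: slowD; last exact: slow_cst; apply: slowM; first exact: slow_cst.
  apply: (@slow_le _ _ (fun n => n + 1)%N) => [n|]; first by rewrite leq_add2r leq_div.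
  by apply: slowD; [exact: slow_id | exact: slow_cst].
have rhoh : rho <= 2^-1.
  by apply: le_trans rho1 _; rewrite lef_pV2 ?posrE// (lt_le_trans _ sR).
(* The first two terms have exponent at most [1 / 2], which is at most [1 - rho]. *)
have gV : growth (fun n => pN s n + T1 n + pY s n * (T2 n + 1))%N (1 - rho).
  apply: growthD; first apply: growthD.
  - apply: growth_le (growth_pN R s0) => //.
    apply: le_trans (le_half rhoh); rewrite lef_pV2 ?posrE//.
    exact: lt_le_trans sR.
  - by apply: growth_le (growth_TC s0 C0 (normr_ge0 KA)) => //; exact: le_trans Cs (le_half rhoh).
  - by apply: growth_queries => //; exact: ltW.
have gP := growth_potn rho0 hu.
(* The leaf time and the number of nodes give [1 - 3 rho / 4]; the overhead [B] raises this to
   [1 - 5 rho / 8], and the constant to [1 - rho / 2]. *)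
have gT : growth (fun n => 70 * (B n * (potn k u n * (pN s n + T1 n + pY s n * (T2 n + 1)))))%N
    (1 - rho / 2).
  apply: (@slow_growthM _ (fun=> 70%N) _ (1 - rho / 2 - rho / 8)); last exact: lt_eps.
    exact: slow_cst.
  apply: (@slow_growthM _ B _ (rho / 4 + (1 - rho))) => //; last exact: lt_eps2.
  exact: growthM.
have [KT [KT0 hT]] := gT.
(* Data are below [Y = 2 ^ (y.+1 * n.+1)] and intermediate values at most [Y ^ DD], so [DD.+1] times
   the length of [Y] suffices. *)
exists (solver k th s cdim Pre Query RR), (y.+1 * DD.+1)%N, KT => n F hF.
have /= hyn := hy n.
set Y := (2 ^ (y.+1 * n.+1))%N.
have hY : (2 ^ (y * n.+1) <= Y)%N by rewrite leq_exp2l// leq_mul2r leqnSn orbT.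
set w := (y.+1 * DD.+1 * n.+1)%N.
have D5 : (5 <= DD)%N by rewrite /DD /Deg leq_addl.
pose w' := (W' * log_bits (pN s n))%N.
have yn0 : (0 < y.+1 * n.+1)%N by [].
have ew : w = (y.+1 * n.+1 * DD.+1)%N by rewrite /w mulnAC.
have FMn : (size F <= pM k n)%N := FM hF.
have hYall := leq_trans hyn hY.
have [st [t [ex tT res]]] : runs (encode_cnf F) w (solver k th s cdim Pre Query RR)
    (init empty_mem) (solver_time k th s cdim RR F (T1 n) (T2 n) (potn k u n))
    (fun st => (reg st 0 != 0%N) = satisfiable F).
  have TY : (T1 n + T2 n <= Y)%N by clear -hYall; lia.
  have wY : (2 ^ w' <= Y)%N by rewrite /w'; clear -hYall; lia.
  have Y2 : (1 < Y)%N by clear -hYall; lia.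
  have ww : (w' + 4 <= w)%N.
    have : (w' <= y.+1 * n.+1)%N by rewrite -(leq_exp2l _ _ (isT : 1 < 2)%N).
    by rewrite ew; clear -D5 yn0; nia.
  apply: (@solver_correct k th s cdim Pre Query RR n F hF w w' Y) => //.
  - by rewrite -expnM ltn_exp2l// ew ltn_mul2l yn0 /=.
  - apply: leq_ltn_trans (_ : 2 ^ (4 + y.+1 * n.+1) < _)%N.
      by rewrite expnD -/Y; clear -TY Y2; lia.
    by rewrite ltn_exp2l// ew; clear -D5 yn0; nia.
  - by clear -hYall; lia.
  - by clear -hYall; lia.
  - by clear -hYall; lia.
  - by clear -hYall; lia.
  - by clear -hYall; lia.
  - by clear -hYall; lia.
  - by clear -hYall; lia.
  - apply: leq_trans (_ : 2 + pM k n * (1 + 2 * k) <= _)%N; last by clear -hYall; lia.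
    by rewrite leq_add2l leq_mul2r FMn orbT.
  - exact: cdim_gt0.
  - move=> X Xk Xd; apply: (ann_leaf g3 cdim_gt0 _ Xk Xd).
    by apply: ann; rewrite ?N_gt0// log_dim_pow2.
  - exact: thr_gt0.
  - exact: Phi_step.
  - by move=> *; exact: Phi_gt0.
  - by rewrite /Phi !subn0 /potn leq_subr.
  - exact: leaf_small.
exists st, t; split=> //.
apply: le_trans (hT n); rewrite ler_nat; apply: leq_trans tT _.
by apply: time_arith; rewrite ?N_gt0// muln_gt0 tree_gt0.
Qed.

End Solve.

Theorem theorem3p8 (R : realType) (seth : SETH R)
    (delta C : R) (hdelta : 0 < delta) (hC : 1 < C) :
  exists c : R, 0 < c /\
    forall gamma : R, 1 < gamma -> gamma < 3 ->
      ~ ann_solvable_in_time gamma (log_dim c)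
          (fun N => N%:R `^ C) (fun N => N%:R `^ (1 - delta)).
Proof.
(* The offset ensures both [s > 2 * C] and [s >= 2]. *)
pose s := (Num.truncn (2 * C)).+2.
have sR : 0 < s%:R :> R by rewrite ltr0n.
have C0 : 0 <= C by exact: ltW (lt_trans ltr01 hC).
have Cs : C / s%:R <= 2^-1.
  rewrite ler_pdivrMr// mulrC ler_pdivlMr// mulrC ltW//.
  by apply: lt_trans (truncnS_gt _) _; rewrite ltr_nat.
pose rho := Num.min s%:R^-1 (delta / s%:R).
have rho0 : 0 < rho by rewrite lt_min invr_gt0 sR divr_gt0.
have rho1 : rho <= s%:R^-1 by rewrite ge_min lexx.
have rho2 : rho <= delta / s%:R by rewrite ge_min lexx orbT.
(* [rho] depends only on [C] and [delta], hence so do [k], [u] and the dimension constant. *)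
have [k hk] := seth (rho / 2) (divr_gt0 rho0 (ltr0Sn _ 1)).
have [u hu] := petal_rate k rho0.
exists (cdim s k u)%:R; split; first by rewrite ltr0n cdim_gt0.
move=> gamma _ g3 [Pre [Query ann]]; apply: hk.
have [R1 h1] := regs_below_exists Pre.
have [R2 h2] := regs_below_exists Query.
have [W [KA hann]] := ann 2.
apply: (@ksat_solvable _ C delta gamma rho s k u hdelta isT Cs C0 rho0 rho1 rho2 hu g3
  Pre Query W (R1 + R2).+1 KA) => // [||N d N0 dE A].
- by apply: regs_below_le h1; rewrite leqW ?leq_addr.
- by apply: regs_below_le h2; rewrite leqW ?leq_addl.
- exact: hann.
Qed.
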